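(* Let $N=3$, let $\Omega\subset\mathbb{R}^3$ be a bounded domain with smooth boundary, and let $b>0$, $\lambda\in\mathbb{R}$, $\mu<0$ satisfy $$\frac{bS^3}{12}+\frac{(4+b^2S^3)\left(bS^3+\sqrt{b^2S^6+4S^3}\right)}{24}+\frac{\mu}{2}e^{-\frac{\lambda}{\mu}}|\Omega|>0 .$$ Then the problem $$-\Big(1+b\int_\Omega|\nabla u|^2\,dx\Big)\Delta u=\lambda u+\mu u\log u^2+|u|^{4}u\ \text{ in }\Omega,\qquad u=0\ \text{ on }\partial\Omega,$$ has a local minimum solution with negative energy, i.e. there is a weak solution $u\in H_0^1(\Omega)$ that is a local minimizer of the energy functional $I$ and satisfies $I(u)<0$.
   Context: Notation: $\|u\|:=\|\nabla u\|_{L^2(\Omega)}$ is the norm of $H_0^1(\Omega)$, $\|\cdot\|_p$ is the $L^p(\Omega)$ norm, $|\Omega|$ is Lebesgue measure, and $2^*=6$ for $N=3$. The best Sobolev constant is $S=\inf_{u\in H_0^1(\Omega)\setminus\{0\}}\|u\|^2/\|u\|_{2^*}^2$. The convention $u\log u^2=0$, $u^2\log u^2=0$ at $u=0$ is used. Energy functional: $I(u)=\frac12\|u\|^2+\frac b4\|u\|^4-\frac\lambda2\|u\|_2^2+\frac\mu2\|u\|_2^2-\frac\mu2\int_\Omega u^2\log u^2\,dx-\frac16\|u\|_6^6$ on $H_0^1(\Omega)$; it is $C^1$. A weak solution is $u\in H_0^1(\Omega)$ with $(1+b\|u\|^2)\int_\Omega\nabla u\cdot\nabla\phi\,dx-\lambda\int_\Omega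 u\phi\,dx-\mu\int_\Omega u\phi\log u^2\,dx-\int_\Omega|u|^{4}u\phi\,dx=0$ for all $\phi\in H_0^1(\Omega)$, i.e. a critical point of $I$. A local minimum solution is a weak solution that is a local minimizer of $I$ in $H_0^1(\Omega)$. *)

(* Defs.v *)
From HB Require Import structures.
From mathcomp Require Export all_boot all_order all_algebra.
From mathcomp Require Export all_classical all_reals all_analysis.

Set Implicit Arguments.
Unset Strict Implicit.
Unset Printing Implicit Defensive.

Import Order.TTheory GRing.Theory Num.Theory.
Import numFieldNormedType.Exports.

Local Open Scope classical_set_scope.
Local Open Scope ring_scope.

(* Functions on Omega are represented by functions on the whole space whose
   values outside Omega are irrelevant, and elements of L^p(Omega) and of
   Sobolev spaces by Borel representatives. *)

Section space.
Context {R : realType}.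

Definition leb3 : {measure
    set (measurableTypeR R * measurableTypeR R * measurableTypeR R)%type
    -> \bar R} :=
  ((@lebesgue_measure R \x @lebesgue_measure R) \x @lebesgue_measure R)%E.

Definition ebasis (i : 'I_3) : R * R * R :=
  ((i == 0 :> nat)%:R, (i == 1 :> nat)%:R, (i == 2 :> nat)%:R).

Definition coord3 (i : 'I_3) (x : R * R * R) : R :=
  nth 0 [:: x.1.1; x.1.2; x.2] i.

Definition drop_coord3 (i : 'I_3) (x : R * R * R) : R * R :=
  if val i is 0 then (x.1.2, x.2)
  else if val i is 1 then (x.1.1, x.2)
  else (x.1.1, x.1.2).

End space.

Section smoothness.
Context {R : realType}.

(* In a finite-dimensional V, derivatives along all directions exist and are
   continuous as soon as those along a basis do, so this is the usual C^k. *)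
Fixpoint Ck (V : normedModType R) (k : nat) (f : V -> R) : Prop :=
  continuous f /\
  if k is k'.+1 then
    forall v, (forall x, derivable f x v) /\ Ck k' (fun x => 'D_v f x)
  else True.

Definition smooth (V : normedModType R) (f : V -> R) : Prop :=
  forall k, Ck k f.

Definition boundary (A : set (R * R * R)) := closure A `\` interior A.

(* Near each boundary point Omega is, up to relabelling and reversing the
   coordinate axes, the region above the graph of a C^infinity function. *)
Definition smooth_boundary (Omega : set (R * R * R)) : Prop :=
  forall p, boundary Omega p ->
  exists (i : 'I_3) (s : bool) (gamma : R * R -> R),
    smooth gamma /\
    \forall x \near p,
      Omega x <-> 0 < (-1) ^+ s * (coord3 i x - gamma (drop_coord3 i x)).

Definition bounded_smooth_domain (Omega : set (R * R * R)) : Prop :=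
  [/\ Omega !=set0, open Omega, connected Omega, bounded_set Omega
    & smooth_boundary Omega].

End smoothness.

Section sobolev.
Context {R : realType} (Omega : set (R * R * R)).
Implicit Types (u v g phi : R * R * R -> R).

Definition test_function phi : Prop :=
  [/\ smooth phi, compact (closure [set x | phi x != 0])
    & closure [set x | phi x != 0] `<=` Omega].

Definition mem_L2 u : Prop := (u \_ Omega) \in Lfun leb3 2%:E.

Definition norm_Lp (p : R) u : R :=
  fine 'N[leb3]_(p%:E)[EFin \o (u \_ Omega)].

Definition weak_partial (i : 'I_3) u g : Prop :=
  mem_L2 g /\
  forall phi, test_function phi ->
    \int[leb3]_(x in Omega) (u x * 'D_(ebasis i) phi x) =
    - \int[leb3]_(x in Omega) (g x * phi x).

Definition mem_H1 u : Prop :=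
  mem_L2 u /\ forall i, exists g, weak_partial i u g.

(* Weak partial derivatives are unique up to null sets, so nothing below
   depends on the choice made here. *)
Definition wpartial (i : 'I_3) u : R * R * R -> R :=
  xget (cst 0) [set g | weak_partial i u g].

Definition dot_grad u v : R :=
  \int[leb3]_(x in Omega) (\sum_(i < 3) wpartial i u x * wpartial i v x).

Definition norm_H01 u : R := Num.sqrt (dot_grad u u).

Definition norm_H1 u : R :=
  Num.sqrt (norm_Lp 2 u ^+ 2 + norm_H01 u ^+ 2).

Definition mem_H01 u : Prop :=
  mem_H1 u /\
  exists phi : nat -> R * R * R -> R,
    (forall n, test_function (phi n)) /\
    norm_H1 (u \- phi n) @[n --> \oo] --> (0 : R).

(* The norms in the quotient are finite on H_0^1, by the Sobolev embedding. *)
Definition sobolev_constant : R :=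
  inf [set norm_H01 u ^+ 2 / norm_Lp 6 u ^+ 2
      | u in [set u | mem_H01 u /\ ~ {ae leb3, forall x, Omega x -> u x = 0}]].

Definition volume : R := fine (leb3 Omega).

End sobolev.

(* The library's ln vanishes at 0, whence u^2 log u^2 = u log u^2 = 0 where
   u = 0. *)
Section kirchhoff_problem.
Context {R : realType} (Omega : set (R * R * R)) (b lambda mu : R).
Implicit Types (u v phi : R * R * R -> R).

Definition energy u : R :=
  1 / 2 * norm_H01 Omega u ^+ 2 + b / 4 * norm_H01 Omega u ^+ 4
  - lambda / 2 * norm_Lp Omega 2 u ^+ 2 + mu / 2 * norm_Lp Omega 2 u ^+ 2
  - mu / 2 * \int[leb3]_(x in Omega) (u x ^+ 2 * ln (u x ^+ 2))
  - 1 / 6 * norm_Lp Omega 6 u ^+ 6.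

Definition weak_solution u : Prop :=
  mem_H01 Omega u /\
  forall phi, mem_H01 Omega phi ->
    (1 + b * norm_H01 Omega u ^+ 2) * dot_grad Omega u phi
    - lambda * \int[leb3]_(x in Omega) (u x * phi x)
    - mu * \int[leb3]_(x in Omega) (u x * phi x * ln (u x ^+ 2))
    - \int[leb3]_(x in Omega) (`|u x| ^+ 4 * u x * phi x) = 0.

Definition local_minimizer u : Prop :=
  mem_H01 Omega u /\
  exists2 rho : R, 0 < rho &
    forall v, mem_H01 Omega v -> norm_H01 Omega (v \- u) < rho ->
      energy u <= energy v.

Definition local_minimum_solution u : Prop :=
  weak_solution u /\ local_minimizer u.

End kirchhoff_problem.

(* Main.v *)
From HB Require Import structures.
Require Import Defs.
From mathcomp Require Import ring lra measurable_realfun.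
Import Order.TTheory GRing.Theory Num.Theory.
Import numFieldNormedType.Exports.
Local Open Scope classical_set_scope.
Local Open Scope ring_scope.

Set Implicit Arguments.
Unset Strict Implicit.
Unset Printing Implicit Defensive.

(* On the sphere of H^1_0 where the squared gradient norm s equals
   s0 = (b S^3 + sqrt (b^2 S^6 + 4 S^3)) / 2, the Sobolev inequality and the
   bound t^2 log t^2 >= (L + 1) t^2 - e^L with L = - lambda / mu show that the
   energy is at least the quantity assumed to be positive.  Inside the sphere
   the energy takes negative values, since the term - mu t^2 log t of t w
   dominates as t -> 0.  So a minimizer over the closed ball, if there is one,
   is interior, and hence a weak solution and a local minimizer.  For existence,
   a minimizing sequence converges in L^2 along a subsequence (Rellich) to some
   u in H^1_0, with gradients converging weakly.  By the Brezis-Lieb splitting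
   the energy lost in the limit is about s/2 + b s^2/4 - s^3/(6 S^3), where s is
   the squared gradient norm of the difference, and this is nonnegative for
   s <= s0.  The assumption forces S > 0, as the left-hand side is nonpositive
   for S = 0, so the Sobolev inequality itself needs no proof. *)

(** * Square-integrable functions *)

(** The second derivative of s^2 log s^2 tends to minus infinity at 0. Since [mu] is negative, the
    argument only asks for an upper bound of this function: along a line through the minimizer it
    bounds the energy from above by a parabola in t, and minimality for both signs of t forces the
    linear coefficient, which is the first variation, to vanish.

    Compactness starts in L^1. On a small cell a test function with bounded gradient is close to a
    constant, and the constants of all cells converge together along an ultrafilter; the L^6 bound
    then lifts L^1 to L^2. The weak gradient of the L^2 limit is found by minimizing the squared
    gradient norm among the pairs that approximate the limit: the parallelogram law makes a
    minimizing sequence of gradients Cauchy.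

    The Kirchhoff term is nonlocal, so splitting a sequence into its limit and a remainder produces
    a product of the two squared gradient norms. That product is nonnegative and enters with the
    sign of [b], hence helps lower semicontinuity. *)

Section integrable_functions.
Context d (T : measurableType d) (R : realType).
Variables (mu : {measure set T -> \bar R}) (D : set T).
Implicit Types f g h : T -> R.

Definition L1 (f : T -> R) := mu.-integrable D (EFin \o f).

Definition L2 (f : T -> R) := measurable_fun D f /\ L1 (fun x => f x ^+ 2).

Definition L2_ip (f g : T -> R) : R := \int[mu]_(x in D) (f x * g x).
Notation ip := L2_ip.

Definition L2_sqn (f : T -> R) : R := \int[mu]_(x in D) (f x ^+ 2).
Notation sqn := L2_sqn.

Hypothesis mD : measurable D.

Lemma L1_measurable f : L1 f -> measurable_fun D f.
Proof. by move=> /(measurable_int mu) /measurable_EFinP. Qed.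

Lemma L1_le f g : measurable_fun D f -> L1 g ->
  (forall x, D x -> `|f x| <= g x) -> L1 f.
Proof.
move=> mf ig fg; apply: le_integrable ig => //; first exact/measurable_EFinP.
move=> x Dx /=; rewrite lee_fin (le_trans (fg x Dx))// ler_norm//.
Qed.

Lemma eq_L1 f g : (forall x, D x -> f x = g x) -> L1 f -> L1 g.
Proof.
by move=> fg; apply: eq_integrable => // x /set_mem Dx /=; rewrite fg.
Qed.

Lemma L1D f g : L1 f -> L1 g -> L1 (fun x => f x + g x).
Proof.
move=> if_ ig; exact: (integrableD mD if_ ig).
Qed.

Lemma L1B f g : L1 f -> L1 g -> L1 (fun x => f x - g x).
Proof.
move=> if_ ig; exact: (integrableB mD if_ ig).
Qed.

Lemma L1Z k f : L1 f -> L1 (fun x => k * f x).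
Proof.
move=> if_; exact: (integrableZl mD k if_).
Qed.

Lemma L1_norm f : L1 f -> L1 (fun x => `|f x|).
Proof. by move=> /integrable_norm. Qed.

Lemma L1_cst k : (mu D < +oo)%E -> L1 (fun=> k).
Proof. move=> fD; apply: measurable_bounded_integrable => //.
by exists `|k|; split; [exact: num_real|move=> M kM x _ /=; exact: ltW]. Qed.

Lemma Rint_eq f g : (forall x, D x -> f x = g x) ->
  \int[mu]_(x in D) f x = \int[mu]_(x in D) g x.
Proof. by move=> fg; apply: eq_Rintegral => x /set_mem /fg. Qed.

Lemma Rint_norm_le f g : L1 f -> L1 g -> (forall x, D x -> `|f x| <= g x) ->
  `|\int[mu]_(x in D) f x| <= \int[mu]_(x in D) g x.
Proof.
move=> if_ ig fg; apply: (le_trans (le_normr_Rintegral mD if_)).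
by apply: le_Rintegral => //; exact: L1_norm.
Qed.

Lemma L2_measurable f : L2 f -> measurable_fun D f.
Proof. by case. Qed.

Lemma L2_sqr f : L2 f -> L1 (fun x => f x ^+ 2).
Proof. by case. Qed.

Lemma L2_le f g : measurable_fun D f -> L1 g ->
  (forall x, D x -> f x ^+ 2 <= g x) -> L2 f.
Proof.
move=> mf ig fg; split => //; apply: L1_le ig _; first exact: measurable_funX.
by move=> x Dx; rewrite ger0_norm ?sqr_ge0// fg.
Qed.

Lemma eq_L2 f g : (forall x, D x -> f x = g x) -> L2 f -> L2 g.
Proof.
move=> fg [mf f2]; split.
  by apply: eq_measurable_fun mf => x /set_mem /fg.
by apply: eq_L1 f2 => x /fg ->.
Qed.

Lemma L2_cst k : (mu D < +oo)%E -> L2 (fun=> k).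
Proof. by move=> fD; split; [exact: measurable_cst|exact: L1_cst]. Qed.

Lemma L2M f g : L2 f -> L2 g -> L1 (fun x => f x * g x).
Proof.
move=> [mf f2] [mg g2]; apply: L1_le (L1D f2 g2) _.
  exact: measurable_funM.
move=> x _; rewrite normrM -(real_normK (num_real (f x))).
rewrite -(real_normK (num_real (g x))).
have := sqr_ge0 (`|f x| - `|g x|); have := normr_ge0 (f x).
have := normr_ge0 (g x); nra.
Qed.

Lemma L2Z k f : L2 f -> L2 (fun x => k * f x).
Proof.
move=> [mf f2]; split; first exact: measurable_funM.
by apply: eq_L1 (L1Z (k ^+ 2) f2) => x _; rewrite exprMn.
Qed.

Lemma L2D f g : L2 f -> L2 g -> L2 (fun x => f x + g x).
Proof.
move=> lf lg; split; first by apply: measurable_funD; [case: lf|case: lg].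
apply: eq_L1 (L1D (L1D (L2_sqr lf) (L2_sqr lg)) (L1Z 2 (L2M lf lg))) => x _.
by rewrite sqrrD; ring.
Qed.

Lemma L2B f g : L2 f -> L2 g -> L2 (fun x => f x - g x).
Proof.
move=> lf lg; apply: eq_L2 (L2D lf (L2Z (-1) lg)) => x _; ring.
Qed.

Lemma L2_L1 f : (mu D < +oo)%E -> L2 f -> L1 f.
Proof.
move=> fD lf; apply: eq_L1 (L2M lf (L2_cst 1 fD)) => x _; ring.
Qed.

Lemma ipC f g : ip f g = ip g f.
Proof. by apply: Rint_eq => x _; rewrite mulrC. Qed.

Lemma ipDl f g h : L2 f -> L2 g -> L2 h ->
  ip (fun x => f x + g x) h = ip f h + ip g h.
Proof.
move=> lf lg lh; rewrite /ip -RintegralD //; [|exact: L2M|exact: L2M].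
by apply: Rint_eq => x _; ring.
Qed.

Lemma ipZl k f h : L2 f -> L2 h -> ip (fun x => k * f x) h = k * ip f h.
Proof.
move=> lf lh; rewrite /ip -RintegralZl //; last exact: L2M.
by apply: Rint_eq => x _; ring.
Qed.

Lemma ipBl f g h : L2 f -> L2 g -> L2 h ->
  ip (fun x => f x - g x) h = ip f h - ip g h.
Proof.
move=> lf lg lh; rewrite /ip -RintegralB //; [|exact: L2M|exact: L2M].
by apply: Rint_eq => x _; ring.
Qed.

Lemma sqnE f : sqn f = ip f f.
Proof. by apply: Rint_eq => x _; rewrite expr2. Qed.

Lemma sqn_ge0 f : 0 <= sqn f.
Proof. by apply: Rintegral_ge0 => x _; exact: sqr_ge0. Qed.

Lemma sqnD f g : L2 f -> L2 g ->
  sqn (fun x => f x + g x) = sqn f + 2 * ip f g + sqn g.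
Proof.
move=> lf lg; rewrite !sqnE ipDl //; last exact: L2D.
rewrite ![ip _ (fun x => _ + _)]ipC !ipDl // (ipC g f); ring.
Qed.

Lemma sqnZ k f : L2 f -> sqn (fun x => k * f x) = k ^+ 2 * sqn f.
Proof.
move=> lf; rewrite !sqnE ipZl; [|done|exact: L2Z].
by rewrite ipC ipZl //; ring.
Qed.

Lemma sqnB f g : L2 f -> L2 g ->
  sqn (fun x => f x - g x) = sqn f - 2 * ip f g + sqn g.
Proof.
move=> lf lg; rewrite !sqnE ipBl //; last exact: L2B.
rewrite ![ip _ (fun x => _ - _)]ipC !ipBl // (ipC g f); ring.
Qed.

Lemma cauchy_schwarz f g : L2 f -> L2 g -> ip f g ^+ 2 <= sqn f * sqn g.
Proof.
move=> lf lg; have H t : 0 <= sqn f + 2 * t * ip f g + t ^+ 2 * sqn g.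
  have -> : sqn f + 2 * t * ip f g + t ^+ 2 * sqn g
      = sqn (fun x => f x + t * g x).
    rewrite sqnD ?sqnZ//; last exact: L2Z.
    by rewrite [ip f (fun x => t * _)]ipC ipZl // (ipC g f); ring.
  exact: sqn_ge0.
have f0 := sqn_ge0 f; have := sqn_ge0 g; rewrite le0r => /orP[/eqP g0|g0].
  rewrite g0 mulr0; rewrite leNgt; apply/negP => p0.
  have i0 : ip f g != 0 by move: p0; apply: contraTneq => ->; rewrite expr0n ltxx.
  (* With [sqn g = 0] the quadratic in t is affine; this t would give it the value -1. *)
  have := H (- (sqn f + 1) / (2 * ip f g)).
  have -> : 2 * (- (sqn f + 1) / (2 * ip f g)) * ip f g = - (sqn f + 1).
    by field.
  rewrite g0; lra.
have := H (- ip f g / sqn g).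
have -> : sqn f + 2 * (- ip f g / sqn g) * ip f g + (- ip f g / sqn g) ^+ 2 * sqn g
  = sqn f - ip f g ^+ 2 / sqn g by field; rewrite gt_eqF.
by rewrite subr_ge0 ler_pdivrMr.
Qed.

Lemma normr_ip_le f g : L2 f -> L2 g ->
  `|ip f g| <= Num.sqrt (sqn f) * Num.sqrt (sqn g).
Proof.
move=> lf lg; rewrite -sqrtrM ?sqn_ge0// -sqrtr_sqr ler_wsqrtr//.
exact: cauchy_schwarz.
Qed.

Lemma sqnD_le f g : L2 f -> L2 g ->
  sqn (fun x => f x + g x) <= 2 * sqn f + 2 * sqn g.
Proof.
move=> lf lg; have := sqn_ge0 (fun x => f x - g x).
by rewrite sqnB// sqnD//; lra.
Qed.

Lemma sqnB_le f g : L2 f -> L2 g ->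
  sqn (fun x => f x - g x) <= 2 * sqn f + 2 * sqn g.
Proof.
move=> lf lg; have := sqn_ge0 (fun x => f x + g x).
by rewrite sqnB// sqnD//; lra.
Qed.

Lemma sqn_sym f g : sqn (fun x => f x - g x) = sqn (fun x => g x - f x).
Proof. by apply: Rint_eq => x _; ring. Qed.

End integrable_functions.

(** * Completeness of L^2 *)

Section riesz_fischer.
Context d (T : measurableType d) (R : realType).
Variables (mu : {measure set T -> \bar R}) (D : set T).
Hypothesis mD : measurable D.
Notation L1 := (L1 mu D).
Notation L2 := (L2 mu D).
Notation sqn := (L2_sqn mu D).
Implicit Types f g h : T -> R.

Lemma limn_einf_le (u : (\bar R)^nat) c : (forall n, u n <= c)%E ->
  (limn_einf u <= c)%E.
Proof.
move=> uc; rewrite limn_einf_lim; apply: lime_le; first exact: is_cvg_einfs.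
apply: nearW => n; apply: le_trans (uc n).
by apply: ereal_inf_lbound; exists n => //=.
Qed.

Lemma EFin_Rint f : L1 f ->
  (\int[mu]_(x in D) f x)%:E = (\int[mu]_(x in D) (f x)%:E)%E.
Proof. by move=> if_; rewrite fineK//; exact: (integrable_fin_num mD if_). Qed.

(** Fatou's lemma for the squares. In [L2_complete] it is applied to differences with one index
    fixed, and so turns a Cauchy bound into a bound on the distance to the limit. *)
Lemma fatou_sqn (h : nat -> T -> R) (k : T -> R) c :
  (forall n, L2 (h n)) -> measurable_fun D k -> (forall n, sqn (h n) <= c) ->
  {ae mu, forall x, D x -> h n x @[n --> \oo] --> k x} ->
  L2 k /\ sqn k <= c.
Proof.
move=> lh mk hc hk.
have mh n : measurable_fun D (EFin \o (fun x => h n x ^+ 2)).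
  by apply/measurable_EFinP/measurable_funX; case: (lh n).
have mk2 : measurable_fun D (EFin \o (fun x => k x ^+ 2)).
  by apply/measurable_EFinP/measurable_funX.
have le : (\int[mu]_(x in D) (k x ^+ 2)%:E <= c%:E)%E.
  apply: (@le_trans _ _ (\int[mu]_(x in D)
      limn_einf (fun n => (h n x ^+ 2)%:E))%E).
    apply: ae_ge0_le_integral => //.
    - by move=> x _; rewrite lee_fin sqr_ge0.
    - move=> x _; rewrite limn_einf_lim; apply: lime_ge.
        exact: is_cvg_einfs.
      apply: nearW => n; apply: le_ereal_inf_tmp => _ [m _ <-] /=.
      by rewrite lee_fin sqr_ge0.
    (* Measurability of the lower limit is obtained from that of the upper limit by a change of
       sign. *)
    - have -> : (fun x => limn_einf (fun n => (h n x ^+ 2)%:E)) =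
        (fun x => - limn_esup (fun n => - (h n x ^+ 2)%:E))%E.
        apply/funext => x; rewrite -limn_einfN; congr limn_einf.
        by apply/funext => n /=; rewrite opprK.
      have mE : measurable_fun D
          (fun x => limn_esup (fun n => - (h n x ^+ 2)%:E)%E).
        apply: measurable_fun_limn_esup => n.
        apply/(@measurable_EFinP _ _ _ _ (fun x => - (h n x ^+ 2))).
        apply: measurable_funN; apply/measurable_funX.
        by case: (lh n).
      apply: (@measurableT_comp _ _ _ _ _ _ (-%E : \bar R -> \bar R) D) mE.
      exact: oppe_measurable.
    apply: filterS hk => x hkx Dx.
    suff -> : limn_einf (fun n => (h n x ^+ 2)%:E) = (k x ^+ 2)%:E by [].
    apply: (cvg_limn_einf_sup _).1; apply: cvg_EFin.
      by apply: nearW.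
    have -> : (fine \o (fun n => (h n x ^+ 2)%:E)) = (fun n => h n x * h n x).
      by apply/funext => n /=; rewrite expr2.
    by rewrite expr2; apply: cvgM; exact: hkx.
  apply: le_trans (fatou mu mD mh _) _.
    by move=> n x _; rewrite lee_fin sqr_ge0.
  apply: limn_einf_le => n /=; rewrite -EFin_Rint ?lee_fin//; last first.
    by case: (lh n).
  exact: hc.
have ik : L1 (fun x => k x ^+ 2).
  apply/integrableP; split => //; apply: le_lt_trans (ltry c).
  apply: le_trans le; apply: ge0_le_integral => //.
  - by apply: measurableT_comp.
  - by move=> x _ /=; rewrite ger0_norm ?sqr_ge0.
by split => //; rewrite -lee_fin EFin_Rint.
Qed.

Hypothesis fD : (mu D < +oo)%E.

Lemma sum_half n : \sum_(0 <= k < n) (2^-1 : R) ^+ k = 2 - 2 * 2^-1 ^+ n.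
Proof.
elim: n => [|n IH]; first by rewrite big_nil expr0; lra.
by rewrite big_nat_recr//= IH exprS; lra.
Qed.

(** On a set of finite measure Cauchy-Schwarz against the constant 1 bounds the L^1 norms of the
    increments by a geometric series. Their sum is therefore integrable, hence finite almost
    everywhere, and the telescoping series converges absolutely there. *)
Lemma ae_cvg_summable (F : nat -> T -> R) :
  (forall n, L2 (F n)) ->
  (forall k, sqn (fun x => F k.+1 x - F k x) <= 4^-1 ^+ k) ->
  {ae mu, forall x, D x -> cvgn (fun n => F n x)}.
Proof.
move=> lF dF; pose h k x := `|F k.+1 x - F k x|.
pose C := Num.sqrt (sqn (fun=> 1)).
have lh k : L1 (h k) by apply/L1_norm/L2_L1 => //; exact: L2B.
have mh k : measurable_fun D (EFin \o h k).
  by apply/measurable_EFinP/L1_measurable.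
have ih k : \int[mu]_(x in D) h k x <= C * 2^-1 ^+ k.
  have -> : \int[mu]_(x in D) h k x = L2_ip mu D (h k) (fun=> 1).
    by apply: Rint_eq => x _; rewrite mulr1.
  have l2h : L2 (h k).
    apply: L2_le (L2_sqr (L2B mD (lF k.+1) (lF k))) _ => //.
      exact/L1_measurable.
    by move=> x _; rewrite real_normK// num_real.
  apply: le_trans (ler_norm _) _.
  apply: le_trans (normr_ip_le mD l2h (L2_cst mD 1 fD)) _.
  rewrite -/C mulrC ler_wpM2l ?sqrtr_ge0//.
  have -> : 2^-1 ^+ k = Num.sqrt ((4^-1) ^+ k) :> R.
    have -> : 4^-1 = 2^-1 ^+ 2 :> R by field.
    by rewrite exprAC sqrtr_sqr ger0_norm// exprn_ge0// invr_ge0.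
  rewrite ler_wsqrtr//; apply: le_trans (dF k); rewrite le_eqVlt; apply/orP; left.
  by apply/eqP/Rint_eq => x _; rewrite real_normK// num_real.
have ms : measurable_fun D (fun x => \sum_(0 <= k <oo) (h k x)%:E)%E.
  apply: (@ge0_emeasurable_sum _ _ _ _ (fun k x => (h k x)%:E) xpredT) => //.
  by move=> k x _ _; rewrite lee_fin normr_ge0.
  by move=> k _; exact: mh.
have s0 x : D x -> (0 <= \sum_(0 <= k <oo) (h k x)%:E)%E.
  by move=> _; apply: nneseries_ge0 => k _ _; rewrite lee_fin normr_ge0.
have iS : mu.-integrable D (fun x => \sum_(0 <= k <oo) (h k x)%:E)%E.
  apply/integrableP; split => //.
  under eq_integral => x /set_mem Dx do rewrite gee0_abs ?s0//.
  rewrite integral_nneseries//; last by move=> k x _; rewrite lee_fin normr_ge0.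
  apply: le_lt_trans (ltry (C * 2)); apply: lime_le.
    apply: is_cvg_nneseries => k _ _; apply: integral_ge0 => x _.
    by rewrite lee_fin normr_ge0.
  apply: nearW => n; rewrite (eq_bigr (fun k => (\int[mu]_(x in D) h k x)%:E)).
    rewrite sumEFin lee_fin; apply: (@le_trans _ _ (\sum_(0 <= k < n) C * 2^-1 ^+ k)).
      by apply: ler_sum => k _; exact: ih.
    rewrite -mulr_sumr sum_half ler_wpM2l ?sqrtr_ge0//.
    by rewrite lerBlDr lerDl mulr_ge0// exprn_ge0// invr_ge0.
  by move=> k _; rewrite EFin_Rint.
apply: filterS (integrable_ae mD iS) => x hx Dx; have {hx} := hx Dx.
move=> fs.
have cn : cvgn [normed series (telescope (F ^~ x))].
  apply: nondecreasing_is_cvgn.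
    by apply: nondecreasing_series => n *; exact: normr_ge0.
  exists (fine (\sum_(0 <= k <oo) (h k x)%:E)%E) => _ [n _ <-].
  rewrite -lee_fin fineK// /series /= -sumEFin.
  by apply: (@nneseries_lim_ge _ (fun k => (h k x)%:E)) => k _ _; rewrite lee_fin normr_ge0.
have := normed_cvg cn => cs.
have -> : (fun n => F n x) = (fun n => F 0%N x + series (telescope (F ^~ x)) n).
  by apply/funext => n; rewrite [LHS](eq_sum_telescope (F ^~ x)).
by apply: is_cvgD => //; exact: is_cvg_cst.
Qed.

Definition cauchy_sqn (f : nat -> T -> R) := forall e, 0 < e ->
  exists N, forall m n, (N <= m)%N -> (N <= n)%N ->
    sqn (fun x => f m x - f n x) <= e.

Theorem L2_complete (f : nat -> T -> R) : (forall n, L2 (f n)) ->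
  cauchy_sqn f ->
  exists g, L2 g /\ forall e, 0 < e -> exists N, forall n, (N <= n)%N ->
    sqn (fun x => f n x - g x) <= e.
Proof.
move=> lf cf.
have q k : (0 : R) < 4^-1 ^+ k by rewrite exprn_gt0// invr_gt0.
have /choice[N HN] k := cf _ (q k).
(* Partial sums of [N] are monotone and dominate [N], so every later index of the subsequence
   respects the k-th Cauchy bound. *)
pose s k := (\sum_(0 <= i < k.+1) N i)%N.
have sS k : s k.+1 = (s k + N k.+1)%N by rewrite /s big_nat_recr.
have sN k : (N k <= s k)%N by rewrite /s big_nat_recr//= leq_addl.
have sm k j : (s k <= s (k + j))%N.
  elim: j => [|j IH]; first by rewrite addn0.
  by rewrite addnS sS (leq_trans IH)// leq_addr.
have d1 k j : sqn (fun x => f (s (k + j)%N) x - f (s k) x) <= 4^-1 ^+ k.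
  by apply: HN => //; apply: leq_trans (sN k) _.
have ac : {ae mu, forall x, D x -> cvgn (fun n => f (s n) x)}.
  apply: (ae_cvg_summable (F := fun n => f (s n))) => // k.
  by rewrite -[k.+1]addn1.
(* An upper limit is measurable on all of D and agrees with the limit wherever the latter exists. *)
pose g x := fine (limn_esup (fun n => (f (s n) x)%:E)).
have mg : measurable_fun D g.
  apply: measurableT_comp => //; apply: measurable_fun_limn_esup => n.
  by apply/measurable_EFinP; case: (lf (s n)).
have cg : {ae mu, forall x, D x -> f (s n) x @[n --> \oo] --> g x}.
  apply: filterS ac => x hx Dx; have {}hx := hx Dx.
  suff -> : g x = limn (fun n => f (s n) x) by [].
  have /cvg_limn_einf_sup[_ /= E] : (EFin (f (s n) x)) @[n --> \oo] -->
      (limn (fun n => f (s n) x))%:E by apply: cvg_EFin => //; exact: nearW.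
  by rewrite /g E.
have Hk n k : (N k <= n)%N -> L2 (fun x => f n x - g x) /\
    sqn (fun x => f n x - g x) <= 4^-1 ^+ k.
  move=> Nn; apply: (fatou_sqn (h := fun j x => f n x - f (s (k + j)%N) x)).
  - by move=> j; exact: L2B.
  - by apply: measurable_funB => //; case: (lf n).
  - by move=> j; apply: HN => //; apply: leq_trans (sN k) _.
  apply: filterS cg => x hx Dx; apply: cvgB; first exact: cvg_cst.
  have -> : (fun j => f (s (k + j)%N) x) = (fun j => f (s (j + k)%N) x).
    by apply/funext => j; rewrite addnC.
  by rewrite (cvg_shiftn k (fun j => f (s j) x)); exact: hx.
exists g; split.
  have [l _] := Hk (N 0%N) 0%N (leqnn _).
  apply: (eq_L2 mD _ (L2B mD (lf (N 0%N)) l)) => x _.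
  by rewrite subKr.
move=> e e0.
have [k ke] : exists k, 4^-1 ^+ k <= e.
  have c : ((4^-1 : R) ^+ k) @[k --> \oo] --> (0 : R).
    by apply: cvg_expr; rewrite ger0_norm ?invr_ge0// invf_lt1// ltr1n.
  have /cvgrPdist_le /(_ _ e0)[k _ /(_ k (leqnn k))] := c.
  by rewrite /= sub0r normrN (ger0_norm (ltW (q k))) => H; exists k.
by exists (N k) => n Nn; apply: le_trans (proj2 (Hk n k Nn)) ke.
Qed.

End riesz_fischer.

(** * The nonlinearities *)

Section real_inequalities.
Context (R : realType).
Implicit Types a h s t u w L M e : R.

Definition sqlog s : R := s ^+ 2 * ln (s ^+ 2).

Lemma ln_le_subr1 t : 0 < t -> ln t <= t - 1.
Proof.
move=> t0; have -> : ln t = ln (1 + (t - 1)) by congr ln; ring.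
by apply: le_ln1Dx; lra.
Qed.

Lemma ln_sqr s : s != 0 -> ln (s ^+ 2) = 2 * ln `|s|.
Proof.
by move=> s0; rewrite -real_normK ?num_real// lnXn ?normr_gt0// mulr_natl.
Qed.

Lemma ln_sqr_le s : ln (s ^+ 2) <= 2 * `|s|.
Proof.
have [->|s0] := eqVneq s 0; first by rewrite expr0n ln0// normr0 mulr0.
rewrite ln_sqr// ler_wpM2l//.
by apply: le_trans (ln_le_subr1 _) _; rewrite ?normr_gt0// lerBlDr lerDl.
Qed.

Lemma normr_mul_ln_sqr_le s : `|s * ln (s ^+ 2)| <= 2 * (1 + s ^+ 2).
Proof.
have [->|s0] := eqVneq s 0; first by rewrite mul0r normr0; nra.
have p0 : 0 < `|s| by rewrite normr_gt0.
rewrite normrM ln_sqr// -(real_normK (num_real s)).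
have H1 := ln_le_subr1 p0.
have H2 : - ln `|s| <= `|s|^-1 - 1 by rewrite -lnV ?posrE//; apply: ln_le_subr1; rewrite invr_gt0.
have H3 : `|s| * `|s|^-1 = 1 by rewrite divff// gt_eqF.
move: (ln `|s|) (`|s|^-1) H1 H2 H3 => l i H1 H2 H3.
rewrite normrM (ger0_norm (_ : 0 <= 2))//.
have [l0|l0] := leP 0 l; [rewrite (ger0_norm l0)|rewrite (ltr0_norm l0)]; nra.
Qed.

(* The second derivative of s^2 log s^2 is bounded above, though not below. *)
Lemma sqlog_upper a h : sqlog (a + h) <=
  sqlog a + 2 * a * (ln (a ^+ 2) + 1) * h + h ^+ 2 * (4 + 2 * `|a| + 2 * `|a + h|).
Proof.
rewrite /sqlog; set s := a + h; have hE : h = s - a by rewrite /s; ring.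
have la := ln_sqr_le a; have ls := ln_sqr_le s.
(* If |s| <= |h|, then |a| <= 2|h| and every term is of order h^2. Otherwise s and a have the same
   sign, and ln(s^2) = ln(a^2) + 2 ln(s/a) with ln(s/a) <= h/a. *)
have [sh|hs] := leP (s ^+ 2) (h ^+ 2).
  have h2 : `|a| <= 2 * `|h|.
    have : `|s| <= `|h| by rewrite -ler_sqr ?nnegrE// !real_normK ?num_real.
    have -> : a = s - h by rewrite hE; ring.
    by have := ler_normB s h; lra.
  have ah : - (2 * a * h) <= 4 * h ^+ 2.
    rewrite -(real_normK (num_real h)); have := ler_norm (- (a * h)).
    rewrite normrN normrM; have := normr_ge0 h; nra.
  have e1 : (h ^+ 2 - s ^+ 2) * ln (a ^+ 2) <= h ^+ 2 * (2 * `|a|).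
    apply: (@le_trans _ _ ((h ^+ 2 - s ^+ 2) * (2 * `|a|))).
      by rewrite ler_wpM2l// subr_ge0.
    by rewrite ler_wpM2r ?mulr_ge0// lerBlDr lerDl sqr_ge0.
  have e2 : s ^+ 2 * ln (s ^+ 2) <= h ^+ 2 * (2 * `|s|).
    apply: (@le_trans _ _ (s ^+ 2 * (2 * `|s|))).
      by rewrite ler_wpM2l// sqr_ge0.
    by rewrite ler_wpM2r ?mulr_ge0.
  rewrite -subr_ge0; rewrite -subr_ge0 in e1; rewrite -subr_ge0 in e2.
  rewrite -subr_ge0 in ah.
  have := addr_ge0 (addr_ge0 e1 e2) ah; congr (0 <= _).
  by rewrite hE; ring.
have sa : 0 < s * a.
  have -> : s * a = (s ^+ 2 - h ^+ 2 + a ^+ 2) / 2 by rewrite hE; field.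
  by apply: divr_gt0 => //; have := sqr_ge0 a; lra.
have a0 : a != 0 by apply: contraTneq sa => ->; rewrite mulr0 ltxx.
have s0 : s != 0 by apply: contraTneq sa => ->; rewrite mul0r ltxx.
have r0 : 0 < s / a.
  have -> : s / a = s * a / a ^+ 2 by field.
  by rewrite divr_gt0// exprn_even_gt0.
have lE : ln (s ^+ 2) = ln (a ^+ 2) + 2 * ln (s / a).
  have -> : s ^+ 2 = a ^+ 2 * (s / a) ^+ 2 by field.
  have L2 : ln ((s / a) ^+ 2) = 2 * ln (s / a) by rewrite lnXn// mulr_natl.
  have p1 : a ^+ 2 \is Num.pos by rewrite posrE exprn_even_gt0.
  have p2 : (s / a) ^+ 2 \is Num.pos by rewrite posrE exprn_gt0.
  by rewrite -L2 (lnM p1 p2).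
have lr : ln (s / a) <= h / a.
  have -> : h / a = s / a - 1 by rewrite hE; field.
  exact: ln_le_subr1.
have e1 : 2 * (s ^+ 2 - h ^+ 2) * ln (s / a) <= 2 * (s ^+ 2 - h ^+ 2) * (h / a).
  by rewrite ler_wpM2l// mulr_ge0// subr_ge0 ltW.
have eE : 2 * (s ^+ 2 - h ^+ 2) * (h / a) = 2 * a * h + 4 * h ^+ 2.
  by rewrite hE; field.
rewrite eE in e1.
have e2 : h ^+ 2 * ln (s ^+ 2) <= h ^+ 2 * (2 * `|s|).
  by rewrite ler_wpM2l// sqr_ge0.
have e3 : 0 <= h ^+ 2 * (2 * `|a|) by rewrite mulr_ge0 ?sqr_ge0// mulr_ge0.
have -> : s ^+ 2 * ln (s ^+ 2) = h ^+ 2 * ln (s ^+ 2)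
    + 2 * (s ^+ 2 - h ^+ 2) * ln (s / a) + (s ^+ 2 - h ^+ 2) * ln (a ^+ 2).
  by rewrite lE; ring.
have -> : (s ^+ 2 - h ^+ 2) * ln (a ^+ 2) =
    a ^+ 2 * ln (a ^+ 2) + 2 * a * ln (a ^+ 2) * h by rewrite hE; ring.
lra.
Qed.

(** The one-sided estimate [sqlog_upper] suffices, because the right-hand side is symmetric in the
    two points. *)
Lemma sqlog_lipschitz a c :
  `|sqlog a - sqlog c| <= 16 * (1 + a ^+ 2 + c ^+ 2) * `|a - c|.
Proof.
suff H x y : sqlog y - sqlog x <= 16 * (1 + x ^+ 2 + y ^+ 2) * `|x - y|.
  rewrite ler_norml; apply/andP; split; last first.
    by have := H c a; rewrite distrC; lra.
  by have := H a c; lra.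
have := sqlog_upper x (y - x); rewrite (addrC x) subrK distrC => U.
suff : 2 * x * (ln (x ^+ 2) + 1) * (y - x)
    + (y - x) ^+ 2 * (4 + 2 * `|x| + 2 * `|y|)
    <= 16 * (1 + x ^+ 2 + y ^+ 2) * `|y - x| by lra.
have L := normr_mul_ln_sqr_le x.
have A : 2 * x * (ln (x ^+ 2) + 1) * (y - x)
    <= (4 * (1 + x ^+ 2) + 2 * `|x|) * `|y - x|.
  apply: le_trans (ler_norm _) _; rewrite normrM ler_wpM2r//.
  have -> : 2 * x * (ln (x ^+ 2) + 1) = 2 * (x * ln (x ^+ 2)) + 2 * x by ring.
  apply: le_trans (ler_normD _ _) _; rewrite !normrM (ger0_norm (_ : 0 <= 2))//.
  by rewrite normrM in L; lra.
have B : (y - x) ^+ 2 * (4 + 2 * `|x| + 2 * `|y|)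
    <= (`|x| + `|y|) * (4 + 2 * `|x| + 2 * `|y|) * `|y - x|.
  rewrite -(real_normK (num_real (y - x))) expr2.
  rewrite mulrAC ler_wpM2r// ler_wpM2r ?addr_ge0 ?mulr_ge0//.
  by have := ler_normB y x; lra.
apply: le_trans (lerD A B) _; rewrite -mulrDl ler_wpM2r//.
rewrite -(real_normK (num_real x)) -(real_normK (num_real y)).
have := normr_ge0 x; have := normr_ge0 y.
move: `|x| `|y| => p q; have := sqr_ge0 (p - q); have := sqr_ge0 (p - 1).
have := sqr_ge0 (q - 1); nra.
Qed.

Lemma normr_sqlog_le s : `|sqlog s| <= 16 * (1 + s ^+ 2) * `|s|.
Proof.
have := sqlog_lipschitz s 0; rewrite /sqlog expr0n mul0r subr0 => H.
by apply: le_trans H _; rewrite addr0 subr0.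
Qed.

(** The inequality ln x <= x - 1 at x = e^L / s^2, multiplied by s^2; it is sharp at s^2 = e^L. *)
Lemma sqlog_lower s L : s ^+ 2 * L + s ^+ 2 - expR L <= sqlog s.
Proof.
rewrite /sqlog; have [->|s0] := eqVneq s 0.
  by rewrite expr0n /= !mul0r add0r sub0r oppr_le0 expR_ge0.
have s2 : 0 < s ^+ 2 by rewrite exprn_even_gt0.
have := ln_le_subr1 (divr_gt0 (expR_gt0 L) s2).
rewrite ln_div ?posrE ?expR_gt0// expRK => H.
have : s ^+ 2 * (L - ln (s ^+ 2)) <= s ^+ 2 * (expR L / s ^+ 2 - 1).
  by rewrite ler_wpM2l// ltW.
have -> : s ^+ 2 * (expR L / s ^+ 2 - 1) = expR L - s ^+ 2 by field.
lra.
Qed.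

Lemma sqlogM t s : t != 0 ->
  sqlog (t * s) = t ^+ 2 * sqlog s + t ^+ 2 * ln (t ^+ 2) * s ^+ 2.
Proof.
move=> t0; rewrite /sqlog; have [->|s0] := eqVneq s 0.
  by rewrite mulr0 expr0n /= !mul0r !mulr0 addr0.
by rewrite exprMn lnM ?posrE ?exprn_even_gt0//; ring.
Qed.

(** Convexity of the sixth power, certified by a sum of squares. As the energy contains minus the
    sixth power, this bounds it from above along lines. *)
Lemma pow6_tangent a h : a ^+ 6 + 6 * a ^+ 5 * h <= (a + h) ^+ 6.
Proof.
rewrite -subr_ge0; set y := a + h; have -> : h = y - a by rewrite /y; ring.
have -> : y ^+ 6 - (a ^+ 6 + 6 * a ^+ 5 * (y - a)) = (y - a) ^+ 2 *
  ((y ^+ 2 + y * a) ^+ 2 + 2 * (a * (y + a)) ^+ 2 + 3 * (a ^+ 2) ^+ 2) by ring.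
rewrite mulr_ge0 ?sqr_ge0// addr_ge0//; last by rewrite mulr_ge0 ?sqr_ge0.
by rewrite addr_ge0 ?sqr_ge0// mulr_ge0 ?sqr_ge0.
Qed.

Lemma pow6D_le u w : (u + w) ^+ 6 <= 32 * (u ^+ 6 + w ^+ 6).
Proof.
have e (x : R) : x ^+ 6 = x ^+ 2 * x ^+ 2 * x ^+ 2 by ring.
have H : (u + w) ^+ 2 <= 2 * (u ^+ 2 + w ^+ 2) by have := sqr_ge0 (u - w); nra.
have P := sqr_ge0 (u + w); rewrite !e.
have : (u + w) ^+ 2 * (u + w) ^+ 2 * (u + w) ^+ 2 <=
  (2 * (u ^+ 2 + w ^+ 2)) * (2 * (u ^+ 2 + w ^+ 2)) * (2 * (u ^+ 2 + w ^+ 2)).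
  move: H P; move: (_ ^+ 2) (2 * _) => x y H P.
  by rewrite ler_pM ?mulr_ge0// ler_pM.
move=> K; apply: le_trans K _.
have := sqr_ge0 u; have := sqr_ge0 w; move: (u ^+ 2) (w ^+ 2) => p q q0 p0.
have := mulr_ge0 (addr_ge0 p0 q0) (sqr_ge0 (p - q)); nra.
Qed.

(** A Young inequality with explicit constants, by comparing U with dl W. The exponent of U is at
    least 1, so that for U <= dl W a full factor dl comes out. *)
Lemma le_mul_pow6 (k j : nat) (W U dl : R) : 0 <= W -> 0 <= U -> 0 < dl <= 1 ->
  (k + j.+1)%N = 6%N -> W ^+ k * U ^+ j.+1 <= dl * W ^+ 6 + (dl^-1) ^+ k * U ^+ 6.
Proof.
move=> W0 U0 /andP[d0 d1] kj; have [UW|WU] := leP U (dl * W).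
  apply: (@le_trans _ _ (dl * W ^+ 6)); last first.
    by rewrite lerDl mulr_ge0// exprn_ge0// invr_ge0 ltW.
  rewrite -kj exprD mulrCA ler_wpM2l ?exprn_ge0//.
  apply: (@le_trans _ _ ((dl * W) ^+ j.+1)).
    by rewrite lerXn2r ?nnegrE ?mulr_ge0// ltW.
  rewrite exprMn ler_wpM2r ?exprn_ge0//.
  by rewrite exprS ler_piMr ?exprn_ile1// ltW.
apply: (@le_trans _ _ ((dl^-1) ^+ k * U ^+ 6)); last first.
  by rewrite lerDr mulr_ge0 ?exprn_ge0// ltW.
rewrite -kj (exprD U) mulrA ler_wpM2r ?exprn_ge0// -exprMn.
rewrite lerXn2r ?nnegrE ?mulr_ge0 ?invr_ge0 ?(ltW d0)//.
by rewrite ler_pdivlMl// ltW.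
Qed.

(** Every mixed monomial is at most the sum of the two extreme ones; 62 = 6 + 15 + 20 + 15 + 6 is
    the sum of the inner binomial coefficients. *)
Lemma pow6_cross w u : `|(w + u) ^+ 6 - w ^+ 6 - u ^+ 6| <=
  62 * (`|w| ^+ 5 * `|u| + `|w| * `|u| ^+ 5).
Proof.
have -> : (w + u) ^+ 6 - w ^+ 6 - u ^+ 6 = 6 * (w ^+ 5 * u ^+ 1)
  + 15 * (w ^+ 4 * u ^+ 2) + 20 * (w ^+ 3 * u ^+ 3) + 15 * (w ^+ 2 * u ^+ 4)
  + 6 * (w ^+ 1 * u ^+ 5) by ring.
do 4! (apply: le_trans (ler_normD _ _) _; rewrite -lerBrDr).
have N (c i j : nat) : `|c%:R * (w ^+ i * u ^+ j)| = c%:R * (`|w| ^+ i * `|u| ^+ j).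
  by rewrite normrM normr_nat normrM !normrX.
rewrite !N !expr1.
have := normr_ge0 w; have := normr_ge0 u; move: `|w| `|u| => p q q0 p0.
have pq : 0 <= p * q by rewrite mulr_ge0.
have k1 := mulr_ge0 pq (sqr_ge0 (p ^+ 2 - q ^+ 2)).
have k2 := mulr_ge0 pq (mulr_ge0 (sqr_ge0 (p - q)) (addr_ge0 (addr_ge0 (sqr_ge0 p) (sqr_ge0 q)) pq)).
have E1 : p * q * (p ^+ 2 - q ^+ 2) ^+ 2 = p ^+ 5 * q + p * q ^+ 5 - 2 * (p ^+ 3 * q ^+ 3) by ring.
have E2 : p * q * ((p - q) ^+ 2 * (p ^+ 2 + q ^+ 2 + p * q)) =
  p ^+ 5 * q + p * q ^+ 5 - p ^+ 4 * q ^+ 2 - p ^+ 2 * q ^+ 4 by ring.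
rewrite E1 in k1; rewrite E2 in k2.
have := mulr_ge0 (exprn_ge0 5 p0) q0; have := mulr_ge0 p0 (exprn_ge0 5 q0).
lra.
Qed.

(** The pointwise form of the Brezis-Lieb splitting. The order of the constants matters: C1 is fixed
    before M, so M can be chosen to make C1 times the integral of the tail of u^6 small, and the
    term C2 w^2 disappears when w tends to 0 in L^2. *)
Lemma pow6_splitting e : 0 < e -> exists2 C1, 0 <= C1 &
  forall M, 0 <= M -> exists2 C2, 0 <= C2 & forall w u,
  `|(w + u) ^+ 6 - w ^+ 6 - u ^+ 6| <=
    e * (1 + w ^+ 6) + C1 * (if `|u| <= M then 0 else u ^+ 6) + C2 * w ^+ 2.
Proof.
move=> e0; pose dl := Num.min 1 (e / 124).
have d0 : 0 < dl by rewrite lt_min ltr01 divr_gt0.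
have d1 : dl <= 1 by rewrite ge_min lexx.
have de : 124 * dl <= e.
  by rewrite mulrC -ler_pdivlMr// ge_min lexx orbT.
have dl0 := ltW d0.
have di k : 0 <= dl^-1 ^+ k by rewrite exprn_ge0// invr_ge0 ltW.
have pE (x : R) : x ^+ 6 = `|x| ^+ 6 by rewrite -normrX ger0_norm// exprn_even_ge0.
exists (62 * (dl^-1 ^+ 5 + dl^-1 ^+ 1)); first by rewrite mulr_ge0 ?addr_ge0.
move=> M M0; have Md : 0 <= M / dl by rewrite divr_ge0.
exists (62 * ((M / dl) ^+ 3 * M + M ^+ 10 / (4 * dl))).
  by rewrite mulr_ge0// addr_ge0// mulr_ge0 ?exprn_ge0// invr_ge0 mulr_ge0.
move=> w u; apply: le_trans (pow6_cross w u) _.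
rewrite (pE w) (pE u) -(real_normK (num_real w)).
have := normr_ge0 w; have := normr_ge0 u; move: `|w| `|u| => W U U0 W0.
have W2 := exprn_ge0 2 W0; have W6 := exprn_ge0 6 W0.
case: ifPn => [UM|_]; last first.
  have A := @le_mul_pow6 5 0 W U dl W0 U0 _ erefl.
  have B := @le_mul_pow6 1 4 W U dl W0 U0 _ erefl.
  rewrite !expr1 in A B *; have {}A := A _; have {}B := B _.
  apply: (@le_trans _ _ (124 * dl * W ^+ 6 +
      62 * (dl^-1 ^+ 5 + dl^-1) * U ^+ 6)).
    by have := A (introT andP (conj d0 d1)); have := B (introT andP (conj d0 d1)); lra.
  have : 124 * dl * W ^+ 6 <= e * W ^+ 6 by rewrite ler_wpM2r.
  suff : 0 <= 62 * ((M / dl) ^+ 3 * M + M ^+ 10 / (4 * dl)) * W ^+ 2.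
    move: (62 * (dl^-1 ^+ 5 + dl^-1) * U ^+ 6) (_ * W ^+ 2) (124 * dl * W ^+ 6).
    by move=> X Y Z; rewrite mulrDr mulr1; lra.
  by rewrite mulr_ge0// mulr_ge0// addr_ge0// mulr_ge0 ?exprn_ge0// invr_ge0 mulr_ge0.
have A : W ^+ 5 * U <= dl * W ^+ 6 + (M / dl) ^+ 3 * M * W ^+ 2.
  apply: (@le_trans _ _ (W ^+ 5 * M)); first by rewrite ler_wpM2l ?exprn_ge0.
  (* For W >= M / dl the factor M is at most dl W; below that value three of the five factors W are
     bounded by M / dl, which leaves W^2. *)
  have [MW|WM] := leP (M / dl) W.
    apply: (@le_trans _ _ (dl * W ^+ 6)).
      rewrite (exprS W 5) mulrA [leRHS]mulrC ler_wpM2l ?exprn_ge0//.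
      by rewrite mulrC -ler_pdivrMr.
    by rewrite lerDl mulr_ge0// mulr_ge0// exprn_ge0.
  apply: (@le_trans _ _ ((M / dl) ^+ 3 * M * W ^+ 2)); last first.
    by rewrite lerDr mulr_ge0// ltW.
  rewrite (exprD W 3 2) mulrAC ler_wpM2r// ler_wpM2r//.
  by rewrite lerXn2r ?nnegrE// ltW.
have B : W * U ^+ 5 <= dl + M ^+ 10 / (4 * dl) * W ^+ 2.
  apply: (@le_trans _ _ (W * M ^+ 5)).
    by rewrite ler_wpM2l// lerXn2r ?nnegrE.
  rewrite -subr_ge0; have -> : dl + M ^+ 10 / (4 * dl) * W ^+ 2 - W * M ^+ 5 =
    (M ^+ 5 * W - 2 * dl) ^+ 2 / (4 * dl) by field; rewrite gt_eqF.
  by rewrite divr_ge0 ?sqr_ge0// mulr_ge0// ltW.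
have D : 62 * dl <= e by lra.
have : 62 * dl * W ^+ 6 <= e * W ^+ 6 by rewrite ler_wpM2r.
move: A B; move: (M ^+ 10 / _) ((M / dl) ^+ 3 * M) => c1 c2 A B.
rewrite mulr0; lra.
Qed.

End real_inequalities.

(** * Smooth functions *)

Section smooth_closure.
Context (R : realType).

Section normed.
Context (V : normedModType R).
Implicit Types f g : V -> R.

Lemma Ck_continuous k f : Ck k f -> continuous f.
Proof. by case: k => [|k] []. Qed.

Lemma CkW k f : Ck k.+1 f -> Ck k f.
Proof.
elim: k f => [|k IH] f [cf Hf]; first by split.
by split => // v; have [df cdf] := Hf v; split => //; exact: IH.
Qed.

Lemma Ck_derivable k f v x : Ck k.+1 f -> derivable f x v.
Proof. by move=> [_ /(_ v)[+ _]]; exact. Qed.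

Lemma Ck_derive k f v : Ck k.+1 f -> Ck k (fun x => 'D_v f x).
Proof. by move=> [_ /(_ v)[]]. Qed.

Lemma Ck_cst k (c : R) : Ck k (fun _ : V => c).
Proof.
elim: k c => [|k IH] c; split => //; try exact: cst_continuous.
move=> v; split => [x|]; first exact: derivable_cst.
have -> : (fun x : V => 'D_v (fun=> c) x) = (fun=> 0).
  by apply/funext => x; rewrite derive_cst.
exact: IH.
Qed.

Lemma CkD k f g : Ck k f -> Ck k g -> Ck k (fun x => f x + g x).
Proof.
elim: k f g => [|k IH] f g Hf Hg; split => //; try by move=> x; apply: cvgD;
  [exact: (Ck_continuous Hf)|exact: (Ck_continuous Hg)].
move=> v; split => [x|].
  by apply: derivableD; [exact: Ck_derivable Hf|exact: Ck_derivable Hg].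
have -> : (fun x => 'D_v (fun x => f x + g x) x) =
    (fun x => 'D_v f x + 'D_v g x).
  apply/funext => x; rewrite deriveD//; first exact: Ck_derivable Hf.
  exact: Ck_derivable Hg.
by apply: IH; exact: Ck_derive.
Qed.

Lemma CkM k f g : Ck k f -> Ck k g -> Ck k (fun x => f x * g x).
Proof.
elim: k f g => [|k IH] f g Hf Hg; split => //; try by move=> x; apply: cvgM;
  [exact: (Ck_continuous Hf)|exact: (Ck_continuous Hg)].
move=> v; split => [x|].
  by apply: derivableM; [exact: Ck_derivable Hf|exact: Ck_derivable Hg].
have -> : (fun x => 'D_v (fun x => f x * g x) x) =
    (fun x => f x * 'D_v g x + g x * 'D_v f x).
  apply/funext => x; rewrite deriveM//; first exact: Ck_derivable Hf.
  exact: Ck_derivable Hg.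
by apply: CkD; apply: IH; try exact: CkW; exact: Ck_derive.
Qed.

Lemma smooth_cst (c : R) : smooth (fun _ : V => c).
Proof. by move=> k; exact: Ck_cst. Qed.

Lemma smoothD f g : smooth f -> smooth g -> smooth (fun x => f x + g x).
Proof. by move=> sf sg k; exact: CkD. Qed.

Lemma smoothM f g : smooth f -> smooth g -> smooth (fun x => f x * g x).
Proof. by move=> sf sg k; exact: CkM. Qed.

Lemma smooth_derive f v : smooth f -> smooth (fun x => 'D_v f x).
Proof. by move=> sf k; exact: (Ck_derive v (sf k.+1)). Qed.

Lemma smooth_continuous f : smooth f -> continuous f.
Proof. by move=> /(_ 0%N) []. Qed.

Lemma smooth_derivable f x v : smooth f -> derivable f x v.
Proof. by move=> /(_ 1%N); exact: Ck_derivable. Qed.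

End normed.

Section composition.
Context (V : normedModType R).

(** With [l0] the linear part of the affine map [l], the difference quotients of the composite along
    v are exactly those of [rho] along [l0 v], so the induction on k runs through directly. *)
Lemma Ck_comp_affine k (rho : R -> R) (l : V -> R) (l0 : V -> R) :
  continuous l -> (forall t v x, l (t *: v + x) = t * l0 v + l x) ->
  Ck k rho -> Ck k (fun x => rho (l x)).
Proof.
move=> cl al; elim: k rho => [|k IH] rho Hr; have cr := Ck_continuous Hr; have C : continuous (rho \o l) by
  move=> x; apply: continuous_comp; [exact: cl|exact: cr].
  by split.
split; first exact: C.
have E v x : (fun h : R => h^-1 *: (rho (l (h *: v + x)) - rho (l x))) =
    (fun h : R => h^-1 *: (rho (h *: l0 v + l x) - rho (l x))).
  by apply/funext => h; rewrite al.
move=> v; split => [x|].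
  by have := Ck_derivable (v := l0 v) (x := l x) Hr; rewrite /derivable E.
have -> : (fun x => 'D_v (fun x => rho (l x)) x) = (fun x => 'D_(l0 v) rho (l x)).
  by apply/funext => x; rewrite /derive E.
by apply: (IH (fun y => 'D_(l0 v) rho y)); exact: Ck_derive.
Qed.

Lemma smooth_comp_affine (rho : R -> R) (l : V -> R) (l0 : V -> R) :
  continuous l -> (forall t v x, l (t *: v + x) = t * l0 v + l x) ->
  smooth rho -> smooth (fun x => rho (l x)).
Proof. by move=> cl al sr k; exact: (Ck_comp_affine cl al). Qed.

End composition.

Section flat.

(** The classical function e^(-1/t), extended by 0, with an extra power of 1/t that closes the
    family under differentiation: the derivative of index k combines the indices k + 2 and k + 1. *)
Definition flat (k : nat) (t : R) : R :=
  if 0 < t then t^-1 ^+ k * expR (- t^-1) else 0.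

Lemma flat_le0 k t : t <= 0 -> flat k t = 0.
Proof. by rewrite /flat leNgt => /negbTE ->. Qed.

Lemma flat_ge0 k t : 0 <= flat k t.
Proof.
rewrite /flat; case: ifPn => // t0.
by rewrite mulr_ge0 ?expR_ge0// exprn_ge0// invr_ge0 ltW.
Qed.

(** The bound e^x >= (x/m)^m at x = 1/t with m = k + 1. Taking m one larger than k leaves a factor
    t, which is what the derivative at 0 requires. *)
Lemma flat_le k t : `|flat k t| <= k.+1%:R ^+ k.+1 * `|t|.
Proof.
rewrite ger0_norm ?flat_ge0// /flat; case: ifPn => t0; last first.
  by rewrite mulr_ge0 ?exprn_ge0.
rewrite (gtr0_norm t0) expRN; have i0 : 0 < t^-1 by rewrite invr_gt0.
pose m : R := k.+1%:R; have m0 : 0 < m by rewrite ltr0n.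
have H : (t^-1 / m) ^+ k.+1 <= expR (t^-1).
  have -> : expR t^-1 = expR (t^-1 / m) ^+ k.+1.
    by rewrite -expRM_natl; congr expR; rewrite mulrC -/m divfK ?gt_eqF.
  rewrite lerXn2r ?nnegrE ?expR_ge0 ?divr_ge0 ?(ltW m0) ?(ltW i0)//.
  by apply: le_trans (expR_ge1Dx _); rewrite lerDr.
rewrite ler_pdivrMr ?expR_gt0//.
apply: (@le_trans _ _ (m ^+ k.+1 * t * (t^-1 / m) ^+ k.+1)); last first.
  by rewrite ler_wpM2l// mulr_ge0 ?exprn_ge0 ?(ltW m0) ?(ltW t0).
rewrite le_eqVlt; apply/orP; left; apply/eqP.
have mm : m ^+ k.+1 * m^-1 ^+ k.+1 = 1.
  by rewrite -exprMn divff ?expr1n// gt_eqF.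
have tt : t * t^-1 = 1 by rewrite divff// gt_eqF.
rewrite exprMn (exprS t^-1) -[LHS]mul1r -mm -[m ^+ _ * _ in LHS]mulr1 -tt.
by move: (m ^+ k.+1) (m^-1 ^+ k.+1) (t^-1 ^+ k) (t^-1) => p q r z; ring.
Qed.

Lemma flat_is_derive k (x : R) :
  is_derive x (1 : R) (flat k : R -> R) (flat k.+2 x - k%:R * flat k.+1 x).
Proof.
have [x0|x0|->] := ltgtP x 0.
- rewrite !flat_le0 ?ltW// mulr0 subr0.
  have H := is_derive_cst (0 : R) x (1 : R).
  apply: (near_eq_is_derive _ H).
  by near=> y; rewrite flat_le0//; apply: ltW; near: y; exact: lt_nbhsl.
- have d1 : is_derive x 1 (fun t : R => t^-1) (- x ^- 2).
    have := @is_deriveV _ (fun y : R => y) x 1 1 (lt0r_neq0 x0) (is_derive_id x 1).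
    by rewrite [_ *: 1]mulr1.
  have d2 : is_derive x^-1 1 (fun y => y ^+ k * expR (- y))
      (x^-1 ^+ k * - expR (- x^-1) + expR (- x^-1) * (k%:R * x^-1 ^+ k.-1)).
    have dX : is_derive x^-1 1 (fun y : R => y ^+ k) (k%:R * x^-1 ^+ k.-1).
      have := @is_deriveX _ _ (fun y : R => y) k x^-1 (1 : R) (1 : R)
        (is_derive_id x^-1 (1 : R)).
      by rewrite exprfctE [_ *: 1]mulr1.
    have dN : is_derive x^-1 1 (fun y : R => - y) (- 1).
      by have := is_deriveN (is_derive_id x^-1 (1 : R)).
    have dE := @is_derive1_comp _ expR (fun y => - y) _ _ _ (is_derive_expR _) dN.
    by have := is_deriveM dX dE; rewrite mulrN1.
  have d3 := @is_derive1_comp _ _ (fun t => t^-1) x _ _ d2 d1.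
  apply: (@near_eq_is_derive _ _ _ ((fun y => y ^+ k * expR (- y)) \o (fun t => t^-1))).
    by near=> y; rewrite /flat /= ifT//; near: y; exact: lt_nbhsr.
  apply: is_derive_eq d3 _.
  rewrite /flat x0 -exprVn; move: (x^-1) (expR _) => y e.
  by clear; case: k => [|k]; rewrite ?mul0r /= !exprS; ring.
rewrite !flat_le0// mulr0 subr0.
(* For h > 0 the difference quotient at 0 is [flat k.+1 h] and for h < 0 it is 0; [flat_le] squeezes
   both. *)
have H : (fun h : R => h^-1 *: (flat k (h *: 1 + 0) - flat k 0)) @ 0^' --> (0 : R).
  rewrite flat_le0//; under eq_fun do rewrite subr0 addr0.
  apply: (@squeeze_cvgr _ _ _ _ (fun h => - (k.+2%:R ^+ k.+2 * `|h|)) (fun h => k.+2%:R ^+ k.+2 * `|h|)).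
  - near=> h; rewrite -ler_norml; apply: le_trans (flat_le k.+1 h).
    have h0 : h != 0 by near: h; exact: nbhs_dnbhs_neq.
    rewrite /flat [h *: 1]mulr1 /GRing.scale /=; case: ifPn => hp.
      by rewrite exprS mulrA.
    by rewrite mulr0.
  - rewrite -[X in _ --> X]oppr0; apply: cvgN.
    rewrite -[X in _ --> X](mulr0 (k.+2%:R ^+ k.+2 : R)); apply: cvgMr.
    rewrite -[X in _ --> X](@normr0 _ R); apply: cvg_norm; exact: nbhs_dnbhs.
  - rewrite -[X in _ --> X](mulr0 (k.+2%:R ^+ k.+2 : R)); apply: cvgMr.
    rewrite -[X in _ --> X](@normr0 _ R); apply: cvg_norm; exact: nbhs_dnbhs.
apply: DeriveDef; first by apply/cvg_ex; exists 0.
by apply: cvg_lim.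
Unshelve. all: by end_near.
Qed.

Lemma flat_derive k v x :
  'D_v (flat k) x = v * (flat k.+2 x - k%:R * flat k.+1 x).
Proof.
have [dx <-] := flat_is_derive k x.
have df : differentiable (flat k) x by apply/derivable1_diffP.
by rewrite !deriveE// -[in LHS](mulr1 v) -[v * 1]/(v *: 1) linearZ.
Qed.

Lemma flat_continuous k : continuous (flat k).
Proof.
move=> x; apply: differentiable_continuous; apply/derivable1_diffP.
by have [] := flat_is_derive k x.
Qed.

Lemma flat_smooth k : smooth (flat k).
Proof.
move=> n; elim: n k => [|n IH] k; split => //; try exact: flat_continuous.
move=> v; split => [x|].
  apply: diff_derivable; apply/derivable1_diffP.
  by have [] := flat_is_derive k x.
have -> : (fun x => 'D_v (flat k) x) =
    (fun x => v * (flat k.+2 x + (- k%:R) * flat k.+1 x)).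
  by apply/funext => x; rewrite flat_derive mulNr.
by apply: CkM; [exact: Ck_cst|apply: CkD => //; apply: CkM => //; exact: Ck_cst].
Qed.

End flat.
End smooth_closure.

(** * Borel sets of the space *)

Section borel.
Context (R : realType).
Notation T3 := (measurableTypeR R * measurableTypeR R * measurableTypeR R)%type.

Definition ocube (q : R * R * R * R) : set T3 :=
  (`]q.1.1.1 - q.2, q.1.1.1 + q.2[ `*` `]q.1.1.2 - q.2, q.1.1.2 + q.2[)
  `*` `]q.1.2 - q.2, q.1.2 + q.2[.

Definition ccube (q : R * R * R * R) : set T3 :=
  (`[q.1.1.1 - q.2, q.1.1.1 + q.2] `*` `[q.1.1.2 - q.2, q.1.1.2 + q.2])
  `*` `[q.1.2 - q.2, q.1.2 + q.2].

Definition ratr4 (q : rat * rat * rat * rat) : R * R * R * R :=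
  (ratr q.1.1.1, ratr q.1.1.2, ratr q.1.2, ratr q.2).

Lemma measurable_ocube q : measurable (ocube q).
Proof. by apply: measurableX => //; exact: measurableX. Qed.

Lemma compact_ccube q : compact (ccube q : set (R * R * R)).
Proof.
by apply: compact_setX; [apply: compact_setX|]; exact: segment_compact.
Qed.

Lemma ocube_ccube q : ocube q `<=` ccube q.
Proof.
move=> [[x y] z] [[/= + +] +]; rewrite !in_itv /= => /andP[? ?] /andP[? ?] /andP[? ?].
by split; [split|]; rewrite /= in_itv /= !ltW.
Qed.

(** The point lies in the open cube, where the bump is positive, while the closed cube stays in U,
    so that the support of the bump is a compact subset of U. A radius below e/2 and a center within
    that radius of x keep the cube in the ball of radius e. *)
Lemma open_cube_cover (U : set (R * R * R)) x : open U -> U x ->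
  exists q, ocube (ratr4 q) x /\ ccube (ratr4 q) `<=` U.
Proof.
move=> oU Ux; have /nbhs_ballP[e /= e0 eU] := open_nbhs_nbhs (conj oU Ux).
have [r] := @rat_in_itvoo R 0 (e / 2) (divr_gt0 e0 (ltr0Sn _ 1)).
rewrite in_itv /= => /andP[r0 re].
have H (y : R) : exists q : rat, `|y - ratr q| < ratr r.
  have [|q] := @rat_in_itvoo R (y - ratr r) (y + ratr r); first by lra.
  by rewrite in_itv /= => /andP[? ?]; exists q; rewrite ltr_norml; lra.
have [q1 h1] := H x.1.1; have [q2 h2] := H x.1.2; have [q3 h3] := H x.2.
exists (q1, q2, q3, r); rewrite !ltr_norml in h1 h2 h3; split.
  by split; [split|]; rewrite /= in_itv /=; lra.
move=> y [[/= y1 y2] y3]; apply: eU; rewrite !in_itv /= in y1 y2 y3.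
by split; [split|]; rewrite /ball /= ltr_norml; lra.
Qed.

(** Measurability refers to the product sigma-algebra of the three lines; an open set belongs to it
    as a union of cubes with rational data, enumerated by [unpickle]. *)
Lemma open_measurable3 (U : set (R * R * R)) : open U -> measurable (U : set T3).
Proof.
move=> oU; pose F k : set T3 := if unpickle k is Some q then
  if `[< ccube (ratr4 q) `<=` U >] then ocube (ratr4 q) else set0 else set0.
have FE k q : unpickle k = Some q -> ccube (ratr4 q) `<=` U -> F k = ocube (ratr4 q).
  by rewrite /F => -> qU; rewrite asboolT.
have -> : (U : set T3) = \bigcup_k F k.
  apply/seteqP; split => x.
    move=> Ux; have [q [qx qU]] := open_cube_cover oU Ux.
    exists (pickle q); first exact: I.
    by rewrite (FE _ _ (pickleK q) qU).
  move=> [k _]; rewrite /F; case: (unpickle k) => // q.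
  by case: asboolP => // qU /ocube_ccube /qU.
apply: bigcupT_measurable => k; rewrite /F; case: (unpickle k) => // q.
by case: ifP => // _; exact: measurable_ocube.
Qed.

Lemma open_preimage_ray (f : R * R * R -> R) (y : R) : continuous f ->
  open (f @^-1` `]y, +oo[).
Proof.
by move=> cf; apply: open_comp => [x _|]; [exact: cf|exact: interval_open].
Qed.

Lemma continuous_measurable3 (f : R * R * R -> R) : continuous f ->
  measurable_fun setT (f : T3 -> R).
Proof.
move=> cf; apply: (measurability _ (RGenOInfty.measurableE R)) => //.
move=> _ [_ [y ->] <-]; rewrite setTI; apply: open_measurable3.
exact: open_preimage_ray.
Qed.

(** The product sigma-algebra is the Borel one: the identity from the Borel space is measurable
    since its coordinates are continuous. This gives access to Dynkin induction starting from the
    open sets. *)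
Lemma measurable3E : @measurable _ T3 = <<s (@open (R * R * R)%type : set (set T3)) >>.
Proof.
apply/seteqP; split; last first.
  apply: smallest_sub => //; first exact: sigma_algebra_measurable.
  exact: open_measurable3.
pose M := g_sigma_algebraType (@open (R * R * R)%type).
have cm (f : R * R * R -> R) : continuous f -> measurable_fun setT (f : M -> R).
  move=> cf; apply: (measurability _ (RGenOInfty.measurableE R)) => //.
  move=> _ [_ [y ->] <-]; rewrite setTI; apply: sub_sigma_algebra.
  exact: open_preimage_ray.
have mid : measurable_fun setT (fun x : M => ((x.1.1, x.1.2), x.2) : T3).
  apply: measurable_fun_pair; [apply: measurable_fun_pair|]; apply: cm => x.
  - by apply: continuous_comp; exact: cvg_fst.
  - by apply: continuous_comp; [exact: cvg_fst|exact: cvg_snd].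
  - exact: cvg_snd.
move=> A mA; have := mid measurableT A mA; rewrite setTI.
have -> : (fun x : M => ((x.1.1, x.1.2), x.2) : T3) @^-1` A = A; last by [].
by apply/seteqP; split => -[[? ?] ?].
Qed.

End borel.

(** * Dominated convergence for real-valued integrals *)

Section dominated.
Context d (T : measurableType d) (R : realType).
Variables (mu : {measure set T -> \bar R}) (D : set T).
Hypothesis mD : measurable D.

Lemma Rint_dominated_cvg (f_ : nat -> T -> R) (f g : T -> R) :
  (forall n, measurable_fun D (f_ n)) -> measurable_fun D f -> L1 mu D g ->
  (forall x, D x -> f_ n x @[n --> \oo] --> f x) ->
  (forall n x, D x -> `|f_ n x| <= g x) ->
  \int[mu]_(x in D) f_ n x @[n --> \oo] --> \int[mu]_(x in D) f x.
Proof.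
move=> mf_ mf ig cf fg; have if_ : L1 mu D f.
  apply: (L1_le mD mf ig) => x Dx.
  have c : `|f_ n x| @[n --> \oo] --> `|f x| by apply: cvg_norm; exact: cf.
  have <- := cvg_lim (@Rhausdorff R) c.
  apply: limr_le; first by apply/cvg_ex; exists (`|f x|).
  by apply: nearW => n; exact: fg.
have := @dominated_convergence _ _ _ mu D mD (fun n => EFin \o f_ n) (EFin \o f)
  (EFin \o g).
case.
- by move=> n; apply/measurable_EFinP.
- by apply/measurable_EFinP.
- by apply: aeW => x Dx; apply: cvg_EFin; [exact: nearW|exact: cf].
- exact: ig.
- by apply: aeW => x n Dx; rewrite lee_fin fg.
by move=> _ _ /= c; apply: fine_cvg; rewrite EFin_Rint.
Qed.

End dominated.

(** * Test functions *)

Section test_functions.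
Context (R : realType) (Omega : set (R * R * R)).
Notation T3 := (measurableTypeR R * measurableTypeR R * measurableTypeR R)%type.
Implicit Types phi psi : R * R * R -> R.

Lemma test_function_sub phi psi : smooth psi -> test_function Omega phi ->
  (forall x, psi x != 0 -> closure [set x | phi x != 0] x) ->
  test_function Omega psi.
Proof.
move=> sp [_ cphi phiO] sub.
have s : closure [set x | psi x != 0] `<=` closure [set x | phi x != 0].
  rewrite [X in _ `<=` X](closure_id _).1; last exact: closed_closure.
  exact: closureS.
split => //; last exact: subset_trans phiO.
by apply: subclosed_compact cphi s; exact: closed_closure.
Qed.

Lemma test_function_smooth phi : test_function Omega phi -> smooth phi.
Proof. by case. Qed.

Lemma test_functionM phi psi : test_function Omega phi -> smooth psi ->
  test_function Omega (fun x => phi x * psi x).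
Proof.
move=> tp sp; apply: test_function_sub (tp) _.
  by apply: smoothM => //; exact: test_function_smooth.
move=> x H; apply: subset_closure => /=; apply: contra_neq H => ->.
by rewrite mul0r.
Qed.

Lemma test_functionZ k phi : test_function Omega phi ->
  test_function Omega (fun x => k * phi x).
Proof.
move=> tp; have := test_functionM tp (smooth_cst _ k).
by under [X in test_function _ X]eq_fun do rewrite mulrC.
Qed.

Lemma test_functionD phi psi : test_function Omega phi ->
  test_function Omega psi -> test_function Omega (fun x => phi x + psi x).
Proof.
move=> [s1 c1 o1] [s2 c2 o2].
have s : closure [set x | phi x + psi x != 0] `<=`
    closure [set x | phi x != 0] `|` closure [set x | psi x != 0].
  rewrite -closureU; apply: closureS => x /= H.
  have [p0|] := eqVneq (phi x) 0; last by left.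
  by right; move: H; rewrite p0 add0r.
split; first exact: smoothD.
  apply: subclosed_compact s; first exact: closed_closure.
  by move=> F PF FA; have := @bigsetU_compact _ bool (fun b => if b then
    closure [set x | phi x != 0] else closure [set x | psi x != 0])
    [:: true; false] xpredT; rewrite !big_cons big_nil setU0; apply => // -[].
by move=> x /s [/o1|/o2].
Qed.

Lemma test_function_derive v phi : test_function Omega phi ->
  test_function Omega (fun x => 'D_v phi x).
Proof.
move=> tp; apply: test_function_sub (tp) _.
  by apply: smooth_derive; exact: test_function_smooth.
move=> x; apply: contraPP => nx; have n0 : \forall y \near x, phi y = 0.
  have := open_nbhs_nbhs (conj (closed_openC (@closed_closure _ [set x | phi x != 0])) nx).
  apply: filterS => y ny; apply/eqP; apply: contra_notT ny.
  exact: (@subset_closure _ [set x | phi x != 0] y).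
apply/negP; rewrite negbK; apply/eqP.
rewrite (near_eq_derive (g := cst 0))//; exact: derive_cst.
Qed.

Lemma test_function0 : test_function Omega (fun=> 0).
Proof.
have e : [set x : R * R * R | (0 : R) != 0] = set0.
  by apply/seteqP; split => x //=; rewrite eqxx.
split; first exact: smooth_cst; rewrite e closure0 //.
exact: compact0.
Qed.

Definition bump1 (c r t : R) : R := flat 0 (t - (c - r)) * flat 0 (c + r - t).

Lemma flat0_lt1 t : flat 0 t < 1 :> R.
Proof.
rewrite /flat; case: ifPn => // t0.
by rewrite expr0 mul1r expR_lt1 oppr_lt0 invr_gt0.
Qed.

Lemma bump1_ge0 c r t : 0 <= bump1 c r t.
Proof. by rewrite mulr_ge0 ?flat_ge0. Qed.

Lemma bump1_lt1 c r t : bump1 c r t < 1.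
Proof.
apply: le_lt_trans (flat0_lt1 (t - (c - r))).
by rewrite ler_piMr ?flat_ge0// ltW// flat0_lt1.
Qed.

Lemma bump1_gt0 c r t : c - r < t < c + r -> 0 < bump1 c r t.
Proof.
move=> /andP[h1 h2]; rewrite /bump1 /flat !subr_gt0 h1 h2 !expr0 !mul1r.
by rewrite mulr_gt0 ?expR_gt0.
Qed.

Lemma bump1_neq0 c r t : bump1 c r t != 0 -> c - r <= t <= c + r.
Proof.
rewrite /bump1 mulf_eq0 negb_or => /andP[h1 h2]; apply/andP; split.
  by rewrite leNgt; apply: contra h1 => h; rewrite flat_le0// subr_le0 ltW.
by rewrite leNgt; apply: contra h2 => h; rewrite flat_le0// subr_le0 ltW.
Qed.

Lemma bump1_smooth c r : smooth (bump1 c r).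
Proof.
apply: smoothM.
  apply: (@smooth_comp_affine _ _ (flat 0) (fun t => t - (c - r)) id).
  - by move=> x; apply: cvgB => //; exact: cvg_cst.
  - by move=> t v x; rewrite addrA.
  - exact: flat_smooth.
apply: (@smooth_comp_affine _ _ (flat 0) (fun t => c + r - t) (fun t => - t)).
- by move=> x; apply: cvgB => //; exact: cvg_cst.
- by move=> t v x; rewrite opprD mulrN addrCA.
- exact: flat_smooth.
Qed.

Definition bump (q : R * R * R * R) (x : R * R * R) : R :=
  bump1 q.1.1.1 q.2 x.1.1 * bump1 q.1.1.2 q.2 x.1.2 * bump1 q.1.2 q.2 x.2.

Lemma bump_ge0 q x : 0 <= bump q x.
Proof.
by rewrite /bump mulr_ge0 ?bump1_ge0// mulr_ge0 ?bump1_ge0.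
Qed.

Lemma bump_lt1 q x : bump q x < 1.
Proof.
apply: le_lt_trans (bump1_lt1 q.1.1.1 q.2 x.1.1); rewrite /bump -mulrA.
by rewrite ler_piMr ?bump1_ge0// mulr_ile1 ?bump1_ge0// ltW// bump1_lt1.
Qed.

Lemma bump_gt0 q x : ocube q x -> 0 < bump q x.
Proof.
by move=> [[/= h1 h2] h3]; rewrite !in_itv /= in h1 h2 h3;
  rewrite /bump mulr_gt0 ?bump1_gt0// mulr_gt0 ?bump1_gt0.
Qed.

Lemma bump_neq0 q x : bump q x != 0 -> ccube q x.
Proof.
rewrite /bump mulf_eq0 negb_or mulf_eq0 negb_or => /andP[/andP[h1 h2] h3].
by split; [split|]; rewrite /= in_itv /=; exact: bump1_neq0.
Qed.

Lemma bump_smooth q : smooth (bump q).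
Proof.
apply: smoothM; [apply: smoothM|].
- apply: (@smooth_comp_affine _ _ _ (fun x : R * R * R => x.1.1) (fun x => x.1.1)) => //.
    by move=> x; apply: continuous_comp; exact: cvg_fst.
  exact: bump1_smooth.
- apply: (@smooth_comp_affine _ _ _ (fun x : R * R * R => x.1.2) (fun x => x.1.2)) => //.
    by move=> x; apply: continuous_comp; [exact: cvg_fst|exact: cvg_snd].
  exact: bump1_smooth.
apply: (@smooth_comp_affine _ _ _ (fun x : R * R * R => x.2) (fun x => x.2)) => //.
  by move=> x; exact: cvg_snd.
exact: bump1_smooth.
Qed.

Lemma bump_test q : ccube q `<=` Omega -> test_function Omega (bump q).
Proof.
move=> qO; have cc := @compact_ccube R q.
have s : closure [set x | bump q x != 0] `<=` ccube q.
  have clc : closed (ccube q : set (R * R * R)).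
    by apply: compact_closed => //; exact: norm_hausdorff.
  rewrite [X in _ `<=` X](closure_id _).1//; apply: closureS => x /=.
  exact: bump_neq0.
split; [exact: bump_smooth| |exact: subset_trans qO].
by apply: subclosed_compact s => //; exact: closed_closure.
Qed.

(* Complementation turns sums into products: for bumps chi_j whose supports
   exhaust U, the functions 1 - prod_(j < n) (1 - chi_j)^n are test functions
   increasing to the indicator function of U. *)
Lemma one_minus_test_prod (I : Type) (s : seq I) (f : I -> R * R * R -> R) :
  (forall i, test_function Omega (fun x => 1 - f i x)) ->
  test_function Omega (fun x => 1 - \prod_(i <- s) f i x).
Proof.
move=> tf; elim: s => [|i s IH].
  by under eq_fun do rewrite big_nil subrr; exact: test_function0.
have -> : (fun x => 1 - \prod_(j <- i :: s) f j x) = (fun x => (1 - f i x)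
    + ((1 - \prod_(j <- s) f j x) + (-1) * ((1 - f i x) * (1 - \prod_(j <- s) f j x)))).
  by apply/funext => x; rewrite big_cons; ring.
apply: test_functionD => //; apply: test_functionD => //.
apply: test_functionZ; apply: test_functionM => //; exact: test_function_smooth.
Qed.

Lemma test_function_approx_open (U : set (R * R * R)) : open U -> U `<=` Omega ->
  exists phi : nat -> R * R * R -> R, [/\ forall n, test_function Omega (phi n),
    forall n x, 0 <= phi n x <= 1 &
    forall x, phi n x @[n --> \oo] --> (\1_U x : R)].
Proof.
move=> oU UO; pose chi k : R * R * R -> R := if unpickle k is Some q then
  if `[< ccube (ratr4 R q) `<=` U >] then bump (ratr4 R q) else (fun=> 0) else (fun=> 0).
have chiE k q : unpickle k = Some q -> ccube (ratr4 R q) `<=` U ->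
    chi k = bump (ratr4 R q).
  by rewrite /chi => -> qU; rewrite asboolT.
have chi_cases k : chi k = (fun=> 0) \/
    exists q, ccube q `<=` U /\ chi k = bump q.
  rewrite /chi; case: (unpickle k) => [q|]; last by left.
  by case: asboolP => qU; [right; exists (ratr4 R q)|left].
have chi01 k x : 0 <= chi k x < 1.
  by have [->|[q [_ ->]]] := chi_cases k; rewrite ?lexx ?ltr01// bump_ge0 bump_lt1.
have chi_test k : test_function Omega (chi k).
  have [->|[q [qU ->]]] := chi_cases k; first exact: test_function0.
  by apply: bump_test; exact: subset_trans UO.
have chi_out k x : ~ U x -> chi k x = 0.
  move=> nU; have [->//|[q [qU ->]]] := chi_cases k.
  by apply/eqP; apply: contra_notT nU => /bump_neq0 /qU.
(* The inner product is the n-th power, written so that [one_minus_test_prod] applies twice. The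
   growing power drives the factor of any bump that is positive at x to 0. *)
pose om n x := \prod_(j <- iota 0 n) \prod_(i <- iota 0 n) (1 - chi j x).
have om01 n x : 0 <= om n x <= 1.
  have c j : 0 <= 1 - chi j x <= 1 by have := chi01 j x; lra.
  have g j : 0 <= \prod_(i <- iota 0 n) (1 - chi j x) <= 1.
    by rewrite prodr_ge0 ?prodr_ile1// => i _; have /andP[] := c j.
  by rewrite /om prodr_ge0 ?prodr_ile1// => i _; have /andP[] := g i.
exists (fun n x => 1 - om n x); split.
- move=> n; apply: (@one_minus_test_prod _ (iota 0 n)
    (fun j x => \prod_(i <- iota 0 n) (1 - chi j x))) => j.
  apply: (@one_minus_test_prod _ (iota 0 n) (fun _ x => 1 - chi j x)) => i.
  by under eq_fun do rewrite opprB addrC subrK.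
- by move=> n x; have := om01 n x; lra.
move=> x; have [Ux|nU] := pselect (U x); last first.
  rewrite indicE memNset//; apply: cvg_near_cst; apply: nearW => n.
  rewrite /om big1 ?subrr// => j _; rewrite big1// => i _.
  by rewrite chi_out// subr0.
rewrite indicE mem_set//.
have [q [qx qU]] := open_cube_cover oU Ux.
pose k := pickle q.
have ckx : 0 < chi k x by rewrite (chiE _ _ (pickleK q) qU) bump_gt0.
have omle n : (k < n)%N -> om n x <= (1 - chi k x) ^+ n.
  have c j : 0 <= 1 - chi j x <= 1 by have := chi01 j x; lra.
  have g j : 0 <= \prod_(i <- iota 0 n) (1 - chi j x) <= 1.
    by rewrite prodr_ge0 ?prodr_ile1// => i _; have /andP[] := c j.
  move=> kn; rewrite /om (big_rem k) ?mem_iota//=.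
  rewrite big_const_seq count_predT size_iota iter_mulr_1.
  rewrite ler_piMr ?exprn_ge0 ?prodr_ile1//; first by have /andP[] := c k.
rewrite -[X in _ --> X]subr0; apply: cvgB; first exact: cvg_cst.
apply: (@squeeze_cvgr _ _ _ _ (fun=> 0) (fun n => (1 - chi k x) ^+ n)).
- by near=> n; have /andP[-> _] /= := om01 n x; apply: omle; near: n;
    exists k.+1.
- exact: cvg_cst.
- by apply: cvg_expr; have := chi01 k x; rewrite ltr_norml; lra.
Unshelve. all: by end_near.
Qed.

(* The sets over which g integrates to 0 form a Dynkin system containing the
   open sets. *)
Lemma ae_eq0_test (g : R * R * R -> R) : open Omega -> L1 leb3 Omega g ->
  (forall phi, test_function Omega phi ->
    \int[leb3]_(x in Omega) (g x * phi x) = 0) ->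
  {ae leb3, forall x, Omega x -> g x = 0}.
Proof.
move=> oO ig H; have mO := open_measurable3 oO : measurable (Omega : set T3).
have iS (A : set T3) : measurable A -> L1 leb3 (A `&` Omega) g.
  by move=> mA; apply: integrableS ig => //; exact: measurableI.
have PU (U : set T3) : open (U : set (R * R * R)) ->
    \int[leb3]_(x in U `&` Omega) g x = 0.
  move=> oU; have mU := open_measurable3 oU.
  have [phi [tphi phi01 cphi]] :=
    test_function_approx_open (openI oU oO) (@subIsetr _ U Omega).
  have c : (\int[leb3]_(x in Omega) (g x * phi n x)) @[n --> \oo] -->
     \int[leb3]_(x in Omega) (g x * \1_(U `&` Omega) x).
    apply: (Rint_dominated_cvg mO (g := fun x => `|g x|)).
    + move=> n; apply: measurable_funM; first exact: L1_measurable ig.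
      apply: measurable_funTS; apply: continuous_measurable3.
      by apply: smooth_continuous; apply: test_function_smooth.
    + apply: measurable_funM; first exact: L1_measurable ig.
      by apply: measurable_indic; apply: open_measurable3; exact: openI.
    + exact: L1_norm.
    + by move=> x _; apply: cvgM; [exact: cvg_cst|exact: cphi].
    + move=> n x _; rewrite normrM ler_piMr//.
      by have /andP[h1 h2] := phi01 n x; rewrite ger0_norm.
  rewrite Rintegral_mkcondl -(cvg_lim (@Rhausdorff R) (cvg_cst (0 : R) (F := \oo))).
  rewrite (_ : (fun=> 0) = (fun n => \int[leb3]_(x in Omega) (g x * phi n x))).
    rewrite (cvg_lim (@Rhausdorff R) c); apply: Rint_eq => x Ox.
    by rewrite patchE indicE in_setI (mem_set Ox) andbT; case: ifP; rewrite ?mulr1 ?mulr0.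
  by apply/funext => n; rewrite H.
have P (A : set T3) : measurable A -> \int[leb3]_(x in A `&` Omega) g x = 0.
  move=> mA; move: (mA); rewrite measurable3E.
  apply: (@dynkin_induction _ _ _
    (fun A : set T3 => \int[leb3]_(x in A `&` Omega) g x = 0) (measurable3E R)).
  - by move=> U V; exact: openI.
  - by apply: PU; exact: openT.
  - exact: PU.
  - move=> {mA} {}A mA A0; have := PU setT openT; rewrite setTI.
    rewrite -{1}(setTI Omega) -(setUv A) setIUl Rintegral_setU.
    + by rewrite A0 add0r.
    + exact: measurableI.
    + by apply: measurableI => //; exact: measurableC.
    + by rewrite -setIUl setUv; exact: iS.
    + by apply/disj_setPS => x [[h _] [h' _]].
  move=> F mF tF F0; apply: EFin_inj; rewrite EFin_Rint//; last first.
  - by apply: iS; exact: bigcupT_measurable.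
  - by apply: measurableI => //; exact: bigcupT_measurable.
  rewrite setI_bigcupl integral_bigcup.
  - apply: eseries0 => k _ _; rewrite -EFin_Rint ?F0//; last exact: iS.
    exact: measurableI.
  - exact: trivIset_setIr.
  - by move=> k; exact: measurableI.
  - by rewrite -setI_bigcupl; apply: iS; exact: bigcupT_measurable.
have : ae_eq leb3 Omega (EFin \o g) (cst 0%E).
  apply: (integral_ae_eq mO ig); first exact: measurable_cst.
  move=> E EO mE; rewrite integral0.
  have EE : E = E `&` Omega by rewrite setIidl.
  rewrite EE -EFin_Rint ?P//; [exact: measurableI|exact: iS].
by apply: filterS => x h Ox; have [] := h Ox.
Qed.

End test_functions.

(** * Integration along coordinate lines *)

Section coordinate_lines.
Context (R : realType).
Notation T3 := (measurableTypeR R * measurableTypeR R * measurableTypeR R)%type.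
Notation leb := (@lebesgue_measure R).
Lemma leb_itv_lty (a b : R) : (leb `[a, b]%classic < +oo)%E.
Proof. by rewrite lebesgue_measure_itv /=; case: ifP => _; rewrite ?ltry// -EFinB ltry. Qed.

Lemma leb2_sigma_finite : sigma_finite setT (leb \x leb)%E.
Proof.
exists (fun n : nat => `[(- n%:R)%R, n%:R]%classic `*` `[(- n%:R)%R, n%:R]%classic).
  apply/esym/seteqP; split => // -[x y] _.
  exists (Num.truncn (Num.max `|x| `|y|)).+1 => //=.
  have /ltW := truncnS_gt (Num.max `|x| `|y|); rewrite ge_max => /andP[hx hy].
  by rewrite !in_itv /= -!ler_norml.
move=> n; split; first exact: measurableX.
rewrite product_measure1E//.
by rewrite lte_mul_pinfty ?ge0_fin_numE ?measure_ge0 ?leb_itv_lty.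
Qed.

(** Packaging the planar product as a sigma-finite measure lets [leb3] be read as a product of
    [leb2] with the line, so that the Fubini and Tonelli theorems apply to each factor in turn. *)
Definition leb2 : {sigma_finite_measure
  set (measurableTypeR R * measurableTypeR R)%type -> \bar R} :=
  HB.pack (leb \x leb)%E (@Measure_isSigmaFinite.Build _ _ _ (leb \x leb)%E leb2_sigma_finite).
Implicit Types (i : 'I_3) (F f phi psi : R * R * R -> R) (y : R * R) (s t : R).

Lemma leb2X A1 A2 : measurable A1 -> measurable A2 ->
  (leb2 (A1 `*` A2) = leb A1 * leb A2)%E.
Proof. by move=> m1 m2; exact: (product_measure1E leb leb). Qed.

Lemma leb3X A1 A2 : measurable A1 -> measurable A2 ->
  (leb3 (A1 `*` A2) = leb2 A1 * leb A2)%E.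
Proof. by move=> m1 m2; exact: (product_measure1E leb2 leb). Qed.

Definition ins i y s : R * R * R :=
  if val i is 0%N then ((s, y.1), y.2)
  else if val i is 1%N then ((y.1, s), y.2)
  else ((y.1, y.2), s).

Lemma insE i y s : ins i y s = s *: ebasis i + ins i y 0.
Proof.
have P (u v : R * R * R) : u.1.1 = v.1.1 -> u.1.2 = v.1.2 -> u.2 = v.2 -> u = v.
  by case: u v => [[? ?] ?] [[? ?] ?] /= -> -> ->.
case: i => -[|[|[|//]]] ?; rewrite /ins /ebasis /=; apply: P => /=;
  by rewrite ?scaler0 ?[_ *: 1]mulr1 ?add0r ?addr0.
Qed.

Lemma insD i y s h : ins i y (h *: 1 + s) = h *: ebasis i + ins i y s.
Proof. by rewrite insE [in RHS]insE addrA -scalerDl [h *: 1]mulr1. Qed.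

Lemma slice_quotient F i y s :
  (fun h : R => h^-1 *: (F (ins i y (h *: 1 + s)) - F (ins i y s))) =
  (fun h : R => h^-1 *: (F (h *: ebasis i + ins i y s) - F (ins i y s))).
Proof. by apply/funext => h; rewrite insD. Qed.

Lemma slice_derivable F i y s : derivable F (ins i y s) (ebasis i) ->
  derivable (fun s => F (ins i y s)) s 1.
Proof. by rewrite /derivable slice_quotient. Qed.

Lemma slice_derive F i y s :
  'D_1 (fun s => F (ins i y s)) s = 'D_(ebasis i) F (ins i y s).
Proof. by rewrite /derive slice_quotient. Qed.

Lemma ins_continuous i y : continuous (ins i y).
Proof.
move=> s; rewrite (_ : ins i y = (fun s => s *: ebasis i + ins i y 0)); last first.
  by apply/funext => t; exact: insE.
by apply: cvgD; [apply: cvgZr_tmp; exact: cvg_id|exact: cvg_cst].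
Qed.

Lemma slice_continuous F i y : continuous F -> continuous (fun s => F (ins i y s)).
Proof.
by move=> cF s; apply: continuous_comp; [exact: ins_continuous|exact: cF].
Qed.

Lemma Rint_derive1 (f : R -> R) (a b : R) : a < b ->
  (forall x, derivable f x 1) -> continuous (fun x => 'D_1 f x) ->
  (\int[leb]_(x in `[a, b]) ('D_1 f x)%:E)%E = (f b - f a)%:E.
Proof.
move=> ab df cf; have cf0 : continuous f.
  by move=> x; apply: differentiable_continuous; exact/derivable1_diffP.
rewrite (@continuous_FTC2 _ (fun x => 'D_1 f x) f) ?EFinB//.
- exact: continuous_subspaceT.
- split => //.
  + by apply: cvg_at_right_filter; exact: cf0.
  + by apply: cvg_at_left_filter; exact: cf0.
- by move=> x _; rewrite derive1E.
Qed.

Definition cbox (B : R) : set T3 :=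
  (`[- B, B] `*` `[- B, B]) `*` `[- B, B].

Lemma cboxP B x : reflect (cbox B x)
  [&& `|x.1.1| <= B, `|x.1.2| <= B & `|x.2| <= B].
Proof.
apply: (iffP and3P); rewrite !ler_norml.
  by move=> [? ? ?]; split; [split|]; rewrite /= in_itv.
by move=> [[/= h1 h2] h3]; rewrite !in_itv /= in h1 h2 h3.
Qed.

Lemma measurable_cbox B : measurable (cbox B).
Proof. by apply: measurableX => //; exact: measurableX. Qed.

Lemma leb3_cbox B : (leb3 (cbox B) < +oo)%E.
Proof.
have h := leb_itv_lty (- B) B.
rewrite leb3X//; last exact: measurableX.
by rewrite leb2X// !lte_mul_pinfty ?ge0_fin_numE ?mule_ge0 ?measure_ge0// lte_mul_pinfty ?ge0_fin_numE ?measure_ge0.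
Qed.

Lemma test_bounded Omega phi : test_function Omega phi ->
  exists2 B, 0 < B & (forall x, ~ cbox B x -> phi x = 0) /\
    (forall x, `|phi x| <= B).
Proof.
move=> [sp cp _].
have [M1 [_ HM1]] := compact_bounded cp.
have : compact (phi @` closure [set x | phi x != 0]).
  by apply: continuous_compact => //; apply: continuous_subspaceT => x;
    exact: (smooth_continuous sp).
move=> /compact_bounded [M2 [_ HM2]].
pose B := 1 + `|M1| + `|M2|.
have B0 : 0 < B by rewrite /B; have := normr_ge0 M1; have := normr_ge0 M2; lra.
have B1 : M1 < B by rewrite /B; have := ler_norm M1; have := normr_ge0 M2; lra.
have B2 : M2 < B by rewrite /B; have := ler_norm M2; have := normr_ge0 M1; lra.
exists B => //; split => x.
  move=> nx; apply/eqP; apply: contra_notT nx => px; apply/cboxP.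
  have : `|x : R * R * R| <= B.
    exact: HM1 B B1 x (@subset_closure _ [set x | phi x != 0] x px).
  rewrite prod_normE /= ge_max prod_normE.
  by rewrite ge_max => /andP[/andP[-> ->] ->].
have [->|px] := eqVneq (phi x) 0; first by rewrite normr0 ltW.
by apply: (HM2 B B2); exists x => //; exact: subset_closure.
Qed.

Lemma integrable_cbox f B : continuous f -> (forall x, `|f x| <= B) ->
  (forall x, ~ cbox B x -> f x = 0) -> leb3.-integrable setT (EFin \o f).
Proof.
move=> cf fB f0.
have -> : EFin \o f = (EFin \o f) \_ (cbox B).
  apply/funext => x; rewrite patchE; case: ifPn => //= /negP nx.
  by rewrite f0// => bx; apply: nx; rewrite inE.
apply/(integrable_mkcond _ (measurable_cbox B)).
apply: measurable_bounded_integrable.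
- exact: measurable_cbox.
- exact: leb3_cbox.
- by apply: measurable_funTS; exact: continuous_measurable3.
- by exists B; split; [exact: num_real|move=> M BM x _; apply: le_trans (fB x) (ltW BM)].
Qed.

Lemma integrable_plane f B (z : R) : continuous f -> (forall x, `|f x| <= B) ->
  (forall x, ~ cbox B x -> f x = 0) ->
  leb2.-integrable setT (fun p => (f (p, z))%:E).
Proof.
move=> cf fB f0; pose A : set (measurableTypeR R * measurableTypeR R) :=
  `[- B, B] `*` `[- B, B].
have mA : measurable A by exact: measurableX.
have fA : (leb2 A < +oo)%E.
  have h := leb_itv_lty (- B) B.
  by rewrite /A leb2X// lte_mul_pinfty ?ge0_fin_numE ?measure_ge0.
have -> : (fun p => (f (p, z))%:E) = (EFin \o (fun p => f (p, z))) \_ A.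
  apply/funext => p; rewrite patchE; case: ifPn => //= /negP nx.
  by rewrite f0// => -[bx _]; apply: nx; rewrite inE.
apply/(integrable_mkcond _ mA).
apply: measurable_bounded_integrable => //.
- apply: measurable_funTS.
  exact: (measurable_fun_pair1 z (continuous_measurable3 cf)).
- by exists B; split; [exact: num_real|move=> M BM p _; apply: le_trans (fB _) (ltW BM)].
Qed.

(** Fubini with the i-th variable innermost; each of the three axes takes its own order of
    integration. *)
Lemma integral_slices0 f B i : continuous f -> (forall x, `|f x| <= B) ->
  (forall x, ~ cbox B x -> f x = 0) ->
  (forall y, \int[leb]_s (f (ins i y s))%:E = 0)%E ->
  (\int[leb3]_x (f x)%:E = 0)%E.
Proof.
move=> cf fB f0; have If := integrable_cbox cf fB f0.
case: i => -[|[|[|//]]] ?; rewrite /ins /= => H.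
- apply: (eq_trans (esym (@integral21_prod_meas1 _ _ _ _ R leb2 leb _ If))).
  apply: integral0_eq => z _.
  have I2 := integrable_plane z cf fB f0.
  apply: (eq_trans (esym (@integral21_prod_meas1 _ _ _ _ R leb leb _ I2))).
  by apply: integral0_eq => y _; exact: (H (y, z)).
- apply: (eq_trans (esym (@integral21_prod_meas1 _ _ _ _ R leb2 leb _ If))).
  apply: integral0_eq => z _.
  have I2 := integrable_plane z cf fB f0.
  apply: (eq_trans (esym (@integral12_prod_meas1 _ _ _ _ R leb leb _ I2))).
  by apply: integral0_eq => y _; exact: (H (y, z)).
apply: (eq_trans (esym (@integral12_prod_meas1 _ _ _ _ R leb2 leb _ If))).
apply: integral0_eq => -[y1 y2] _.
exact: (H (y1, y2)).
Qed.

Lemma ins_notin_cbox i y s B : B < `|s| -> ~ cbox B (ins i y s).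
Proof.
move=> Bs /cboxP/and3P; case: i => -[|[|[|//]]] ? [] /=; rewrite leNgt ?Bs//.
- by move=> _; rewrite leNgt Bs.
by move=> _ _; rewrite leNgt Bs.
Qed.

Lemma Rint_test_derive Omega i phi : test_function Omega phi ->
  (\int[leb3]_x ('D_(ebasis i) phi x)%:E = 0)%E.
Proof.
move=> tp; have sp := test_function_smooth tp.
have td := test_function_derive (ebasis i) tp.
have [B1 B10 [phi0 _]] := test_bounded tp.
have [B2 B20 [d0 dB]] := test_bounded td.
have cd := smooth_continuous (test_function_smooth td).
apply: (@integral_slices0 _ B2 i) => // y.
(* B exceeds both support bounds: [phi] vanishes at the endpoints of [-B, B], and its derivative
   vanishes outside this segment. *)
pose B := B1 + B2 + 1; pose f s := phi (ins i y s).
have df s : derivable f s 1 by apply: slice_derivable; exact: smooth_derivable.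
have dE : (fun s => 'D_1 f s) = (fun s => 'D_(ebasis i) phi (ins i y s)).
  by apply/funext => s; exact: slice_derive.
have cf : continuous (fun s => 'D_1 f s) by rewrite dE;
  exact: (@slice_continuous (fun x => 'D_(ebasis i) phi x) i y cd).
have := Rint_derive1 (_ : - B < B) df cf.
have -> : f B = 0.
  by apply: phi0; apply: ins_notin_cbox; rewrite ger0_norm /B; lra.
have -> : f (- B) = 0.
  by apply: phi0; apply: ins_notin_cbox; rewrite normrN ger0_norm /B; lra.
rewrite subrr => H; rewrite -[RHS]H; last by rewrite /B; lra.
rewrite [RHS]integral_mkcond; apply: eq_integral => s _.
rewrite patchE; case: ifPn => [_|]; first by rewrite -[X in X%:E]slice_derive.
rewrite notin_setE /= in_itv /= -ler_norml => /negP; rewrite -ltNge => Bs.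
by rewrite d0//; apply: ins_notin_cbox; apply: le_lt_trans Bs; rewrite /B; lra.
Qed.

End coordinate_lines.

(** * Integration by parts for test functions *)

Section test_weak_derivative.
Context (R : realType) (Omega : set (R * R * R)).
Hypothesis oO : open Omega.
Notation T3 := (measurableTypeR R * measurableTypeR R * measurableTypeR R)%type.
Implicit Types (i : 'I_3) (phi psi : R * R * R -> R).

Lemma test_function_out phi x : test_function Omega phi -> ~ Omega x -> phi x = 0.
Proof.
move=> [_ _ pO] nx; apply/eqP; apply: contra_notT nx => px; apply: pO.
exact: (@subset_closure _ [set x | phi x != 0] x px).
Qed.

Lemma test_L1 phi : test_function Omega phi -> L1 leb3 Omega phi.
Proof.
move=> tp; have [B B0 [h1 h2]] := test_bounded tp.
apply: integrableS (integrable_cbox (smooth_continuous (test_function_smooth tp)) h2 h1) => //.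
exact: open_measurable3.
Qed.

Lemma test_L2 phi : test_function Omega phi -> L2 leb3 Omega phi.
Proof.
move=> tp; split.
  apply: measurable_funTS; apply: continuous_measurable3.
  exact: (smooth_continuous (test_function_smooth tp)).
have := test_L1 (test_functionM tp (test_function_smooth tp)).
by under eq_fun do rewrite -expr2.
Qed.

Lemma test_ibp i phi psi : test_function Omega phi -> test_function Omega psi ->
  \int[leb3]_(x in Omega) (phi x * 'D_(ebasis i) psi x) =
  - \int[leb3]_(x in Omega) ('D_(ebasis i) phi x * psi x).
Proof.
move=> tp tq; have mO := open_measurable3 oO.
have tpq := test_functionM tp (test_function_smooth tq).
have l1 : L1 leb3 Omega (fun x => phi x * 'D_(ebasis i) psi x).
  exact: L2M (test_L2 tp) (test_L2 (test_function_derive _ tq)).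
have l2 : L1 leb3 Omega (fun x => 'D_(ebasis i) phi x * psi x).
  exact: L2M (test_L2 (test_function_derive _ tp)) (test_L2 tq).
apply/eqP; rewrite -addr_eq0 -RintegralD//; apply/eqP.
rewrite -[RHS](congr1 fine (Rint_test_derive i tpq)) Rintegral_mkcond.
rewrite /Rintegral; congr fine; apply: eq_integral => x _; rewrite patchE.
have dE : 'D_(ebasis i) (fun x => phi x * psi x) x =
    phi x * 'D_(ebasis i) psi x + 'D_(ebasis i) phi x * psi x.
  rewrite deriveM; [|exact: smooth_derivable (test_function_smooth tp)|
    exact: smooth_derivable (test_function_smooth tq)].
  by congr (_ + _); rewrite [RHS]mulrC.
case: ifPn => [_|]; first by rewrite dE.
rewrite notin_setE => nx.
by rewrite dE !(test_function_out _ nx)// ?mul0r ?mulr0 ?addr0.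
Qed.

End test_weak_derivative.

(** * The Poincare inequality on cells *)

Section tonelli.
Context d1 d2 (T1 : measurableType d1) (T2 : measurableType d2) (R : realType).
Variables (m1 : {sigma_finite_measure set T1 -> \bar R}).
Variables (m2 : {sigma_finite_measure set T2 -> \bar R}).
Variables (A : set T1) (B : set T2) (f : T1 * T2 -> \bar R).
Hypotheses (mA : measurable A) (mB : measurable B).
Hypotheses (mf : measurable_fun setT f) (f0 : forall z, (0 <= f z)%E).

Let mfAB : measurable_fun setT (f \_ (A `*` B)).
Proof.
apply/(measurable_restrictT _ (measurableX mA mB)).
exact: measurable_funTS.
Qed.

Let fAB0 z : (0 <= (f \_ (A `*` B)) z)%E.
Proof. by rewrite patchE; case: ifP. Qed.

Lemma tonelli_setX1 : (\int[m1 \x m2]_(z in A `*` B) f z =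
  \int[m1]_(x in A) \int[m2]_(y in B) f (x, y))%E.
Proof.
rewrite integral_mkcond (fubini_tonelli1 _ mfAB fAB0) [RHS]integral_mkcond.
apply: eq_integral => x _; rewrite /fubini_F patchE; case: ifPn => xA.
  rewrite [RHS]integral_mkcond; apply: eq_integral => y _.
  by rewrite !patchE in_setX xA.
apply: integral0_eq => y _; by rewrite patchE in_setX (negbTE xA).
Qed.

Lemma tonelli_setX2 : (\int[m1 \x m2]_(z in A `*` B) f z =
  \int[m2]_(y in B) \int[m1]_(x in A) f (x, y))%E.
Proof.
rewrite integral_mkcond (fubini_tonelli2 _ mfAB fAB0) [RHS]integral_mkcond.
apply: eq_integral => y _; rewrite /fubini_G patchE; case: ifPn => yB.
  rewrite [RHS]integral_mkcond; apply: eq_integral => x _.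
  by rewrite !patchE in_setX yB andbT.
apply: integral0_eq => x _; by rewrite patchE in_setX (negbTE yB) andbF.
Qed.

Lemma measurable_tonelli_section : measurable_fun A (fun x => \int[m2]_(y in B) f (x, y))%E.
Proof.
have -> : (fun x => \int[m2]_(y in B) f (x, y))%E = fubini_F m2 (f \_ (setT `*` B)).
  apply/funext => x; rewrite /fubini_F [LHS]integral_mkcond; apply: eq_integral => y _.
  by rewrite !patchE in_setX in_setT.
apply: measurable_funTS; apply: measurable_fun_fubini_tonelli_F.
  apply/(measurable_restrictT _ (measurableX measurableT mB)).
  exact: measurable_funTS.
by move=> z; rewrite patchE; case: ifP.
Qed.

End tonelli.

Lemma mul_div_double_le (R : realFieldType) (x y : R) : 0 <= x -> 0 <= y ->
  x * (y / (2 * (x + 1))) <= y / 2.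
Proof.
move=> x0 y0; have -> : y / 2 = (x + 1) * (y / (2 * (x + 1))).
  by field; rewrite gt_eqF// ltr_wpDl.
by rewrite ler_wpM2r ?lerDl// divr_ge0// mulr_ge0// addr_ge0.
Qed.

Section poincare_step.
Context d (X : measurableType d) (R : realType).
Notation leb := (@lebesgue_measure R).
Variables (mu : {sigma_finite_measure set X -> \bar R}) (E : set X).
Hypothesis mE : measurable E.
Variables (a b e : R) (phi g h : X * measurableTypeR R -> R).
Hypotheses (ab : a < b) (e0 : 0 <= e).
Hypotheses (mphi : measurable_fun setT phi) (mg : measurable_fun setT g)
  (mh : measurable_fun setT h).
Hypotheses (g0 : forall z, 0 <= g z) (h0 : forall z, 0 <= h z).
Let J : set (measurableTypeR R) := `]a, b].
Let mJ : measurable J. Proof. exact: measurable_itv. Qed.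

Let lebJ : leb J = (b - a)%:E.
Proof. by rewrite lebesgue_measure_itv /= lte_fin ab EFinB. Qed.

Let intJ (r : \bar R) : (\int[leb]_(t in J) cst r t = r * (b - a)%:E)%E.
Proof. by rewrite integral_cst//; congr (_ * _)%E; exact: lebJ. Qed.

(* A value z' at which the integral of g over E is at most its mean serves as
   the base point from which the last variable is moved. *)
Lemma poincare_step :
  (forall p s t, E p -> J s -> J t ->
    (`|phi (p, s) - phi (p, t)|%:E <= \int[leb]_(r in J) (h (p, r))%:E)%E) ->
  (forall t eta, J t -> 0 < eta -> exists c,
    (\int[mu]_(p in E) `|phi (p, t) - c|%:E <=
     e%:E * \int[mu]_(p in E) (g (p, t))%:E + eta%:E)%E) ->
  (\int[mu \x leb]_(z in E `*` J) (g z)%:E < +oo)%E ->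
  forall eta, 0 < eta -> exists c,
    (\int[mu \x leb]_(z in E `*` J) `|phi z - c|%:E <=
     e%:E * \int[mu \x leb]_(z in E `*` J) (g z)%:E +
     (b - a)%:E * \int[mu \x leb]_(z in E `*` J) (h z)%:E + eta%:E)%E.
Proof.
move=> H1 H2 gfin eta eta0.
have l0 : 0 < b - a by rewrite subr_gt0.
pose I := fine (\int[mu \x leb]_(z in E `*` J) (g z)%:E)%E.
have IE : (\int[mu \x leb]_(z in E `*` J) (g z)%:E = I%:E)%E.
  rewrite fineK// ge0_fin_numE//; apply: integral_ge0 => z _.
  by rewrite lee_fin.
(* Half of the slack [eta] pays for the choice of the slice, as e * eta1 <= eta / 2; the other half,
   (b - a) * eta2, pays for the inequality on that slice. *)
pose eta1 := eta / (2 * (e + 1)).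
have eta10 : 0 < eta1 by rewrite divr_gt0// mulr_gt0// ltr_wpDl.
pose k := (I + eta1) / (b - a).
have I0 : 0 <= I by apply/fine_ge0/integral_ge0 => z _; rewrite lee_fin.
have k0 : 0 <= k by rewrite /k divr_ge0 ?(ltW l0)// addr_ge0 ?(ltW eta10).
have mgE : measurable_fun setT (EFin \o g) by exact/measurable_EFinP.
have mhE : measurable_fun setT (EFin \o h) by exact/measurable_EFinP.
(* If every slice exceeded k, integrating over J would give I + eta1 <= I. *)
have [t Jt tk] : exists2 t, J t & (\int[mu]_(p in E) (g (p, t))%:E <= k%:E)%E.
  apply: contrapT => nt.
  have : (\int[leb]_(t in J) (cst k%:E t) <= I%:E)%E.
    rewrite -IE (tonelli_setX2 (f := EFin \o g) mu leb mE mJ) //.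
    apply: ge0_le_integral => //.
    - have -> : (fun t => \int[mu]_(p in E) (EFin \o g) (p, t))%E =
          fubini_G mu ((EFin \o g) \_ (E `*` setT)).
        apply/funext => y; rewrite /fubini_G [LHS]integral_mkcond.
        by apply: eq_integral => x _; rewrite !patchE in_setX in_setT andbT.
      apply: measurable_funTS; apply: measurable_fun_fubini_tonelli_G.
        apply/(measurable_restrictT _ (measurableX mE measurableT)).
        exact: measurable_funTS.
      by move=> z; rewrite patchE; case: ifP => //= _; rewrite lee_fin.
    move=> t Jt /=; rewrite leNgt; apply/negP => tk; apply: nt.
    by exists t => //; exact: ltW.
  rewrite intJ -EFinM lee_fin /k divfK ?gt_eqF//; lra.
pose eta2 := eta / (2 * (b - a)).
have eta20 : 0 < eta2 by rewrite divr_gt0// mulr_gt0.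
have [c Hc] := H2 t _ Jt eta20; exists c.
have mphic : measurable_fun setT (fun z => `|phi z - c|%:E).
  apply/measurable_EFinP; apply: measurableT_comp => //.
  by apply: measurable_funB => //; exact: measurable_cst.
rewrite (tonelli_setX1 (f := fun z => `|phi z - c|%:E) mu leb mE mJ)//.
pose A p := (\int[leb]_(r in J) (h (p, r))%:E)%E.
pose D p : \bar R := `|phi (p, t) - c|%:E.
have A0 p : (0 <= A p)%E by apply: integral_ge0 => r _; rewrite lee_fin.
have D0 p : (0 <= D p)%E by rewrite lee_fin.
have mA : measurable_fun E A.
  by apply: (measurable_tonelli_section leb mJ mhE) => z; rewrite lee_fin.
have mD : measurable_fun E D.
  apply: measurable_funTS; exact: (measurable_fun_pair1 t mphic).
have step : (\int[mu]_(p in E) \int[leb]_(s in J) `|phi (p, s) - c|%:E <=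
    \int[mu]_(p in E) ((b - a)%:E * (A p + D p)))%E.
  apply: ge0_le_integral => //.
  - by move=> p _; apply: integral_ge0 => s _; rewrite lee_fin.
  - by apply: (measurable_tonelli_section leb mJ mphic) => z; rewrite lee_fin.
  - by apply: measurable_funeM; exact: emeasurable_funD.
  move=> p Ep; apply: (@le_trans _ _ (\int[leb]_(s in J) cst (A p + D p) s)%E).
    apply: ge0_le_integral => //.
    + apply: measurable_funTS; exact: (measurable_fun_pair2 p mphic).
    move=> s Js /=; apply: (@le_trans _ _
        (`|phi (p, s) - phi (p, t)|%:E + D p)%E); last by rewrite leeD2r// H1.
    rewrite -EFinD lee_fin.
    by have := ler_normD (phi (p, s) - phi (p, t)) (phi (p, t) - c); rewrite addrA subrK.
  by rewrite intJ muleC.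
apply: (le_trans step).
rewrite ge0_integralZl//; last 3 first.
- exact: emeasurable_funD.
- by move=> p _; rewrite adde_ge0.
- by rewrite lee_fin ltW.
rewrite ge0_integralD// ge0_muleDr; [|exact: integral_ge0|exact: integral_ge0].
rewrite (tonelli_setX1 (f := EFin \o h) mu leb mE mJ)//.
rewrite [X in (_ <= X)%E](_ : _ = ((b - a)%:E * \int[mu]_(x in E) A x +
  (e%:E * I%:E + eta%:E))%E); last by rewrite IE addeAC addeC.
rewrite leeD2l//.
apply: (@le_trans _ _ ((b - a)%:E * (e%:E * k%:E + eta2%:E))%E).
  rewrite lee_wpmul2l ?lee_fin ?(ltW l0)//; apply: (le_trans Hc).
  by rewrite leeD2r// lee_wpmul2l.
rewrite -!EFinM -!EFinD lee_fin mulrDr.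
have -> : (b - a) * eta2 = eta / 2 by rewrite /eta2; field; rewrite gt_eqF.
have -> : (b - a) * (e * k) = e * I + e * eta1.
  by rewrite /k; field; rewrite gt_eqF.
rewrite -addrA lerD2l.
have := mul_div_double_le e0 (ltW eta0); rewrite -/eta1.
lra.
Qed.

End poincare_step.

Lemma lee_mulD_max (R : realType) (u v w : R) (x y : \bar R) :
  (0 <= x)%E -> (0 <= y)%E -> u <= w -> v <= w ->
  (u%:E * x + v%:E * y <= w%:E * (x + y))%E.
Proof.
move=> x0 y0 uw vw; rewrite ge0_muleDr//.
by apply: leeD; rewrite lee_wpmul2r// lee_fin.
Qed.

Section cells.
Context (R : realType) (Omega : set (R * R * R)) (phi : R * R * R -> R).
Hypothesis tphi : test_function Omega phi.
Notation T3 := (measurableTypeR R * measurableTypeR R * measurableTypeR R)%type.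
Notation leb := (@lebesgue_measure R).
Implicit Types (i : 'I_3) (a b l s t eta : R).

Definition i0 : 'I_3 := @Ordinal 3 0 isT.
Definition i1 : 'I_3 := @Ordinal 3 1 isT.
Definition i2 : 'I_3 := @Ordinal 3 2 isT.

Definition absD i x : R := `|'D_(ebasis i) phi x|.

Lemma absD_ge0 i x : 0 <= absD i x.
Proof. exact: normr_ge0. Qed.

Lemma absD_measurable i : measurable_fun setT (absD i : T3 -> R).
Proof.
apply: measurableT_comp => //; apply: continuous_measurable3.
apply: smooth_continuous; apply: smooth_derive; exact: test_function_smooth tphi.
Qed.

Lemma phi_measurable : measurable_fun setT (phi : T3 -> R).
Proof.
apply: continuous_measurable3; apply: smooth_continuous.
exact: test_function_smooth tphi.
Qed.

Lemma slice_osc i y a b s t : s \in `]a, b] -> t \in `]a, b] ->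
  (`|phi (ins i y s) - phi (ins i y t)|%:E <=
   \int[leb]_(r in `]a, b]) (absD i (ins i y r))%:E)%E.
Proof.
wlog st : s t / s < t => [H sJ tJ|].
  have [st|ts|->] := ltgtP s t; [exact: H|by rewrite distrC; exact: H|].
  by rewrite subrr normr0; apply: integral_ge0 => r _; rewrite lee_fin absD_ge0.
rewrite !in_itv /= => /andP[as_ sb] /andP[at_ tb].
have sp := test_function_smooth tphi.
pose f r := phi (ins i y r).
have df r : derivable f r 1 by apply: slice_derivable; exact: smooth_derivable.
have dE : (fun r => 'D_1 f r) = (fun r => 'D_(ebasis i) phi (ins i y r)).
  by apply/funext => r; exact: slice_derive.
have cf : continuous (fun r => 'D_1 f r).
  rewrite dE; apply: (@slice_continuous _ (fun x => 'D_(ebasis i) phi x) i y).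
  by apply: smooth_continuous; exact: smooth_derive.
have mf A : measurable_fun A (fun r => 'D_1 f r).
  by apply: measurable_funTS; exact: continuous_measurable_fun.
rewrite distrC -[phi (ins i y t)]/(f t) -[phi (ins i y s)]/(f s) -abse_EFin.
rewrite -(Rint_derive1 st df cf).
apply: (@le_trans _ _ (\int[leb]_(r in `[s, t]) `|('D_1 f r)%:E|)%E).
  apply: le_abse_integral; first exact: measurable_itv.
  by apply/measurable_EFinP; exact: mf.
have -> : (\int[leb]_(r in `]a, b]) (absD i (ins i y r))%:E =
    \int[leb]_(r in `]a, b]) `|('D_1 f r)%:E|)%E.
  by apply: eq_integral => r _; rewrite slice_derive.
apply: ge0_subset_integral => //.
- by apply: measurableT_comp => //; apply/measurable_EFinP; exact: mf.
- by move=> r /=; rewrite !in_itv /= => /andP[sr rt]; rewrite (lt_le_trans as_ sr) (le_trans rt tb).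
Qed.

Lemma slice_poincare a b y : a < b -> exists c,
  (\int[leb]_(p in `]a, b]) `|phi (ins i0 y p) - c|%:E <=
   (b - a)%:E * \int[leb]_(p in `]a, b]) (absD i0 (ins i0 y p))%:E)%E.
Proof.
move=> ab; exists (phi (ins i0 y b)).
apply: (@le_trans _ _ (\int[leb]_(p in `]a, b])
    cst (\int[leb]_(p in `]a, b]) (absD i0 (ins i0 y p))%:E) p)%E).
  apply: ge0_le_integral => //.
  - apply/measurable_EFinP; apply: measurableT_comp => //.
    apply: measurable_funB => //; apply: measurable_funTS.
    apply: continuous_measurable_fun; apply: slice_continuous.
    exact: smooth_continuous (test_function_smooth tphi).
  by move=> p pJ; apply: slice_osc => //; rewrite in_itv /= ab lexx.
rewrite integral_cst// muleC lee_wpmul2r//.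
  by apply: integral_ge0 => r _; rewrite lee_fin absD_ge0.
apply: (@le_trans _ _ (leb `]a, b]%classic)) => //.
by rewrite lebesgue_measure_itv /= lte_fin ab EFinB.
Qed.

Lemma integral_absD_lty d (T : measurableType d)
    (mu : {measure set T -> \bar R}) (A : set T) (k : T -> T3) i :
  measurable A -> (mu A < +oo)%E -> measurable_fun setT k ->
  (\int[mu]_(x in A) (absD i (k x))%:E < +oo)%E.
Proof.
move=> mA fA mk; have [B B0 [_ dB]] := test_bounded (test_function_derive (ebasis i) tphi).
apply: (@integrable_lty _ _ _ mu A mA (fun x => (absD i (k x))%:E)).
apply: measurable_bounded_integrable => //.
  apply: measurable_funTS; apply: measurableT_comp => //; exact: absD_measurable.
exists B; split; [exact: num_real|move=> M BM x _ /=].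
by rewrite /absD normr_id; apply: le_trans (dB _) (ltW BM).
Qed.

Lemma leb_itv_oc_lty a b : (leb `]a, b]%classic < +oo)%E.
Proof.
by rewrite lebesgue_measure_itv /=; case: ifP => _; rewrite ?ltry// -EFinB ltry.
Qed.

(** Half-open sides make adjacent rectangles disjoint, so that integrals add up when cells are
    glued. *)
Definition rect a1 b1 a2 b2 : set (measurableTypeR R * measurableTypeR R) :=
  `]a1, b1]%classic `*` `]a2, b2]%classic.

Definition cell a1 b1 a2 b2 a3 b3 : set T3 := rect a1 b1 a2 b2 `*` `]a3, b3]%classic.

Lemma measurable_rect a1 b1 a2 b2 : measurable (rect a1 b1 a2 b2).
Proof. exact: measurableX. Qed.

Lemma measurable_cell a1 b1 a2 b2 a3 b3 : measurable (cell a1 b1 a2 b2 a3 b3).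
Proof. by apply: measurableX => //; exact: measurable_rect. Qed.

Lemma leb2_rect_lty a1 b1 a2 b2 : (leb2 R (rect a1 b1 a2 b2) < +oo)%E.
Proof.
by rewrite leb2X// lte_mul_pinfty ?ge0_fin_numE ?measure_ge0 ?leb_itv_oc_lty.
Qed.

Lemma leb3_cell_lty a1 b1 a2 b2 a3 b3 : (leb3 (cell a1 b1 a2 b2 a3 b3) < +oo)%E.
Proof.
rewrite leb3X//; last exact: measurable_rect.
by rewrite lte_mul_pinfty ?ge0_fin_numE ?measure_ge0 ?leb2_rect_lty ?leb_itv_oc_lty.
Qed.

Lemma plane_poincare a1 b1 a2 b2 l (z : R) eta :
  a1 < b1 -> a2 < b2 -> b1 - a1 <= l -> b2 - a2 <= l -> 0 < eta ->
  exists c, (\int[leb2 R]_(p in rect a1 b1 a2 b2) `|phi (p, z) - c|%:E <=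
    l%:E * \int[leb2 R]_(p in rect a1 b1 a2 b2)
      (absD i0 (p, z) + absD i1 (p, z))%:E + eta%:E)%E.
Proof.
move=> ab1 ab2 l1 l2 eta0.
have m0 i : measurable_fun setT (fun p => absD i (p, z)).
  exact: (measurable_fun_pair1 z (absD_measurable i)).
have d0 i p : 0 <= absD i (p, z) by exact: absD_ge0.
have mE : measurable (`]a1, b1]%classic : set (measurableTypeR R)).
  exact: measurable_itv.
have e0 : 0 <= b1 - a1 by rewrite subr_ge0 ltW.
have fI i : (\int[leb2 R]_(p in rect a1 b1 a2 b2) (absD i (p, z))%:E < +oo)%E.
  apply: (integral_absD_lty i (measurable_rect _ _ _ _) (leb2_rect_lty _ _ _ _)).
  exact: pair2_measurable.
have H1 (p s t : measurableTypeR R) : `]a1, b1]%classic p -> `]a2, b2]%classic s ->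
    `]a2, b2]%classic t ->
    (`|phi ((p, s), z) - phi ((p, t), z)|%:E <=
     \int[leb]_(r in `]a2, b2]%classic) (absD i1 ((p, r), z))%:E)%E.
  by move=> _ sJ tJ; exact: (slice_osc i1 (p, z) sJ tJ).
have H2 (t : measurableTypeR R) (r : R) : `]a2, b2]%classic t -> 0 < r ->
    exists c, (\int[leb]_(p in `]a1, b1]%classic) `|phi ((p, t), z) - c|%:E <=
     (b1 - a1)%:E * \int[leb]_(p in `]a1, b1]%classic) (absD i0 ((p, t), z))%:E + r%:E)%E.
  move=> _ h0; have [c Hc] := slice_poincare (t, z) ab1; exists c.
  by apply: (le_trans Hc); rewrite leeDl// lee_fin ltW.
have [c Hc] := @poincare_step _ _ R leb `]a1, b1]%classic mE a2 b2 (b1 - a1) (fun p => phi (p, z))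
  (fun p => absD i0 (p, z)) (fun p => absD i1 (p, z)) ab2 e0
  (measurable_fun_pair1 z phi_measurable) (m0 i0) (m0 i1) (d0 i0) (d0 i1)
  H1 H2 (fI i0) eta eta0.
pose I i := (\int[leb2 R]_(p in rect a1 b1 a2 b2) (absD i (p, z))%:E)%E.
have {}Hc : (\int[leb2 R]_(p in rect a1 b1 a2 b2) `|phi (p, z) - c|%:E <=
  (b1 - a1)%:E * I i0 + (b2 - a2)%:E * I i1 + eta%:E)%E by exact: Hc.
exists c; apply: (le_trans Hc); rewrite leeD2r//.
under [X in (_ <= _ * X)%E]eq_integral do rewrite EFinD.
rewrite ge0_integralD//; last 5 first.
- exact: measurable_rect.
- by move=> x _; rewrite lee_fin.
- by apply: measurable_funTS; apply/measurable_EFinP; exact: m0.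
- by move=> x _; rewrite lee_fin.
- by apply: measurable_funTS; apply/measurable_EFinP; exact: m0.
have p0 i : (0 <= I i)%E by apply: integral_ge0 => p _; rewrite lee_fin.
exact: (lee_mulD_max (p0 i0) (p0 i1) l1 l2).
Qed.

(** [poincare_step] adds the third variable to the planar estimate. The constant is the side bound l
    itself, so on small cells a bounded gradient in L^1 leaves little room to deviate from a
    constant. The slack [eta] stems from the choice of slices. *)
Lemma space_poincare a1 b1 a2 b2 a3 b3 l eta :
  a1 < b1 -> a2 < b2 -> a3 < b3 -> b1 - a1 <= l -> b2 - a2 <= l -> b3 - a3 <= l ->
  0 < eta -> exists c,
    \int[leb3]_(x in cell a1 b1 a2 b2 a3 b3) `|phi x - c| <=
    l * \int[leb3]_(x in cell a1 b1 a2 b2 a3 b3)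
      (absD i0 x + absD i1 x + absD i2 x) + eta.
Proof.
move=> ab1 ab2 ab3 l1 l2 l3 eta0.
set Q := cell _ _ _ _ _ _; have mQ : measurable Q by exact: measurable_cell.
have fQ : (leb3 Q < +oo)%E by exact: leb3_cell_lty.
have l0 : 0 <= l by apply: le_trans l1; rewrite subr_ge0 ltW.
have d0 i x : 0 <= absD i x by exact: absD_ge0.
have mg : measurable_fun setT (fun x : T3 => absD i0 x + absD i1 x).
  by apply: measurable_funD; exact: absD_measurable.
have g0 x : 0 <= absD i0 x + absD i1 x by rewrite addr_ge0.
have fI i : (\int[leb3]_(x in Q) (absD i x)%:E < +oo)%E.
  exact: (@integral_absD_lty _ _ leb3 Q id i).
have H1 (p : measurableTypeR R * measurableTypeR R) (s t : measurableTypeR R) :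
    rect a1 b1 a2 b2 p -> `]a3, b3]%classic s -> `]a3, b3]%classic t ->
    (`|phi (p, s) - phi (p, t)|%:E <=
     \int[leb]_(r in `]a3, b3]%classic) (absD i2 (p, r))%:E)%E.
  by case: p => p1 p2 _ sJ tJ; exact: (slice_osc i2 (p1, p2) sJ tJ).
have H2 (t : measurableTypeR R) (r : R) : `]a3, b3]%classic t -> 0 < r ->
    exists c, (\int[leb2 R]_(p in rect a1 b1 a2 b2) `|phi (p, t) - c|%:E <=
     l%:E * \int[leb2 R]_(p in rect a1 b1 a2 b2)
       (absD i0 (p, t) + absD i1 (p, t))%:E + r%:E)%E.
  by move=> _ h0; exact: plane_poincare.
have LD i : L1 leb3 Q (absD i).
  apply/integrableP; split.
    by apply: measurable_funTS; apply/measurable_EFinP; exact: absD_measurable.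
  by under eq_integral do rewrite /= ger0_norm//; exact: fI.
have gfin : (\int[leb3]_(x in Q) (absD i0 x + absD i1 x)%:E < +oo)%E.
  by rewrite -EFin_Rint ?ltry//; exact: L1D.
have [c Hc] := @poincare_step _ _ R (leb2 R) (rect a1 b1 a2 b2)
  (measurable_rect _ _ _ _) a3 b3 l phi
  (fun x => absD i0 x + absD i1 x) (absD i2) ab3 l0 phi_measurable mg
  (absD_measurable i2) g0 (d0 i2) H1 H2 gfin eta eta0.
have Lphi : L1 leb3 Q (fun x => `|phi x - c|).
  apply: L1_norm; apply: L1B => //; last exact: L1_cst.
  have [B B0 [p1 p2]] := test_bounded tphi.
  apply: integrableS (integrable_cbox (smooth_continuous (test_function_smooth tphi)) p2 p1) => //.
have L01 : L1 leb3 Q (fun x => absD i0 x + absD i1 x) by exact: L1D.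
have {}Hc : (\int[leb3]_(x in Q) `|phi x - c|%:E <=
  l%:E * \int[leb3]_(x in Q) (absD i0 x + absD i1 x)%:E +
  (b3 - a3)%:E * \int[leb3]_(x in Q) (absD i2 x)%:E + eta%:E)%E by exact: Hc.
rewrite -!EFin_Rint// -!EFinM -!EFinD lee_fin in Hc.
exists c; apply: (le_trans Hc); rewrite lerD2r.
have -> : \int[leb3]_(x in Q) (absD i0 x + absD i1 x + absD i2 x) =
   \int[leb3]_(x in Q) (absD i0 x + absD i1 x) + \int[leb3]_(x in Q) absD i2 x.
  by rewrite RintegralD//; exact: LD.
rewrite mulrDr lerD2l ler_wpM2r//; apply: Rintegral_ge0 => x _.
exact: absD_ge0.
Qed.

End cells.

(** * Rellich compactness *)

(** Induction on j for intervals of length at most l 2^j, by halving. Applied to one axis at a time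
    it carries a property from small cells to arbitrary boxes. *)
Lemma interval_bisection (R : realType) (l : R) (Q : R -> R -> Prop) : 0 < l ->
  (forall a b, a < b -> b - a <= l -> Q a b) ->
  (forall a m b, a < m -> m < b -> Q a m -> Q m b -> Q a b) ->
  forall a b, a < b -> Q a b.
Proof.
move=> l0 small glue a b ab.
have H (j : nat) x y : x < y -> y - x <= l * 2 ^+ j -> Q x y.
  elim: j x y => [|j IH] x y xy; first by rewrite expr0 mulr1; exact: small.
  rewrite exprS => h; apply: (glue x ((x + y) / 2)); try lra.
  - by apply: IH; lra.
  - by apply: IH; lra.
apply: (H (Num.truncn ((b - a) / l)).+1) => //.
rewrite mulrC -ler_pdivrMr//; apply: le_trans (ltW (truncnS_gt _)) _.
by rewrite -natrX ler_nat ltnW// ltn_expl.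
Qed.

Lemma ler_osc_setU (R : realFieldType) (a b l c d e f t : R) :
  a <= l * (c + d) + t / 2 -> b <= l * (e + f) + t / 2 ->
  a + b <= l * (c + e + (d + f)) + t.
Proof. lra. Qed.

Lemma ler_mean_bound (R : realFieldType) (a b l G K e : R) : a <= K -> e <= 1 ->
  b <= l * G + e -> l * G <= l * K -> a + b <= K + l * K + 1.
Proof. lra. Qed.

Lemma ler_osc_cell (R : realFieldType) (a b c l G H e t : R) : a <= l * G + e ->
  b <= l * H + e -> c <= t / 2 -> 4 * e <= t -> a + b + c <= l * (G + H) + t.
Proof. lra. Qed.

Lemma setX_setUr (X Y : Type) (P : set X) (Q1 Q2 : set Y) :
  P `*` (Q1 `|` Q2) = (P `*` Q1) `|` (P `*` Q2).
Proof. by apply/seteqP; split => -[x y] /=; tauto. Qed.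

Lemma setX_setUl (X Y : Type) (P1 P2 : set X) (Q : set Y) :
  (P1 `|` P2) `*` Q = (P1 `*` Q) `|` (P2 `*` Q).
Proof. by apply/seteqP; split => -[x y] /=; tauto. Qed.

Lemma ultra_fmap (T U : Type) (f : T -> U) (F : set_system T) :
  UltraFilter F -> UltraFilter (f @ F).
Proof.
move=> UF; have FF := @ultra_proper _ _ UF; split; first exact: fmap_proper_filter.
move=> G PG FG; apply/seteqP; split => // A GA.
have [//|FnA] := in_ultra_setVsetC (f @^-1` A) UF.
have /filter_ex[x []] : G (A `&` ~` A) by apply: filterI => //; exact: FG.
by [].
Qed.

Section rellich.
Context (R : realType) (Omega : set (R * R * R)).
Hypothesis oO : open Omega.
Notation T3 := (measurableTypeR R * measurableTypeR R * measurableTypeR R)%type.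
Variables (phi : nat -> R * R * R -> R) (K : R).
Hypothesis tphi : forall n, test_function Omega (phi n).

Let g n (x : T3) := absD (phi n) i0 x + absD (phi n) i1 x + absD (phi n) i2 x.

Let L1T (f : T3 -> R) := L1 leb3 setT f.

Let L1phi n : L1T (phi n).
Proof.
have [B B0 [h1 h2]] := test_bounded (tphi n).
exact: integrable_cbox (smooth_continuous (test_function_smooth (tphi n))) h2 h1.
Qed.

Let L1absD n i : L1T (absD (phi n) i).
Proof.
have td := test_function_derive (ebasis i) (tphi n).
have [B B0 [h1 h2]] := test_bounded td.
apply: L1_norm.
exact: (integrable_cbox (smooth_continuous (test_function_smooth td)) h2 h1).
Qed.

Let L1g n : L1T (g n).
Proof. by apply: L1D => //; apply: L1D. Qed.

Let g0 n x : 0 <= g n x.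
Proof. by rewrite /g !addr_ge0 ?absD_ge0. Qed.

Let L1S (f : T3 -> R) A : measurable A -> L1T f -> L1 leb3 A f.
Proof. by move=> mA; exact: integrableS. Qed.

Let RintS (f : T3 -> R) A : measurable A -> L1T f -> (forall x, 0 <= f x) ->
  \int[leb3]_(x in A) f x <= \int[leb3]_x f x.
Proof.
move=> mA lf f0; rewrite -lee_fin !EFin_Rint//; last exact: L1S.
by apply: ge0_subset_integral => //; case/integrableP: lf => // ? _ x _; rewrite lee_fin.
Qed.

Hypotheses (Kphi : forall n, \int[leb3]_x `|phi n x| <= K)
  (Kg : forall n, \int[leb3]_x g n x <= K).
Variable F : set_system nat.
Hypotheses (UF : UltraFilter F) (ooF : \oo `<=` F).

Let FF : ProperFilter F. Proof. exact: ultra_proper. Qed.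

(** The sequence is Cauchy in L^1(A) along the ultrafilter, up to l times the gradient masses on A.
    These masses are additive in A, so gluing cells does not increase the factor l. *)
Let osc (l : R) (A : set T3) := forall eta, 0 < eta -> exists2 U, F U &
  forall n m, U n -> U m -> \int[leb3]_(x in A) `|phi n x - phi m x| <=
    l * (\int[leb3]_(x in A) g n x + \int[leb3]_(x in A) g m x) + eta.

Let osc_setU l A B : measurable A -> measurable B -> [disjoint A & B] ->
  osc l A -> osc l B -> osc l (A `|` B).
Proof.
move=> mA mB AB oA oB eta eta0.
have e2 : 0 < eta / 2 by rewrite divr_gt0.
have [U FU HU] := oA _ e2; have [V FV HV] := oB _ e2.
exists (U `&` V); first exact: filterI.
move=> n m [Un Vn] [Um Vm]; have := HU n m Un Um; have := HV n m Vn Vm.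
have mAB : measurable (A `|` B) by exact: measurableU.
rewrite !Rintegral_setU//.
- by move=> hB hA; exact: (ler_osc_setU hA hB).
- exact: L1S.
- exact: L1S.
by apply: L1S => //; apply: L1_norm; exact: L1B.
Qed.

(** The Poincare inequality replaces each function by a constant [c n]. These constants are bounded
    through the L^1 bounds, hence converge along the ultrafilter, and their differences fall below
    any slack. The ultrafilter is the same for all cells, so the gluing takes place without
    successive extractions. *)
Let cell_osc l a1 b1 a2 b2 a3 b3 : 0 < l ->
  a1 < b1 -> a2 < b2 -> a3 < b3 -> b1 - a1 <= l -> b2 - a2 <= l -> b3 - a3 <= l ->
  osc l (cell a1 b1 a2 b2 a3 b3).
Proof.
move=> l0 ab1 ab2 ab3 l1 l2 l3 eta eta0.
set Q := cell _ _ _ _ _ _; have mQ : measurable Q by exact: measurable_cell.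
have fQ : (leb3 Q < +oo)%E by exact: leb3_cell_lty.
pose V := fine (leb3 Q).
have VE : V = (b1 - a1) * (b2 - a2) * (b3 - a3).
  rewrite /V leb3X//; last exact: measurable_rect.
  by rewrite leb2X// !lebesgue_measure_itv /= !lte_fin ab1 ab2 ab3.
have V0 : 0 < V by rewrite VE !mulr_gt0 ?subr_gt0.
pose e := Num.min 1 (eta / 4).
have e0 : 0 < e by rewrite lt_min ltr01 divr_gt0.
have e1 : e <= 1 by rewrite ge_min lexx.
have e4 : 4 * e <= eta by rewrite mulrC -ler_pdivlMr// ge_min lexx orbT.
have /choice[c Hc] n := space_poincare (tphi n) ab1 ab2 ab3 l1 l2 l3 e0.
have Lc n : L1 leb3 Q (fun x => phi n x - c n).
  by apply: L1B => //; [exact: L1S|exact: L1_cst].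
have Rc (r : R) : \int[leb3]_(x in Q) r = r * V by rewrite Rintegral_cst.
pose M := (K + l * K + 1) / V.
have cM n : `|c n| <= M.
  rewrite /M ler_pdivlMr// -Rc.
  apply: (@le_trans _ _ (\int[leb3]_(x in Q) (`|phi n x| + `|phi n x - c n|))).
    apply: le_Rintegral => //; first exact: L1_cst.
      by apply: L1D => //; apply: L1_norm => //; exact: L1S.
    move=> x _; have := ler_normB (phi n x) (phi n x - c n).
    by rewrite opprB addrC subrK.
  rewrite RintegralD//; last 2 first.
  - by apply: L1_norm; exact: L1S.
  - exact: L1_norm.
  have h1 : \int[leb3]_(x in Q) `|phi n x| <= K.
    by apply: le_trans (Kphi n); apply: RintS => //; exact: L1_norm.
  have h2 : \int[leb3]_(x in Q) g n x <= K.
    by apply: le_trans (Kg n); exact: RintS.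
  have h3 := Hc n; rewrite -/Q -/(g n _) in h3.
  have h4 : l * \int[leb3]_(x in Q) g n x <= l * K by rewrite ler_wpM2l ?(ltW l0).
  exact: (ler_mean_bound h1 e1 h3 h4).
have [c0 cc] : exists c0 : R, c n @[n --> F] --> c0.
  have := @segment_compact R (- M) M; rewrite compact_ultra => /(_ (c @ F)).
  case.
  - exact: ultra_fmap.
  - have S : setT `<=` c @^-1` `[- M, M]%classic.
      by move=> n _; rewrite /= in_itv /= -ler_norml; exact: cM.
    exact: (@filterS _ F _ _ _ S filterT).
  by move=> p [_ ?]; exists p.
have d0 : 0 < eta / 4 / V by rewrite !divr_gt0.
have /cvgrPdist_lt/(_ _ d0) Ud := cc.
exists [set n | `|c0 - c n| < eta / 4 / V]; first exact: Ud.
move=> n m /= cn cm.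
have cnm : `|c n - c m| * V <= eta / 2.
  have -> : eta / 2 = (eta / 4 / V + eta / 4 / V) * V by field; rewrite gt_eqF.
  rewrite ler_pM2r//; apply: le_trans (ltW (ltrD cn cm)).
  rewrite [leRHS]addrC (_ : c n - c m = (c0 - c m) - (c0 - c n)); last by ring.
  exact: ler_normB.
apply: (@le_trans _ _ (\int[leb3]_(x in Q)
   (`|phi n x - c n| + `|phi m x - c m| + `|c n - c m|))).
  apply: le_Rintegral => //.
  - by apply: L1_norm; apply: L1B => //; exact: L1S.
  - apply: L1D => //; last exact: L1_cst.
    by apply: L1D => //; exact: L1_norm.
  move=> x _; have := ler_normD (phi n x - c n - (phi m x - c m)) (c n - c m).
  have := ler_normB (phi n x - c n) (phi m x - c m).
  have -> : phi n x - c n - (phi m x - c m) + (c n - c m) = phi n x - phi m x by ring.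
  lra.
rewrite RintegralD//; last 2 first.
- by apply: L1D => //; exact: L1_norm.
- exact: L1_cst.
rewrite RintegralD//; [|exact: L1_norm|exact: L1_norm].
rewrite Rc; exact: (ler_osc_cell (Hc n) (Hc m) cnm e4).
Qed.

Let disjoint_oc (a m b : R) : [disjoint `]a, m]%classic & `]m, b]%classic].
Proof.
apply/disj_setPS => x [] /=; rewrite !in_itv /= => /andP[_ xm] /andP[mx _].
by have := lt_le_trans mx xm; rewrite ltxx.
Qed.

Let itv_oc_setU (a m b : R) : a < m -> m < b ->
  `]a, b]%classic = `]a, m]%classic `|` `]m, b]%classic.
Proof.
move=> am mb; apply/seteqP; split => x /=; rewrite !in_itv /=.
  by move=> /andP[ax xb]; have [xm|mx] := leP x m; [left|right]; rewrite ?ax ?xm ?xb.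
by case=> /andP[h1 h2]; rewrite ?(lt_trans am h1) ?h1 ?h2 ?(le_trans h2 (ltW mb)).
Qed.

Let box_osc l a1 b1 a2 b2 a3 b3 : 0 < l -> a1 < b1 -> a2 < b2 -> a3 < b3 ->
  osc l (cell a1 b1 a2 b2 a3 b3).
Proof.
move=> l0 ab1 ab2 ab3.
have H1 x1 y1 x2 y2 : x1 < y1 -> x2 < y2 -> y1 - x1 <= l -> y2 - x2 <= l ->
    osc l (cell x1 y1 x2 y2 a3 b3).
  move=> xy1 xy2 l1 l2.
  apply: (@interval_bisection _ l (fun x y => osc l (cell x1 y1 x2 y2 x y))) => //.
    by move=> x y xy l3; exact: cell_osc.
  move=> x m y xm my o1 o2.
  rewrite /cell (itv_oc_setU xm my) setX_setUr; apply: osc_setU => //; try exact: measurable_cell.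
  by apply/disj_setPS => z [[_ /= h1] [_ /= h2]]; have /disj_setPS := disjoint_oc x m y; apply; split; eassumption.
have H2 x1 y1 : x1 < y1 -> y1 - x1 <= l -> osc l (cell x1 y1 a2 b2 a3 b3).
  move=> xy1 l1.
  apply: (@interval_bisection _ l (fun x y => osc l (cell x1 y1 x y a3 b3))) => //.
    by move=> x y xy l3; exact: H1.
  move=> x m y xm my o1 o2.
  rewrite /cell /rect (itv_oc_setU xm my) setX_setUr setX_setUl.
  apply: osc_setU => //; try exact: measurable_cell.
  by apply/disj_setPS => z [[[_ /= h1] _] [[_ /= h2] _]]; have /disj_setPS := disjoint_oc x m y; apply; split; eassumption.
apply: (@interval_bisection _ l (fun x y => osc l (cell x y a2 b2 a3 b3))) => //.
move=> x m y xm my o1 o2.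
rewrite /cell /rect (itv_oc_setU xm my) !setX_setUl.
apply: osc_setU => //; try exact: measurable_cell.
by apply/disj_setPS => z [[[/= h1 _] _] [[/= h2 _] _]]; have /disj_setPS := disjoint_oc x m y; apply; split; eassumption.
Qed.

Variable B : R.
Hypothesis OB : Omega `<=` cbox B.

Let rellich_filter e : 0 < e -> exists2 U, F U & forall n m, U n -> U m ->
  \int[leb3]_(x in Omega) `|phi n x - phi m x| <= e.
Proof.
move=> e0; have K0 : 0 <= K by apply: le_trans (Kphi 0%N); exact: Rintegral_ge0.
pose l := e / (4 * (K + 1)).
have l0 : 0 < l by rewrite divr_gt0// mulr_gt0// ltr_wpDl.
have lK : l * (K + K) <= e / 2.
  have -> : e / 2 = l * (2 * (K + 1)) by rewrite /l; field; rewrite gt_eqF// ltr_wpDl.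
  by rewrite ler_wpM2l ?(ltW l0)//; lra.
(* The margin 1 makes the half-open cell nonempty and large enough to contain the closed box. *)
pose B1 := `|B| + 1.
have BB : - B1 < B1 by rewrite /B1; have := normr_ge0 B; lra.
have e2 : 0 < e / 2 by rewrite divr_gt0.
have [U FU HU] := box_osc l0 BB BB BB e2.
exists U => // n m Un Um.
have OC : (Omega : set T3) `<=` cell (- B1) B1 (- B1) B1 (- B1) B1.
  move=> x /OB/cboxP/and3P; rewrite !ler_norml => -[h1 h2 h3].
  by have hB := ler_norm B; split; [split|]; rewrite /= in_itv /= /B1; lra.
have mO : measurable (Omega : set T3) by exact: open_measurable3.
have mC := measurable_cell (- B1) B1 (- B1) B1 (- B1) B1.
have Lnm : L1T (fun x => `|phi n x - phi m x|) by apply: L1_norm; exact: L1B.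
apply: (@le_trans _ _ (\int[leb3]_(x in cell (- B1) B1 (- B1) B1 (- B1) B1)
    `|phi n x - phi m x|)).
  rewrite -lee_fin !EFin_Rint//; [|exact: L1S|exact: L1S].
  apply: ge0_subset_integral => //.
  by have /integrableP[] := L1S mC Lnm.
apply: le_trans (HU n m Un Um) _.
have h1 : \int[leb3]_(x in cell (- B1) B1 (- B1) B1 (- B1) B1) g n x <= K.
  by apply: le_trans (Kg n); exact: RintS.
have h2 : \int[leb3]_(x in cell (- B1) B1 (- B1) B1 (- B1) B1) g m x <= K.
  by apply: le_trans (Kg m); exact: RintS.
rewrite [leRHS](splitr e) lerD2r; apply: le_trans lK.
by rewrite ler_wpM2l ?(ltW l0)// lerD.
Qed.

(** A finite intersection of members of the ultrafilter meets every tail of the integers; choosing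
    [s k] in the first k + 1 Cauchy sets turns convergence along the ultrafilter into that of a
    sequence. *)
Lemma rellich_L1 : exists s : nat -> nat, (forall k, (k <= s k)%N) /\
  forall e, 0 < e -> exists N, forall j k, (N <= j)%N -> (N <= k)%N ->
    \int[leb3]_(x in Omega) `|phi (s j) x - phi (s k) x| <= e.
Proof.
have i0 k : 0 < (k.+1%:R : R)^-1 by rewrite invr_gt0.
have /choice[U HU] k : exists U, F U /\ forall n m, U n -> U m ->
    \int[leb3]_(x in Omega) `|phi n x - phi m x| <= k.+1%:R^-1.
  by have [U FU H] := rellich_filter (i0 k); exists U.
have /choice[s Hs] k : exists n, (k <= n)%N /\ forall j, (j <= k)%N -> U j n.
  suff : F ([set n | (k <= n)%N] `&` \bigcap_(j in [set j | (j <= k)%N]) U j).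
    by move=> /filter_ex[n [kn Hn]]; exists n.
  apply: filterI; first by apply: ooF; exists k.
  elim: k => [|k IH].
    apply: filterS (HU 0%N).1 => n Un j /=; by rewrite leqn0 => /eqP ->.
  apply: filterS (filterI IH (HU k.+1).1) => n [h1 h2] j /=.
  by rewrite leq_eqVlt ltnS => /predU1P[->//|/h1].
exists s; split; first by move=> k; case: (Hs k).
move=> e e0; exists (Num.truncn e^-1) => j k Nj Nk.
apply: (@le_trans _ _ (Num.truncn e^-1).+1%:R^-1).
  by apply: (HU _).2; [case: (Hs j) => _|case: (Hs k) => _]; apply.
rewrite -[leRHS]invrK lef_pV2 ?posrE ?invr_gt0//.
exact: ltW (truncnS_gt _).
Qed.

End rellich.

(** * The Sobolev space *)

Section almost_everywhere.
Context d (T : measurableType d) (R : realType) (mu : {measure set T -> \bar R}).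

Lemma ae_imp (P Q : T -> Prop) : (forall x, P x -> Q x) ->
  {ae mu, forall x, P x} -> {ae mu, forall x, Q x}.
Proof. by move=> PQ; apply: filterS. Qed.

Lemma ae_imp2 (P1 P2 Q : T -> Prop) : (forall x, P1 x -> P2 x -> Q x) ->
  {ae mu, forall x, P1 x} -> {ae mu, forall x, P2 x} -> {ae mu, forall x, Q x}.
Proof. by move=> PQ; apply: filterS2. Qed.

End almost_everywhere.

(** * Lebesgue norms of even order as integrals *)

Section lebesgue_norms.
Context (R : realType) (Omega : set (R * R * R)).
Notation T3 := (measurableTypeR R * measurableTypeR R * measurableTypeR R)%type.
Hypothesis mO : measurable (Omega : set T3).
Implicit Types u v f g : R * R * R -> R.

Lemma restrict_comp (h : R -> R) u : h 0 = 0 ->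
  (fun x : T3 => h ((u \_ Omega) x)) = (fun x => h (u x)) \_ Omega.
Proof.
move=> h0; apply/funext => x; rewrite !patchE; case: ifP => // _.
Qed.

Lemma L1_restrict f : L1 leb3 Omega f <-> leb3.-integrable setT (EFin \o (f \_ Omega)).
Proof.
have -> : EFin \o (f \_ Omega) = (EFin \o f) \_ Omega :> (T3 -> \bar R).
  by apply/funext => x; rewrite /= !patchE; case: ifP.
exact: integrable_mkcond.
Qed.

Lemma even_expr_powR (n : nat) (r : R) : ~~ odd n -> `|r| `^ n%:R = r ^+ n.
Proof.
by move=> on; rewrite powR_mulrn// -normrX ger0_norm// exprn_even_ge0.
Qed.

Lemma mem_L2P u : mem_L2 Omega u <-> L2 leb3 Omega u.
Proof.
split=> [ul|[mu lu]].
  have := Lfun2_integrable_sqr ul.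
  rewrite (restrict_comp (h := fun r => r ^+ 2)) ?expr0n// => /L1_restrict lu.
  split => //; move: ul; rewrite /mem_L2 inE => /andP[/[!inE]/= mu _].
  exact/(measurable_restrictT _ mO).
rewrite /mem_L2 inE; apply/andP; split; rewrite inE /=.
  exact/(measurable_restrictT _ mO).
rewrite /finite_norm unlock; apply: poweR_lty.
have -> : (fun x : T3 => (`|(EFin \o (u \_ Omega)) x| `^ 2)%E) =
    (EFin \o ((fun x => u x ^+ 2) \_ Omega)).
  rewrite -(restrict_comp (h := fun r => r ^+ 2)) ?expr0n//.
  by apply/funext => x; rewrite /= -(even_expr_powR (n := 2)).
by apply: integrable_lty => //; exact/L1_restrict.
Qed.

Lemma Lnorm_even (n : nat) u : (0 < n)%N -> ~~ odd n ->
  ('N[leb3]_(n%:R%:E)[EFin \o (u \_ Omega)] =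
   (\int[leb3]_(x in Omega) (u x ^+ n)%:E) `^ n%:R^-1)%E.
Proof.
move=> n0 on; rewrite unlock [in RHS]integral_mkcond; congr poweR.
apply: eq_integral => x _ /=; rewrite patchE; case: ifPn => xO.
  by rewrite patchE xO -(even_expr_powR (n := n)).
rewrite /patch (negbTE xO) (_ : (point : R) = 0)// normr0 powR0//.
by rewrite pnatr_eq0 -lt0n.
Qed.

Lemma norm_Lp_even (n : nat) u : (0 < n)%N -> ~~ odd n ->
  L1 leb3 Omega (fun x => u x ^+ n) ->
  norm_Lp Omega n%:R u ^+ n = \int[leb3]_(x in Omega) (u x ^+ n).
Proof.
move=> n0 on lu; rewrite /norm_Lp Lnorm_even// -EFin_Rint//=.
rewrite -powR_mulrn ?powR_ge0// -powRrM mulVf ?pnatr_eq0 -?lt0n//.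
by rewrite powRr1// Rintegral_ge0// => x _; rewrite exprn_even_ge0.
Qed.

(** [fine] sends an infinite norm to 0, so a nonzero value certifies that the integral is finite. *)
Lemma norm_Lp_even_neq0 (n : nat) u : (0 < n)%N -> ~~ odd n ->
  measurable_fun Omega u -> norm_Lp Omega n%:R u != 0 ->
  L1 leb3 Omega (fun x => u x ^+ n).
Proof.
move=> n0 on mu; rewrite /norm_Lp Lnorm_even// => h.
have m : measurable_fun Omega (fun x : T3 => (u x ^+ n)%:E).
  by apply/measurable_EFinP; exact: measurable_funX.
apply/integrableP; split => //.
under eq_integral => x _ do rewrite gee0_abs ?lee_fin ?exprn_even_ge0//.
rewrite ltey; apply: contra_neqN h => /eqP ->.
by rewrite poweRyr// invr_eq0 pnatr_eq0 -lt0n.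
Qed.

Lemma Rint_ae_eq f g : measurable_fun (Omega : set T3) f ->
  measurable_fun (Omega : set T3) g -> {ae leb3, forall x, Omega x -> f x = g x} ->
  \int[leb3]_(x in Omega) f x = \int[leb3]_(x in Omega) g x.
Proof.
move=> mf mg fg; rewrite /Rintegral; congr fine.
apply: ae_eq_integral => //; [exact/measurable_EFinP|exact/measurable_EFinP|].
by apply: (ae_imp _ fg) => x h Ox; rewrite /= h.
Qed.

End lebesgue_norms.

Lemma ler_quarters (R : realFieldType) (a b e : R) :
  a <= e / 4 -> b <= e / 4 -> 2 * a + 2 * b <= e.
Proof. lra. Qed.

(** * Functions of H^1_0 paired with a weak gradient *)

Section weak_gradients.
Context (R : realType) (Omega : set (R * R * R)).
Notation T3 := (measurableTypeR R * measurableTypeR R * measurableTypeR R)%type.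
Hypotheses (oO : open Omega) (fO : (leb3 Omega < +oo)%E).
Let mO : measurable (Omega : set T3). Proof. exact: open_measurable3. Qed.
Notation L2 := (L2 leb3 Omega).
Notation sqn := (L2_sqn leb3 Omega).
Notation ip := (L2_ip leb3 Omega).
Implicit Types u v phi : R * R * R -> R.
Implicit Types g h : 'I_3 -> R * R * R -> R.

Lemma big_ord3 (V : nmodType) (F : 'I_3 -> V) :
  \sum_(i < 3) F i = F i0 + F i1 + F i2.
Proof.
rewrite !big_ord_recl big_ord0 addr0 addrA.
by congr (F _ + F _ + F _); exact: val_inj.
Qed.

Definition grad_ip g h : R := \sum_(i < 3) ip (g i) (h i).

Notation gip := grad_ip.

Definition grad_sqn g : R := \sum_(i < 3) sqn (g i).

Notation gsqn := grad_sqn.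

Definition grad phi : 'I_3 -> R * R * R -> R := fun i x => 'D_(ebasis i) phi x.

(* [H0 u g]: u belongs to H^1_0 and g is its weak gradient. *)
Definition H0 u g : Prop := [/\ L2 u, forall i, weak_partial Omega i u (g i) &
  forall e, 0 < e -> exists2 phi, test_function Omega phi &
    sqn (fun x => u x - phi x) <= e /\ gsqn (fun i x => g i x - grad phi i x) <= e].

Lemma weak_partial_L2 i u f : weak_partial Omega i u f -> L2 f.
Proof. by move=> [/(mem_L2P mO)]. Qed.

Lemma weak_partialP i u f : weak_partial Omega i u f <-> L2 f /\
  forall phi, test_function Omega phi -> ip u (grad phi i) = - ip f phi.
Proof. by rewrite /weak_partial (mem_L2P mO). Qed.

Lemma weak_partial_unique i u f1 f2 : weak_partial Omega i u f1 ->
  weak_partial Omega i u f2 -> {ae leb3, forall x, Omega x -> f1 x = f2 x}.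
Proof.
move=> /weak_partialP[l1 w1] /weak_partialP[l2 w2].
have l12 := L2B mO l1 l2.
have := ae_eq0_test oO (L2_L1 mO fO l12).
have H phi : test_function Omega phi ->
    \int[leb3]_(x in Omega) ((f1 x - f2 x) * phi x) = 0.
  move=> tphi; rewrite -/(ip (fun x => f1 x - f2 x) phi) ipBl//; last exact: test_L2.
  by rewrite -[ip f1 phi]opprK -[ip f2 phi]opprK -w1// -w2// subrr.
by move=> /(_ H); apply: ae_imp => x h Ox; apply/eqP; rewrite -subr_eq0 h.
Qed.

Lemma weak_partial_test i phi : test_function Omega phi ->
  weak_partial Omega i phi (grad phi i).
Proof.
move=> tphi; apply/weak_partialP; split.
  by apply: (test_L2 oO); exact: (test_function_derive (ebasis i) tphi).
by move=> psi tpsi; rewrite /ip /grad test_ibp.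
Qed.

Lemma weak_partialD i u v f1 f2 : L2 u -> L2 v -> weak_partial Omega i u f1 ->
  weak_partial Omega i v f2 ->
  weak_partial Omega i (fun x => u x + v x) (fun x => f1 x + f2 x).
Proof.
move=> lu lv /weak_partialP[l1 w1] /weak_partialP[l2 w2]; apply/weak_partialP.
split; first exact: L2D.
move=> phi tphi; have l3 := test_L2 oO tphi.
have l4 := test_L2 oO (test_function_derive (ebasis i) tphi).
by rewrite !ipDl// w1// w2// opprD.
Qed.

Lemma weak_partialZ i k u f : L2 u -> weak_partial Omega i u f ->
  weak_partial Omega i (fun x => k * u x) (fun x => k * f x).
Proof.
move=> lu /weak_partialP[l1 w1]; apply/weak_partialP; split; first exact: L2Z.
move=> phi tphi; have l3 := test_L2 oO tphi.
have l4 := test_L2 oO (test_function_derive (ebasis i) tphi).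
by rewrite !ipZl// w1// mulrN.
Qed.

Lemma gsqn_ge0 g : 0 <= gsqn g.
Proof. by apply: sumr_ge0 => i _; exact: sqn_ge0. Qed.

Lemma H0_L2 u g : H0 u g -> L2 u. Proof. by case. Qed.

Lemma H0_L2g u g i : H0 u g -> L2 (g i).
Proof. by move=> [_ /(_ i)/weak_partial_L2]. Qed.

Lemma grad_L2 phi i : test_function Omega phi -> L2 (grad phi i).
Proof.
by move=> tp; apply: (test_L2 oO); exact: (test_function_derive (ebasis i) tp).
Qed.

Lemma gsqnD_le g h : (forall i, L2 (g i)) -> (forall i, L2 (h i)) ->
  gsqn (fun i x => g i x + h i x) <= 2 * gsqn g + 2 * gsqn h.
Proof.
move=> lg lh; rewrite /gsqn !mulr_sumr -big_split /=; apply: ler_sum => i _.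
exact: sqnD_le.
Qed.

Lemma gradD phi psi : test_function Omega phi -> test_function Omega psi ->
  grad (fun x => phi x + psi x) = (fun i x => grad phi i x + grad psi i x).
Proof.
move=> tp tq; apply/funext => i; apply/funext => x.
rewrite /grad.
have d1 : derivable phi x (ebasis i).
  by apply: smooth_derivable; exact: test_function_smooth tp.
have d2 : derivable psi x (ebasis i).
  by apply: smooth_derivable; exact: test_function_smooth tq.
exact: (deriveD d1 d2).
Qed.

Lemma gradZ k phi : test_function Omega phi ->
  grad (fun x => k * phi x) = (fun i x => k * grad phi i x).
Proof.
move=> tp; apply/funext => i; apply/funext => x; rewrite /grad.
have d : derivable phi x (ebasis i).
  by apply: smooth_derivable; exact: test_function_smooth tp.
exact: (deriveZ k d).
Qed.

Lemma H0_test phi : test_function Omega phi -> H0 phi (grad phi).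
Proof.
move=> tp; split; first exact: test_L2.
  by move=> i; exact: weak_partial_test.
move=> e e0; exists phi => //.
have z f : sqn (fun x => f x - f x) = 0.
  rewrite /L2_sqn (_ : (fun x => _) = (fun=> 0 : R)); last first.
    by apply/funext => x; rewrite subrr expr0n.
  by rewrite Rintegral_cst// mul0r.
by split; [rewrite z ltW|rewrite /gsqn big1 ?ltW// => i _; exact: z].
Qed.

Lemma H0D u v g h : H0 u g -> H0 v h ->
  H0 (fun x => u x + v x) (fun i x => g i x + h i x).
Proof.
move=> Hu Hv; have [lu wu au] := Hu; have [lv wv av] := Hv; split.
- exact: L2D.
- by move=> i; exact: weak_partialD.
move=> e e0; have e4 : 0 < e / 4 by rewrite divr_gt0.
have [phi tp [p1 p2]] := au _ e4; have [psi tq [q1 q2]] := av _ e4.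
exists (fun x => phi x + psi x); first exact: test_functionD.
have E f1 f2 f3 f4 : (fun x : R * R * R => f1 x + f2 x - (f3 x + f4 x) : R) =
    (fun x => (f1 x - f3 x) + (f2 x - f4 x)) by apply/funext => x; ring.
split.
  rewrite E; apply: le_trans (sqnD_le mO _ _) _.
  - by apply: L2B => //; exact: test_L2.
  - by apply: L2B => //; exact: test_L2.
  exact: (ler_quarters p1 q1).
rewrite gradD// (_ : (fun i x => _) = (fun i x => (g i x - grad phi i x) +
   (h i x - grad psi i x))); last first.
  by apply/funext => i; exact: E.
apply: le_trans (gsqnD_le _ _) _.
- by move=> i; apply: L2B; [exact: mO|exact: H0_L2g Hu|exact: grad_L2].
- by move=> i; apply: L2B; [exact: mO|exact: H0_L2g Hv|exact: grad_L2].
exact: (ler_quarters p2 q2).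
Qed.

Lemma gsqnZ k g : (forall i, L2 (g i)) ->
  gsqn (fun i x => k * g i x) = k ^+ 2 * gsqn g.
Proof. by move=> lg; rewrite /gsqn mulr_sumr; apply: eq_bigr => i _; rewrite sqnZ. Qed.

Lemma H0Z k u g : H0 u g -> H0 (fun x => k * u x) (fun i x => k * g i x).
Proof.
move=> Hu; have [lu wu au] := Hu; split.
- exact: L2Z.
- by move=> i; exact: weak_partialZ.
move=> e e0; have k0 : 0 < k ^+ 2 + 1 by rewrite ltr_wpDl ?sqr_ge0.
have [phi tp [p1 p2]] := au _ (divr_gt0 e0 k0).
exists (fun x => k * phi x); first exact: test_functionZ.
have E f1 f2 : (fun x : R * R * R => k * f1 x - k * f2 x : R) =
    (fun x => k * (f1 x - f2 x)) by apply/funext => x; ring.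
have le : k ^+ 2 * (e / (k ^+ 2 + 1)) <= e.
  rewrite mulrCA ler_piMr ?(ltW e0)// ler_pdivrMr// mul1r; lra.
split.
  rewrite E sqnZ//; last by apply: L2B => //; exact: test_L2.
  by apply: le_trans le; rewrite ler_wpM2l ?sqr_ge0.
rewrite gradZ// (_ : (fun i x => _) = (fun i x => k * (g i x - grad phi i x))); last first.
  by apply/funext => i; exact: E.
rewrite gsqnZ; last by move=> i; apply: L2B; [exact: mO|exact: H0_L2g Hu|exact: grad_L2].
by apply: le_trans le; rewrite ler_wpM2l ?sqr_ge0.
Qed.

Lemma H0B u v g h : H0 u g -> H0 v h ->
  H0 (fun x => u x - v x) (fun i x => g i x - h i x).
Proof.
move=> Hu Hv; have := H0D Hu (H0Z (-1) Hv).
under eq_fun do rewrite mulN1r.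
by under [X in H0 _ X]eq_fun do under eq_fun do rewrite mulN1r.
Qed.

(** Weak derivatives are unique almost everywhere, so the representatives chosen by [wpartial] may
    be exchanged for any others. This permits computing with explicit pairs of a function and its
    gradient. *)
Lemma dot_gradE u v g h : (forall i, weak_partial Omega i u (g i)) ->
  (forall i, weak_partial Omega i v (h i)) -> dot_grad Omega u v = gip g h.
Proof.
move=> wu wv.
have wpu i : weak_partial Omega i u (wpartial Omega i u).
  by apply: (@xgetPex _ (cst 0) [set f | weak_partial Omega i u f]); exists (g i); exact: wu.
have wpv i : weak_partial Omega i v (wpartial Omega i v).
  by apply: (@xgetPex _ (cst 0) [set f | weak_partial Omega i v f]); exists (h i); exact: wv.
have lu i := weak_partial_L2 (wpu i); have lv i := weak_partial_L2 (wpv i).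
have E i : ip (wpartial Omega i u) (wpartial Omega i v) = ip (g i) (h i).
  have lg := weak_partial_L2 (wu i); have lh := weak_partial_L2 (wv i).
  apply: (Rint_ae_eq mO).
  - by apply: measurable_funM; [exact: L2_measurable (lu i)|exact: L2_measurable (lv i)].
  - by apply: measurable_funM; [exact: L2_measurable lg|exact: L2_measurable lh].
  have A := weak_partial_unique (wpu i) (wu i).
  have B := weak_partial_unique (wpv i) (wv i).
  by apply: (ae_imp2 _ A B) => x a b Ox; rewrite a// b.
rewrite /gip -(eq_bigr _ (fun i _ => E i)) big_ord3 /ip.
rewrite -!RintegralD//; try by [exact: L2M|apply: L1D => //; exact: L2M].
by apply: Rint_eq => x _; rewrite big_ord3.
Qed.

Lemma norm_H01_sqr u g : (forall i, weak_partial Omega i u (g i)) ->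
  norm_H01 Omega u ^+ 2 = gsqn g.
Proof.
move=> wu; have E : dot_grad Omega u u = gsqn g.
  by rewrite (dot_gradE wu wu); apply: eq_bigr => i _; rewrite sqnE.
by rewrite /norm_H01 E sqr_sqrtr// gsqn_ge0.
Qed.

Lemma mem_H01_H0 u : mem_H01 Omega u -> H0 u (fun i => wpartial Omega i u).
Proof.
move=> [[/(mem_L2P mO) lu gu] [phi [tphi cphi]]].
have wpu i : weak_partial Omega i u (wpartial Omega i u).
  by apply: (@xgetPex _ (cst 0) [set f | weak_partial Omega i u f]); exact: gu.
split => // e e0.
have s0 : 0 < Num.sqrt e by rewrite sqrtr_gt0.
have /cvgrPdist_lt/(_ _ s0)[n _ /(_ n (leqnn n))] := cphi.
rewrite /= sub0r normrN => h; exists (phi n) => //.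
have lun : L2 (fun x => u x - phi n x) by apply: L2B => //; exact: test_L2.
have wun i : weak_partial Omega i (u \- phi n)
    (fun x => wpartial Omega i u x - grad (phi n) i x).
  have := weak_partialD lu (L2Z mO (-1) (test_L2 oO (tphi n))) (wpu i)
    (weak_partialZ (-1) (test_L2 oO (tphi n)) (weak_partial_test i (tphi n))).
  under eq_fun do rewrite mulN1r.
  by under [X in weak_partial _ _ _ X]eq_fun do rewrite mulN1r.
have : norm_H1 Omega (u \- phi n) ^+ 2 < e.
  rewrite -[ltRHS](sqr_sqrtr (ltW e0)) -(real_normK (num_real (norm_H1 _ _))).
  by rewrite ltr_pXn2r ?nnegrE ?sqrtr_ge0.
rewrite /norm_H1 (norm_H01_sqr wun) (norm_Lp_even mO (n := 2))//; last exact: L2_sqr.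
have a := sqn_ge0 leb3 Omega (fun x => u x - phi n x).
have b := gsqn_ge0 (fun i x => wpartial Omega i u x - grad (phi n) i x).
rewrite sqr_sqrtr; last by rewrite addr_ge0.
rewrite -/(sqn (fun x => u x - phi n x)).
by move: (gsqn _) (sqn _) a b => p q *; lra.
Qed.

Lemma H0_mem_H01 u g : H0 u g -> mem_H01 Omega u.
Proof.
move=> Hu; have [lu wu au] := Hu; split.
  by split; [exact/(mem_L2P mO)|move=> i; exists (g i)].
have i0 k : 0 < (k.+1%:R : R)^-1 by rewrite invr_gt0.
have /choice[phi Hphi] k : exists phi, test_function Omega phi /\
   sqn (fun x => u x - phi x) <= k.+1%:R^-1 /\
   gsqn (fun i x => g i x - grad phi i x) <= k.+1%:R^-1.
  by have [phi tp [p1 p2]] := au _ (i0 k); exists phi.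
exists phi; split; first by move=> n; case: (Hphi n).
have wun n i : weak_partial Omega i (u \- phi n) (fun x => g i x - grad (phi n) i x).
  by have [_ /(_ i)] := H0B Hu (H0_test (Hphi n).1).
apply: (@squeeze_cvgr _ _ _ _ (fun=> 0) (fun n => Num.sqrt (2 * n.+1%:R^-1))).
- apply: nearW => n; rewrite sqrtr_ge0 /= /norm_H1 (norm_H01_sqr (wun n)).
  rewrite (norm_Lp_even mO (n := 2))//; last first.
    by apply: L2_sqr; apply: L2B => //; apply: test_L2; case: (Hphi n).
  have [_ [p1 p2]] := Hphi n; rewrite ler_wsqrtr//.
  by rewrite (_ : 2 * _ = n.+1%:R^-1 + n.+1%:R^-1) ?lerD//; ring.
- exact: cvg_cst.
rewrite -[X in _ --> X]sqrtr0.
have c : (fun n => 2 * (n.+1%:R : R)^-1) @ \oo --> (0 : R).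
  by rewrite -[X in _ --> X](mulr0 2); apply: cvgMr; exact: cvg_harmonic.
by apply: (cvg_comp _ _ c); exact: sqrt_continuous.
Qed.

End weak_gradients.

(** * The Sobolev inequality and strong limits in H^1_0 *)

Section sobolev_space.
Context (R : realType) (Omega : set (R * R * R)).
Notation T3 := (measurableTypeR R * measurableTypeR R * measurableTypeR R)%type.
Hypotheses (oO : open Omega) (fO : (leb3 Omega < +oo)%E).
Let mO : measurable (Omega : set T3). Proof. exact: open_measurable3. Qed.
Notation L1 := (L1 leb3 Omega).
Notation L2 := (L2 leb3 Omega).
Notation sqn := (L2_sqn leb3 Omega).
Notation ip := (L2_ip leb3 Omega).
Notation gsqn := (grad_sqn Omega).
Notation gip := (grad_ip Omega).
Notation H0 := (H0 Omega).
Implicit Types u v phi : R * R * R -> R.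
Implicit Types g h : 'I_3 -> R * R * R -> R.

Lemma sobolev_constant_ge0 : 0 <= sobolev_constant Omega.
Proof.
rewrite /sobolev_constant; set A := (X in inf X).
have [->|/set0P A0] := eqVneq A set0; first by rewrite inf0.
apply: lb_le_inf => // _ [u _ <-].
by rewrite divr_ge0 ?sqr_ge0.
Qed.

(** The infimum of the empty set is 0 here, so a positive constant yields a nonzero function, later
    scaled to reach negative energy. *)
Lemma sobolev_constant_nontrivial : 0 < sobolev_constant Omega ->
  exists u g, H0 u g /\ ~ {ae leb3, forall x, Omega x -> u x = 0}.
Proof.
move=> S0; suff [u [uH un]] : exists u, mem_H01 Omega u /\
    ~ {ae leb3, forall x, Omega x -> u x = 0}.
  by exists u, (fun i => wpartial Omega i u); split => //; exact: mem_H01_H0.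
apply: contrapT => nE; move: S0; rewrite /sobolev_constant.
rewrite (_ : image _ _ = set0) ?inf0 ?ltxx//.
by rewrite -subset0 => x [u [uH un] _]; apply: nE; exists u.
Qed.

(** The inequality is the definition of the infimum, raised to the third power. Membership in L^6 is
    the part that relies on positivity of the constant. *)
Lemma sobolev_inequality u g : 0 < sobolev_constant Omega -> H0 u g ->
  L1 (fun x => u x ^+ 6) /\
  sobolev_constant Omega ^+ 3 * \int[leb3]_(x in Omega) (u x ^+ 6) <= gsqn g ^+ 3.
Proof.
move=> S0 Hu; have [lu wu _] := Hu.
have mu : measurable_fun (Omega : set T3) u := L2_measurable lu.
have mu6 : measurable_fun (Omega : set T3) (fun x => u x ^+ 6) by exact: measurable_funX.
have [un|nun] := pselect {ae leb3, forall x, Omega x -> u x = 0}.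
  have I0 : (\int[leb3]_(x in Omega) (u x ^+ 6)%:E = 0)%E.
    rewrite (@ae_eq_integral _ _ _ leb3 Omega (cst 0%E)) ?integral0//.
      exact/measurable_EFinP.
    by apply: (ae_imp _ un) => x h Ox; rewrite h// expr0n.
  split.
    apply/integrableP; split; first exact/measurable_EFinP.
    under eq_integral => x _ do rewrite /= ger0_norm ?exprn_even_ge0//.
    by rewrite I0 ltry.
  by rewrite /Rintegral I0 /= mulr0 exprn_ge0// gsqn_ge0.
set S := sobolev_constant Omega in S0 *.
have HS : S <= norm_H01 Omega u ^+ 2 / norm_Lp Omega 6 u ^+ 2.
  apply: inf_lbound; last by exists u => //; split => //; exact: (H0_mem_H01 oO fO Hu).
  by exists 0 => _ [v _ <-]; rewrite divr_ge0 ?sqr_ge0.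
(* An infinite norm would be read as 0 and division by 0 gives 0, so the quotient would be 0 and
   could not dominate S > 0. *)
have N0 : norm_Lp Omega 6 u != 0.
  by apply: contraTneq HS => ->; rewrite expr0n invr0 mulr0 -ltNge.
have l6 := norm_Lp_even_neq0 (n := 6) isT isT mu N0.
split => //; rewrite -(norm_Lp_even mO (n := 6) isT isT l6).
rewrite (_ : norm_Lp _ _ _ ^+ 6 = (norm_Lp Omega 6 u ^+ 2) ^+ 3); last by rewrite -exprM.
rewrite -exprMn lerXn2r ?nnegrE ?gsqn_ge0//.
  by apply: mulr_ge0; [exact: ltW|exact: sqr_ge0].
by rewrite -ler_pdivlMr ?exprn_even_gt0// -(norm_H01_sqr oO fO wu).
Qed.

Lemma ip_young t u v : 0 < t -> L2 u -> L2 v ->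
  `|ip u v| <= t * sqn u + t^-1 * sqn v.
Proof.
move=> t0 lu lv; rewrite -(ler_pM2l t0) mulrDr (mulrA t t^-1) mulfV ?gt_eqF// mul1r.
have h1 := sqn_ge0 leb3 Omega (fun x => t * u x + v x).
have h2 := sqn_ge0 leb3 Omega (fun x => t * u x - v x).
rewrite sqnD ?sqnZ ?ipZl// in h1; last exact: L2Z.
rewrite sqnB ?sqnZ ?ipZl// in h2; last exact: L2Z.
have := sqn_ge0 leb3 Omega u; have := sqn_ge0 leb3 Omega v.
move: (ip u v) (sqn u) (sqn v) h1 h2 => p a b h1 h2 b0 a0.
have -> : t * `|p| = `|t * p| by rewrite normrM (gtr0_norm t0).
rewrite ler_norml; have := mulr_ge0 (sqr_ge0 t) a0; lra.
Qed.

Lemma gip_young t g h : 0 < t -> (forall i, L2 (g i)) -> (forall i, L2 (h i)) ->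
  `|gip g h| <= t * gsqn g + t^-1 * gsqn h.
Proof.
move=> t0 lg lh; rewrite /grad_ip /grad_sqn !mulr_sumr -big_split /=.
by apply: le_trans (ler_norm_sum _ _ _) _; apply: ler_sum => i _; exact: ip_young.
Qed.

Lemma gipC g h : gip g h = gip h g.
Proof. by apply: eq_bigr => i _; exact: ipC. Qed.

Lemma gipBl g1 g2 h : (forall i, L2 (g1 i)) -> (forall i, L2 (g2 i)) ->
  (forall i, L2 (h i)) -> gip (fun i x => g1 i x - g2 i x) h = gip g1 h - gip g2 h.
Proof.
move=> l1 l2 lh; rewrite /grad_ip -sumrB; apply: eq_bigr => i _.
exact: ipBl.
Qed.

Lemma gsqnD g h : (forall i, L2 (g i)) -> (forall i, L2 (h i)) ->
  gsqn (fun i x => g i x + h i x) = gsqn g + 2 * gip g h + gsqn h.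
Proof.
move=> lg lh; rewrite /grad_sqn /grad_ip mulr_sumr -!big_split /=.
by apply: eq_bigr => i _; rewrite sqnD.
Qed.

Lemma gsqnB g h : (forall i, L2 (g i)) -> (forall i, L2 (h i)) ->
  gsqn (fun i x => g i x - h i x) = gsqn g - 2 * gip g h + gsqn h.
Proof.
move=> lg lh; rewrite /grad_sqn /grad_ip mulr_sumr -sumrB -!big_split /=.
by apply: eq_bigr => i _; rewrite sqnB.
Qed.

Lemma gsqnB_le g h : (forall i, L2 (g i)) -> (forall i, L2 (h i)) ->
  gsqn (fun i x => g i x - h i x) <= 2 * gsqn g + 2 * gsqn h.
Proof.
move=> lg lh; rewrite /grad_sqn !mulr_sumr -big_split /=; apply: ler_sum => i _.
exact: sqnB_le.
Qed.

Lemma eq0_of_le_mul (a C : R) : (forall e, 0 < e -> `|a| <= e * C) -> a = 0.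
Proof.
move=> H; apply/eqP/negPn/negP => a0.
have p : 0 < `|a| by rewrite normr_gt0.
have C0 : 0 < C by have := H 1 ltr01; rewrite mul1r; exact: lt_le_trans.
have := H (`|a| / (2 * C)) (divr_gt0 p (mulr_gt0 (ltr0Sn _ 1) C0)).
have -> : `|a| / (2 * C) * C = `|a| / 2 by field; rewrite gt_eqF.
lra.
Qed.

(** Both sides of the integration by parts formula are L^2-continuous for a fixed test function, and
    test functions approximating the approximants also approximate the limit. *)
Lemma H0_limit u g : L2 u -> (forall i, L2 (g i)) ->
  (forall e, 0 < e -> exists v h, [/\ H0 v h, sqn (fun x => u x - v x) <= e &
    gsqn (fun i x => g i x - h i x) <= e]) -> H0 u g.
Proof.
move=> lu lg app; split => //.
  move=> i; apply/weak_partialP => //; split => // phi tp.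
  have lp := test_L2 oO tp; have lD := grad_L2 oO i tp.
  apply/eqP; rewrite -subr_eq0 opprK; apply/eqP.
  apply: (@eq0_of_le_mul _ (2 + sqn (grad phi i) + sqn phi)) => e e0.
  (* Accuracy e^2 compensates the weight e^-1 that Young's inequality puts on the differences. *)
  have e2 : 0 < e ^+ 2 by rewrite exprn_gt0.
  have [v [h [Hv v1 v2]]] := app _ e2.
  have lv := H0_L2 Hv; have lh j := H0_L2g oO j Hv.
  have /weak_partialP[//|_ wv] : weak_partial Omega i v (h i) by case: Hv.
  have -> : ip u (grad phi i) + ip (g i) phi =
      ip (fun x => u x - v x) (grad phi i) + ip (fun x => g i x - h i x) phi.
    by rewrite !ipBl// wv//; ring.
  have ei : 0 < e^-1 by rewrite invr_gt0.
  apply: le_trans (ler_normD _ _) _.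
  have y1 := ip_young ei (L2B mO lu lv) lD.
  have y2 := ip_young ei (L2B mO (lg i) (lh i)) lp.
  have v3 : sqn (fun x => g i x - h i x) <= e ^+ 2.
    apply: le_trans v2; rewrite /grad_sqn (bigD1 i)//= lerDl.
    by apply: sumr_ge0 => j _; exact: sqn_ge0.
  apply: le_trans (lerD y1 y2) _.
  rewrite invrK; move: v1 v3; move: (sqn _) (sqn _) (sqn _) (sqn _) => a b c d v1 v3.
  have h1 : e^-1 * d <= e by rewrite mulrC ler_pdivrMr// -expr2.
  have h2 : e^-1 * c <= e by rewrite mulrC ler_pdivrMr// -expr2.
  lra.
move=> e e0; have e4 : 0 < e / 4 by rewrite divr_gt0.
have [v [h [Hv v1 v2]]] := app _ e4.
have [lv _ av] := Hv; have lh j := H0_L2g oO j Hv.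
have [phi tp [p1 p2]] := av _ e4; exists phi => //.
have E f1 f2 f3 : (fun x : R * R * R => f1 x - f2 x : R) =
    (fun x => (f1 x - f3 x) + (f3 x - f2 x)) by apply/funext => x; ring.
split.
  rewrite (E _ _ v); apply: le_trans (sqnD_le mO _ _) _.
  - exact: L2B.
  - by apply: L2B => //; exact: test_L2.
  exact: (ler_quarters v1 p1).
rewrite (_ : (fun i x => _) = (fun i x => (g i x - h i x) + (h i x - grad phi i x))).
  apply: le_trans (gsqnD_le oO _ _) _.
  - by move=> i; exact: L2B.
  - by move=> i; apply: L2B => //; exact: grad_L2.
  exact: (ler_quarters v2 p2).
by apply/funext => i; exact: E.
Qed.

End sobolev_space.

(** Fits errors that Young's inequality splits into a uniformly small part and a part that vanishes
    in the limit for each fixed weight. *)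
Lemma cvg0_of_le (R : realType) (a : nat -> R) (C : R) :
  (forall e, 0 < e -> exists2 x : nat -> R, x n @[n --> \oo] --> (0 : R) &
    forall n, `|a n| <= e * C + x n) -> a n @[n --> \oo] --> (0 : R).
Proof.
move=> H; apply/cvgrPdist_le => e e0.
have C1 : 0 < `|C| + 1 by rewrite ltr_wpDl.
have d0 : 0 < e / 2 / (`|C| + 1) by rewrite !divr_gt0.
have [x x0 ax] := H _ d0.
have e2 : 0 < e / 2 by rewrite divr_gt0.
have /cvgrPdist_le/(_ _ e2) := x0; apply: filterS => n.
rewrite !sub0r !normrN => xn; apply: le_trans (ax n) _.
have h1 : e / 2 / (`|C| + 1) * C <= e / 2.
  rewrite mulrAC ler_pdivrMr// ler_wpM2l ?(ltW e2)//.
  by have := ler_norm C; lra.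
by have := ler_norm (x n); lra.
Qed.

(** Pointwise interpolation of L^2 between L^1 and L^6: the first term serves |d| <= A, and
    otherwise (|d|/A)^4 >= 1. *)
Lemma le_mul_norm_pow6 (R : realFieldType) (A d : R) : 0 < A ->
  d ^+ 2 <= A * `|d| + A^-1 ^+ 4 * d ^+ 6.
Proof.
move=> A0; have [dA|Ad] := leP `|d| A.
  apply: (@le_trans _ _ (A * `|d|)).
    by rewrite -(real_normK (num_real d)) expr2 ler_wpM2r.
  have d6 : 0 <= d ^+ 6 by rewrite exprn_even_ge0.
  have A4 : 0 <= A^-1 ^+ 4 by rewrite exprn_even_ge0.
  by rewrite lerDl mulr_ge0.
apply: (@le_trans _ _ (A^-1 ^+ 4 * d ^+ 6)); last by rewrite lerDr mulr_ge0// ltW.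
have -> : A^-1 ^+ 4 * d ^+ 6 = (A^-1 * `|d|) ^+ 4 * d ^+ 2.
  rewrite exprMn; have -> : `|d| ^+ 4 = d ^+ 4 by rewrite -normrX ger0_norm// exprn_even_ge0.
  ring.
rewrite ler_peMl ?sqr_ge0// exprn_ege1// mulrC ler_pdivlMr// mul1r; exact: ltW.
Qed.

Lemma normr_le1_pow6 (R : realFieldType) (d : R) : `|d| <= 1 + d ^+ 6.
Proof.
have [d1|d1] := leP `|d| 1.
  by apply: (le_trans d1); rewrite lerDl exprn_even_ge0.
rewrite (_ : d ^+ 6 = `|d| ^+ 6).
  by apply: (@le_trans _ _ (`|d| ^+ 6)); rewrite ?lerDr// ler_eXnr// ltW.
by rewrite -normrX ger0_norm// exprn_even_ge0.
Qed.

Lemma normr_le1_sqr (R : realFieldType) (d : R) : `|d| <= 1 + d ^+ 2.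
Proof.
rewrite -(real_normK (num_real d)); have := sqr_ge0 (`|d| - 1); have := normr_ge0 d.
by rewrite sqrrB; nra.
Qed.

(** * Weak limits of gradients *)

Section compactness.
Context (R : realType) (Omega : set (R * R * R)).
Notation T3 := (measurableTypeR R * measurableTypeR R * measurableTypeR R)%type.
Hypotheses (oO : open Omega) (fO : (leb3 Omega < +oo)%E).
Let mO : measurable (Omega : set T3). Proof. exact: open_measurable3. Qed.
Notation L1 := (L1 leb3 Omega).
Notation L2 := (L2 leb3 Omega).
Notation sqn := (L2_sqn leb3 Omega).
Notation ip := (L2_ip leb3 Omega).
Notation gsqn := (grad_sqn Omega).
Notation gip := (grad_ip Omega).
Notation H0 := (H0 Omega).
Implicit Types u v phi : R * R * R -> R.
Implicit Types g h : 'I_3 -> R * R * R -> R.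

Lemma H0_complete u (v_ : nat -> R * R * R -> R) (h_ : nat -> 'I_3 -> R * R * R -> R) : L2 u ->
  (forall n, H0 (v_ n) (h_ n)) -> sqn (fun x => u x - v_ n x) @[n --> \oo] --> (0 : R) ->
  (forall e, 0 < e -> exists N, forall m n, (N <= m)%N -> (N <= n)%N ->
     gsqn (fun i x => h_ m i x - h_ n i x) <= e) -> exists g, H0 u g.
Proof.
move=> lu Hv vu ch.
have lh i n : L2 (h_ n i) by apply: (H0_L2g oO i (Hv n)).
have /choice[g Hg] i : exists g : R * R * R -> R, L2 g /\ forall e, 0 < e ->
    exists N, forall n, (N <= n)%N -> sqn (fun x => h_ n i x - g x) <= e.
  apply: (L2_complete mO fO (lh i)) => e e0; have [N HN] := ch e e0; exists N => m n Nm Nn.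
  apply: le_trans (HN m n Nm Nn); rewrite /grad_sqn (bigD1 i)//= lerDl.
  by apply: sumr_ge0 => j _; exact: sqn_ge0.
exists g; apply: (H0_limit oO) => //; first by move=> i; case: (Hg i).
move=> e e0; have e3 : 0 < e / 3 by rewrite divr_gt0.
have /choice[N HN] i : exists N, forall n, (N <= n)%N ->
    sqn (fun x => h_ n i x - g i x) <= e / 3 by case: (Hg i) => _; exact.
have /cvgrPdist_le/(_ _ e0)[M _ HM] := vu.
pose n := maxn M (\max_(i < 3) N i); exists (v_ n), (h_ n); split => //.
  have := HM n (leq_maxl _ _); rewrite sub0r normrN; apply: le_trans; exact: ler_norm.
apply: (@le_trans _ _ (\sum_(i < 3) e / 3)).
  apply: ler_sum => i _; rewrite sqn_sym; apply: HN.
  by rewrite leq_max; apply/orP; right; exact: (leq_bigmax i).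
by rewrite sumr_const card_ord -[_ *+ 3]mulr_natr divfK.
Qed.

(** Let M be the least asymptotic squared gradient norm of pairs approaching u in L^2. Midpoints of
    near-optimal pairs still approach u, hence have squared gradient norm nearly M or more; by the
    parallelogram law the gradients of a near-optimal sequence are Cauchy, and their strong limit is
    a weak gradient of u. *)
Lemma H0_relax u K : L2 u -> (forall e, 0 < e -> exists v h, [/\ H0 v h,
    sqn (fun x => v x - u x) <= e & gsqn h <= K]) -> exists g, H0 u g.
Proof.
move=> lu HK.
pose P := [set c | forall e, 0 < e -> exists v h, [/\ H0 v h,
    sqn (fun x => v x - u x) <= e & gsqn h <= c]].
have P0 : lbound P 0.
  by move=> c /(_ 1 ltr01)[v [h [_ _]]]; apply: le_trans; exact: gsqn_ge0.
have hP : has_inf P by split; [exists K|exists 0].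
pose M := inf P.
have e_ n : 0 < (n.+1%:R : R)^-1 by rewrite invr_gt0.
(* By minimality of M, within a small enough L^2 distance [d n] of u no pair undercuts M by more
   than 1/(n + 1). *)
have /choice[d Hd] n : exists d, 0 < d /\ forall v h, H0 v h ->
    sqn (fun x => v x - u x) <= d -> M - n.+1%:R^-1 <= gsqn h.
  apply: contrapT => /forallNP nE.
  suff : P (M - n.+1%:R^-1).
    move=> /(ge_inf hP.2); rewrite -/M lerBrDr gerDl => q; have := e_ n.
    by rewrite ltNge q.
  move=> e e0; have := nE e; move=> /not_andP[//|/existsNP[v /existsNP[h]]].
  move=> /not_implyP[Hv /not_implyP[vu /negP]]; rewrite -ltNge => /ltW hM.
  by exists v, h.
have /choice[vh Hvh] n : exists vh : (R * R * R -> R) * ('I_3 -> R * R * R -> R),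
    [/\ H0 vh.1 vh.2, sqn (fun x => vh.1 x - u x) <= Num.min (d n) n.+1%:R^-1 &
      gsqn vh.2 <= M + n.+1%:R^-1].
  have [c Pc cM] := inf_adherent (e_ n) hP.
  have m0 : 0 < Num.min (d n) n.+1%:R^-1 by rewrite lt_min e_ (Hd n).1.
  have [v [h [Hv v1 v2]]] := Pc _ m0; exists (v, h); split => //=.
  exact: le_trans v2 (ltW cM).
have Hv n : H0 (vh n).1 (vh n).2 by case: (Hvh n).
have lv n := H0_L2 (Hv n); have lh n i := H0_L2g oO i (Hv n).
apply: (@H0_complete u (fun n => (vh n).1) (fun n => (vh n).2)) => //.
  apply: (@squeeze_cvgr _ _ _ _ (fun=> 0) (fun n => n.+1%:R^-1)).
  - apply: nearW => n; rewrite sqn_ge0 /= sqn_sym.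
    by case: (Hvh n) => _ + _; rewrite le_min => /andP[].
  - exact: cvg_cst.
  exact: cvg_harmonic.
(* With r, q the two harmonic errors, the parallelogram law gives 2(M + r) + 2(M + q) - 4(M - r - q)
   = 6(r + q). *)
have key m n : gsqn (fun i x => (vh m).2 i x - (vh n).2 i x) <=
    6 * (m.+1%:R^-1 + n.+1%:R^-1).
  have Hw := H0Z oO 2^-1 (H0D oO (Hv m) (Hv n)).
  set w := (X in H0 X _) in Hw; set k := (X in H0 _ X) in Hw.
  have lw : sqn (fun x => w x - u x) <= 2^-1 * sqn (fun x => (vh m).1 x - u x) +
      2^-1 * sqn (fun x => (vh n).1 x - u x).
    have -> : (fun x => w x - u x) = (fun x => 2^-1 * ((vh m).1 x - u x) +
       2^-1 * ((vh n).1 x - u x)) by apply/funext => x; rewrite /w; field.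
    apply: le_trans (sqnD_le mO _ _) _; do ?[by apply: L2Z => //; exact: L2B].
    rewrite !sqnZ//; try exact: L2B.
    move: (sqn _) (sqn _) => p q; lra.
  have gk : M - m.+1%:R^-1 - n.+1%:R^-1 <= gsqn k.
    have [_ + _] := Hvh m; have [_ + _] := Hvh n; rewrite !le_min.
    (* The midpoint lies within the larger of the two radii, and the index of that radius supplies
       the lower bound. *)
    move=> /andP[a1 a2] /andP[b1 b2]; have [dmn|dnm] := leP (d m) (d n).
      have : M - n.+1%:R^-1 <= gsqn k.
        by apply: ((Hd n).2 _ _ Hw); apply: le_trans lw _; clear -a1 b1 dmn; lra.
      by apply: le_trans; rewrite addrAC gerDl oppr_le0 (ltW (e_ m)).
    have : M - m.+1%:R^-1 <= gsqn k.
      by apply: ((Hd m).2 _ _ Hw); apply: le_trans lw _; clear -a1 b1 dnm; lra.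
    by apply: le_trans; rewrite gerDl oppr_le0 (ltW (e_ n)).
  have ek : gsqn k = 2^-1 ^+ 2 * gsqn (fun i x => (vh m).2 i x + (vh n).2 i x).
    by rewrite /k gsqnZ// => i; exact: L2D.
  rewrite ek gsqnD// in gk; rewrite gsqnB//.
  have [_ _] := Hvh m; have [_ _] := Hvh n; move: gk.
  move: (gip _ _) (gsqn _) (gsqn _) (m.+1%:R^-1) (n.+1%:R^-1) => p a c r q; lra.
move=> e e0; have e12 : 0 < e / 12 by rewrite divr_gt0.
have /cvgrPdist_le/(_ _ e12)[N _ HN] := @cvg_harmonic R; exists N => m n Nm Nn.
apply: le_trans (key m n) _; move: (HN m Nm) (HN n Nn).
rewrite /harmonic /= !sub0r !normrN !ger0_norm ?(ltW (e_ _))//.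
by move: (m.+1%:R^-1) (n.+1%:R^-1) => r q; lra.
Qed.

(** Approximate h by the gradient of a test function [psi]. The remainder is small uniformly in n
    because the gradients are bounded; against the gradient of [psi] a further integration by parts
    leaves only u_n - u, which tends to 0 in L^2. *)
Lemma weak_gradient_cvg (u_ : nat -> R * R * R -> R)
    (g_ : nat -> 'I_3 -> R * R * R -> R) u g v h (K : R) :
  (forall n, H0 (u_ n) (g_ n)) -> H0 u g -> (forall n, gsqn (g_ n) <= K) ->
  sqn (fun x => u_ n x - u x) @[n --> \oo] --> (0 : R) -> H0 v h ->
  gip (fun i x => g_ n i x - g i x) h @[n --> \oo] --> (0 : R).
Proof.
move=> Hu_ Hu gK cu Hv.
have lg_ n i : L2 (g_ n i) by exact: H0_L2g (Hu_ n).
have lg i : L2 (g i) by exact: H0_L2g Hu.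
have lh i : L2 (h i) by exact: H0_L2g Hv.
have lB n i : L2 (fun x => g_ n i x - g i x) by exact: L2B.
apply: (@cvg0_of_le _ _ (2 * K + 2 * gsqn g + 2)) => e e0.
have e2 : 0 < e ^+ 2 by rewrite exprn_gt0.
have [_ _ /(_ _ e2)[psi tpsi [_ hpsi]]] := Hv.
have lp i := grad_L2 oO i tpsi.
pose dd i := grad (grad psi i) i.
have td i : test_function Omega (grad psi i) := test_function_derive (ebasis i) tpsi.
have ldd i : L2 (dd i) := grad_L2 oO i (td i).
pose D := \sum_(i < 3) sqn (dd i).
have D0 : 0 <= D by apply: sumr_ge0 => i _; exact: sqn_ge0.
(* This weight in Young's inequality makes the contribution d * D of the second derivatives at most
   e. *)
pose d := e / (D + 1); have d0 : 0 < d by rewrite divr_gt0// ltr_wpDl.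
exists (fun n => 3 * d^-1 * sqn (fun x => u_ n x - u x)).
  by rewrite -[X in _ --> X](mulr0 (3 * d^-1)); exact: cvgMr.
move=> n.
have -> : gip (fun i x => g_ n i x - g i x) h =
    gip (fun i x => g_ n i x - g i x) (fun i x => h i x - grad psi i x) +
    gip (fun i x => g_ n i x - g i x) (grad psi).
  rewrite !(gipC _ (fun i x => g_ n i x - g i x)) gipBl//; ring.
apply: le_trans (ler_normD _ _) _.
have y1 : `|gip (fun i x => g_ n i x - g i x) (fun i x => h i x - grad psi i x)| <=
    e * (2 * K + 2 * gsqn g) + e.
  apply: le_trans (gip_young oO e0 _ _) _ => //; first by move=> i; exact: L2B.
  apply: lerD; first rewrite ler_wpM2l ?(ltW e0)//.
    apply: le_trans (gsqnB_le oO _ _) _ => //; rewrite lerD2r ler_wpM2l//.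
  by rewrite mulrC ler_pdivrMr// -expr2.
have y2 : `|gip (fun i x => g_ n i x - g i x) (grad psi)| <=
    3 * d^-1 * sqn (fun x => u_ n x - u x) + e.
  have luu : L2 (fun x => u_ n x - u x).
    by apply: L2B => //; [exact: H0_L2 (Hu_ n)|exact: H0_L2 Hu].
  apply: le_trans (ler_norm_sum _ _ _) _.
  apply: (@le_trans _ _ (\sum_(i < 3) (d^-1 * sqn (fun x => u_ n x - u x) + d * sqn (dd i)))).
    apply: ler_sum => i _.
    have [_ /(_ i)/weak_partialP[//|_ w] _] := H0B oO (Hu_ n) Hu.
    rewrite -[ip _ _]opprK -(w _ (td i)) normrN.
    have di : 0 < d^-1 by rewrite invr_gt0.
    have := ip_young oO di luu (ldd i); rewrite invrK; exact.
  rewrite big_split /= sumr_const card_ord -mulr_sumr -/D -[_ *+ 3]mulr_natl mulrA lerD2l.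
  rewrite /d mulrAC ler_pdivrMr ?ltr_wpDl// ler_wpM2l ?(ltW e0)//; lra.
by apply: le_trans (lerD y1 y2) _; rewrite !mulrDr; lra.
Qed.

End compactness.

Section real_integrals.
Context d (T : measurableType d) (R : realType).
Variables (mu : {measure set T -> \bar R}) (D : set T).
Hypothesis mD : measurable D.
Implicit Types f g : T -> R.

Lemma Rint_le f g : L1 mu D f -> L1 mu D g -> (forall x, D x -> f x <= g x) ->
  \int[mu]_(x in D) f x <= \int[mu]_(x in D) g x.
Proof. by move=> lf lg fg; exact: le_Rintegral. Qed.

Lemma RintD f g : L1 mu D f -> L1 mu D g ->
  \int[mu]_(x in D) (f x + g x) = \int[mu]_(x in D) f x + \int[mu]_(x in D) g x.
Proof. by move=> lf lg; exact: RintegralD. Qed.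

Lemma RintZ k f : L1 mu D f ->
  \int[mu]_(x in D) (k * f x) = k * \int[mu]_(x in D) f x.
Proof. by move=> lf; exact: RintegralZl. Qed.

End real_integrals.

Lemma pow6B_le (R : realType) (a b : R) : (a - b) ^+ 6 <= 32 * (a ^+ 6 + b ^+ 6).
Proof.
have := pow6D_le a (- b); rewrite (_ : (- b) ^+ 6 = b ^+ 6)//; ring.
Qed.

Lemma scaled_harmonic_cvg (R : realType) (k : R) (s : nat -> nat) :
  (forall n, (n <= s n)%N) -> k * (s n).+1%:R^-1 @[n --> \oo] --> (0 : R).
Proof.
move=> ks; rewrite -[X in _ --> X](mulr0 k); apply: cvgMr.
apply: (@squeeze_cvgr _ _ _ _ (fun=> 0) (fun n => n.+1%:R^-1)).
- apply: nearW => n; rewrite invr_ge0 ler0n /= lef_pV2 ?posrE ?ltr0Sn//.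
  by rewrite ler_nat ltnS.
- exact: cvg_cst.
exact: cvg_harmonic.
Qed.

(** * Compactness of H^1_0 in L^2 *)

Section rellich_kondrachov.
Context (R : realType) (Omega : set (R * R * R)).
Notation T3 := (measurableTypeR R * measurableTypeR R * measurableTypeR R)%type.
Hypotheses (oO : open Omega) (bO : bounded_set Omega)
  (S0 : 0 < sobolev_constant Omega).
Let mO : measurable (Omega : set T3). Proof. exact: open_measurable3. Qed.
Notation L1 := (L1 leb3 Omega).
Notation L2 := (L2 leb3 Omega).
Notation sqn := (L2_sqn leb3 Omega).
Notation ip := (L2_ip leb3 Omega).
Notation gsqn := (grad_sqn Omega).
Notation gip := (grad_ip Omega).
Notation H0 := (H0 Omega).
Implicit Types u v phi : R * R * R -> R.
Implicit Types g h : 'I_3 -> R * R * R -> R.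

Lemma bounded_sub_cbox : exists B, (Omega : set T3) `<=` cbox B.
Proof.
have [M [_ HM]] := bO; exists (M + 1) => -[[x y] z] Ox.
have := HM (M + 1) ltac:(by rewrite ltrDl) _ Ox.
rewrite /= !prod_normE /= !ge_max => /andP[/andP[h1 h2] h3].
by apply/cboxP => /=; rewrite h1 h2 h3.
Qed.

Lemma bounded_leb3_lty : (leb3 Omega < +oo)%E.
Proof.
have [B OB] := bounded_sub_cbox; apply: le_lt_trans (leb3_cbox B).
by apply: le_measure => //; rewrite inE//; exact: measurable_cbox.
Qed.

Let fO := bounded_leb3_lty.

Lemma Rint_setT (f : R * R * R -> R) : (forall x, ~ Omega x -> f x = 0) ->
  \int[leb3]_x f x = \int[leb3]_(x in Omega) f x.
Proof.
move=> f0; rewrite [RHS]Rintegral_mkcond; apply: eq_Rintegral => x _.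
by rewrite patchE; case: ifPn => // /negP xO; rewrite f0// => Ox; apply: xO; rewrite inE.
Qed.

Lemma sobolev_pow6_bound u g K : H0 u g -> gsqn g <= K ->
  \int[leb3]_(x in Omega) (u x ^+ 6) <= K ^+ 3 / sobolev_constant Omega ^+ 3.
Proof.
move=> Hu gK; have [_ h] := sobolev_inequality oO fO S0 Hu.
rewrite ler_pdivlMr ?exprn_gt0// mulrC; apply: (le_trans h).
have K0 : 0 <= K by apply: le_trans gK; exact: gsqn_ge0.
by rewrite lerXn2r// ?nnegrE// gsqn_ge0.
Qed.

(** Test functions extend by zero, so the cells of the Rellich argument may cross the boundary. The
    L^1-Cauchy subsequence is L^2-Cauchy by interpolation with the L^6 bound of the Sobolev
    inequality. *)
Lemma test_subsequence (phi : nat -> R * R * R -> R) (K : R) :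
  (forall n, test_function Omega (phi n)) -> (forall n, gsqn (grad (phi n)) <= K) ->
  exists s u, [/\ forall k, (k <= s k)%N, L2 u &
    sqn (fun x => phi (s k) x - u x) @[k --> \oo] --> (0 : R)].
Proof.
move=> tphi phiK; have [B OB] := bounded_sub_cbox.
have [F [UF ooF]] := ultraFilterLemma (eventually_filter : ProperFilter \oo).
have L1p n := test_L1 oO (tphi n).
have lp n := test_L2 oO (tphi n).
have K6 n := sobolev_pow6_bound (H0_test oO (tphi n)) (phiK n).
have l6 n : L1 (fun x => phi n x ^+ 6).
  by case: (sobolev_inequality oO fO S0 (H0_test oO (tphi n))).
set C := K ^+ 3 / _ in K6; pose V := \int[leb3]_(x in Omega) (1 : R).
have V0 : 0 <= V by apply: Rintegral_ge0.
have C0 : 0 <= C.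
  by apply: le_trans (K6 0%N); apply: Rintegral_ge0 => x _; rewrite exprn_even_ge0.
have K0 : 0 <= K by apply: le_trans (phiK 0%N); exact: gsqn_ge0.
have lD n i := grad_L2 oO i (tphi n).
have L1c : L1 (fun=> 1) by exact: L1_cst.
have H1 n : \int[leb3]_x `|phi n x| <= C + 3 * V + K.
  rewrite (Rint_setT (f := fun x => `|phi n x|)); last first.
    by move=> x Ox; rewrite (test_function_out (tphi n) Ox) normr0.
  apply: (@le_trans _ _ (\int[leb3]_(x in Omega) (1 + phi n x ^+ 6))).
    apply: le_Rintegral => //; [exact: L1_norm|exact: L1D|].
    by move=> x _; exact: normr_le1_pow6.
  have -> : \int[leb3]_(x in Omega) (1 + phi n x ^+ 6) =
      V + \int[leb3]_(x in Omega) (phi n x ^+ 6) by exact: (RintegralD mO L1c (l6 n)).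
  apply: le_trans (lerD (lexx V) (K6 n)) _; clear -V0 K0.
  by move: V V0 C => V V0 C; lra.
have H2 n : \int[leb3]_x (absD (phi n) i0 x + absD (phi n) i1 x + absD (phi n) i2 x)
    <= C + 3 * V + K.
  pose f x := absD (phi n) i0 x + absD (phi n) i1 x + absD (phi n) i2 x.
  rewrite (Rint_setT (f := f)); last first.
    move=> x Ox; have D0 i : absD (phi n) i x = 0.
      by rewrite /absD (test_function_out (test_function_derive (ebasis i) (tphi n)) Ox) normr0.
    by rewrite /f !D0 !addr0.
  have lA i : L1 (absD (phi n) i).
    by apply: L1_norm; apply: test_L1 => //; exact: test_function_derive (tphi n).
  apply: (@le_trans _ _ (\sum_(i < 3) (V + sqn (grad (phi n) i)))).
    have -> : \int[leb3]_(x in Omega) f x = \int[leb3]_(x in Omega) absD (phi n) i0 x +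
        \int[leb3]_(x in Omega) absD (phi n) i1 x + \int[leb3]_(x in Omega) absD (phi n) i2 x.
      rewrite -(RintegralD mO (lA i0) (lA i1)).
      by rewrite -(RintegralD mO (L1D mO (lA i0) (lA i1)) (lA i2)).
    rewrite big_ord3.
    suff P i : \int[leb3]_(x in Omega) absD (phi n) i x <= V + sqn (grad (phi n) i).
      by rewrite !lerD.
    have -> : V + sqn (grad (phi n) i) =
        \int[leb3]_(x in Omega) (1 + grad (phi n) i x ^+ 2).
      by apply/esym/(RintegralD mO L1c); exact: L2_sqr.
    apply: (Rint_le mO (lA i)); first exact: (L1D mO L1c (L2_sqr (lD n i))).
    by move=> x _; exact: normr_le1_sqr.
  rewrite big_split /= sumr_const card_ord -/(gsqn (grad (phi n))).
  by have := phiK n; move: (gsqn _) => q; rewrite -[V *+ 3]mulr_natl; lra.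
have [s [ks cs]] := rellich_L1 oO tphi H1 H2 UF ooF OB.
have cau : cauchy_sqn leb3 Omega (fun k => phi (s k)).
  (* The sixth powers of differences integrate to at most 64 C; as A >= 1, this A gives A^-4 * 64 C
     <= A^-1 * 64 C <= e / 2. *)
  move=> e e0; pose A := 1 + 128 * C / e.
  have A0 : 0 < A by rewrite ltr_wpDr// divr_ge0 ?(ltW e0)// mulr_ge0.
  have A1 : 1 <= A by rewrite lerDl divr_ge0 ?(ltW e0)// mulr_ge0.
  have e2A : 0 < e / (2 * A) by rewrite divr_gt0// mulr_gt0.
  have [N HN] := cs _ e2A; exists N => m n Nm Nn.
  have ld1 : L1 (fun x => `|phi (s m) x - phi (s n) x|) by apply: L1_norm; exact: L1B.
  have mB : measurable_fun (Omega : set T3) (fun x => phi (s m) x - phi (s n) x).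
    by apply: L1_measurable; exact: L1B.
  have ld6 : L1 (fun x => (phi (s m) x - phi (s n) x) ^+ 6).
    apply: (@L1_le _ _ _ _ _ mO _ (fun x => 32 * (phi (s m) x ^+ 6 + phi (s n) x ^+ 6))).
    - exact: measurable_funX.
    - by apply: L1Z => //; exact: L1D.
    by move=> x _; rewrite ger0_norm ?exprn_even_ge0// pow6B_le.
  have d6 : \int[leb3]_(x in Omega) ((phi (s m) x - phi (s n) x) ^+ 6) <= 64 * C.
    apply: (@le_trans _ _ (\int[leb3]_(x in Omega) (32 * (phi (s m) x ^+ 6 + phi (s n) x ^+ 6)))).
      apply: (Rint_le mO ld6); first by apply: L1Z => //; exact: L1D.
      by move=> x _; exact: pow6B_le.
    rewrite (RintZ mO _ (L1D mO (l6 _) (l6 _))) (RintD mO (l6 _) (l6 _)).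
    move: (K6 (s m)) (K6 (s n)).
    by move: (Rintegral _ _ _) (Rintegral _ _ _) => p q; lra.
  apply: (@le_trans _ _ (\int[leb3]_(x in Omega) (A * `|phi (s m) x - phi (s n) x| +
      A^-1 ^+ 4 * (phi (s m) x - phi (s n) x) ^+ 6))).
    apply: (Rint_le mO); first by apply: L2_sqr; exact: L2B.
      exact: (L1D mO (L1Z mO _ ld1) (L1Z mO _ ld6)).
    by move=> x _; exact: le_mul_norm_pow6.
  rewrite (RintD mO (L1Z mO _ ld1) (L1Z mO _ ld6)) (RintZ mO _ ld1) (RintZ mO _ ld6).
  have p1 : A * \int[leb3]_(x in Omega) `|phi (s m) x - phi (s n) x| <= e / 2.
    rewrite mulrC -ler_pdivlMr//; apply: le_trans (HN m n Nm Nn) _.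
    by rewrite invfM mulrA.
  have p2 : A^-1 ^+ 4 * \int[leb3]_(x in Omega) ((phi (s m) x - phi (s n) x) ^+ 6) <= e / 2.
    apply: (@le_trans _ _ (A^-1 * (64 * C))).
      apply: ler_pM => //.
      - by rewrite exprn_even_ge0.
      - by apply: Rintegral_ge0 => x _; rewrite exprn_even_ge0.
      rewrite exprS ger_pMr ?invr_gt0// exprn_ile1// ?invr_ge0 ?(ltW A0)//.
      by rewrite invf_le1.
    rewrite mulrC ler_pdivrMr//; have -> : e / 2 * A = e / 2 + 64 * C.
      have AE (c : R) : e / 2 * (1 + 128 * c / e) = e / 2 + 64 * c.
        by field; rewrite gt_eqF.
      exact: AE.
    by rewrite lerDr divr_ge0// ltW.
  rewrite [leRHS]splitr; exact: lerD.
have [u [lu Hlim]] := L2_complete mO fO (fun k => lp (s k)) cau.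
exists s, u; split => //; apply/cvgrPdist_le => e e0.
have [N HN] := Hlim e e0; exists N => // n /= Nn.
by rewrite sub0r normrN ger0_norm ?sqn_ge0//; exact: HN.
Qed.



(** Each pair is first replaced by a test function within 1/(n + 1); [H0_relax] then provides the
    weak gradient of the L^2 limit. *)
Lemma H0_compact (u_ : nat -> R * R * R -> R) (g_ : nat -> 'I_3 -> R * R * R -> R) (K : R) :
  (forall n, H0 (u_ n) (g_ n)) -> (forall n, gsqn (g_ n) <= K) ->
  exists s u g, [/\ forall k, (k <= s k)%N, H0 u g &
    sqn (fun x => u_ (s k) x - u x) @[k --> \oo] --> (0 : R)].
Proof.
move=> Hu gK.
have e_ n : 0 < (n.+1%:R : R)^-1 by rewrite invr_gt0.
have /choice[phi Hphi] n : exists phi, [/\ test_function Omega phi,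
    sqn (fun x => u_ n x - phi x) <= n.+1%:R^-1 &
    gsqn (fun i x => g_ n i x - grad phi i x) <= n.+1%:R^-1].
  by have [_ _ /(_ _ (e_ n))[phi tp [p1 p2]]] := Hu n; exists phi.
have tphi n : test_function Omega (phi n) by case: (Hphi n).
have lg n i := H0_L2g oO i (Hu n); have lD n i := grad_L2 oO i (tphi n).
have phiK n : gsqn (grad (phi n)) <= 2 * K + 2.
  have -> : grad (phi n) = (fun i x => g_ n i x - (g_ n i x - grad (phi n) i x)).
    by apply/funext => i; apply/funext => x; ring.
  apply: le_trans (gsqnB_le oO _ _) _ => //; first by move=> i; exact: L2B.
  have [_ _ h1] := Hphi n; have h2 := gK n.
  have h3 : (n.+1%:R : R)^-1 <= 1 by rewrite invf_le1// ler1n.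
  apply: lerD; first by rewrite ler_wpM2l.
  by rewrite -[leRHS]mulr1 ler_wpM2l// (le_trans h1).
have [s [u [ks lu cu]]] := test_subsequence tphi phiK.
have [g Hg] : exists g, H0 u g.
  apply: (@H0_relax _ _ oO fO u (2 * K + 2)) => // e e0.
  have /cvgrPdist_le/(_ _ e0)[N _ /(_ N (leqnn N))] := cu.
  rewrite sub0r normrN ger0_norm ?sqn_ge0// => h.
  by exists (phi (s N)), (grad (phi (s N))); split => //; exact: H0_test.
exists s, u, g; split => //.
have lp n := test_L2 oO (tphi n).
apply: (@squeeze_cvgr _ _ _ _ (fun=> 0) (fun k => 2 * (s k).+1%:R^-1 +
   2 * sqn (fun x => phi (s k) x - u x))).
- apply: nearW => k; rewrite sqn_ge0 /=.
  have -> : (fun x => u_ (s k) x - u x) =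
      (fun x => (u_ (s k) x - phi (s k) x) + (phi (s k) x - u x)).
    by apply/funext => x; ring.
  apply: le_trans (sqnD_le mO _ _) _.
  - by apply: L2B => //; exact: H0_L2 (Hu _).
  - exact: L2B.
  by rewrite lerD2r ler_wpM2l//; case: (Hphi (s k)).
- exact: cvg_cst.
rewrite -[X in _ --> X]addr0; apply: cvgD; first exact: scaled_harmonic_cvg.
by rewrite -[X in _ --> X](mulr0 2); exact: cvgMr.
Qed.

End rellich_kondrachov.

(** * The energy *)

Section growth.
Context (R : realType).
Implicit Types a h t u w : R.

(** On a domain of finite measure the right-hand side is integrable for L^6 functions; the
    logarithmic integrands are all brought under such a bound. *)
Lemma mul_growth_le u w : (1 + u ^+ 2) * `|w| <= 4 * (1 + u ^+ 6 + w ^+ 6).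
Proof.
rewrite -(real_normK (num_real u)) (_ : u ^+ 6 = `|u| ^+ 6); last first.
  by rewrite -normrX ger0_norm// exprn_even_ge0.
rewrite (_ : w ^+ 6 = `|w| ^+ 6); last by rewrite -normrX ger0_norm// exprn_even_ge0.
move: (normr_ge0 u) (normr_ge0 w); move: `|u| `|w| => p q p0 q0.
have h1 : q <= 1 + q ^+ 6.
  by have := normr_le1_pow6 q; rewrite ger0_norm.
have h2 : 2 * (p ^+ 2 * q) <= (p ^+ 2) ^+ 2 + q ^+ 2.
  by have := sqr_ge0 (p ^+ 2 - q); rewrite sqrrB; lra.
have c0 (r : R) : 0 <= r -> r <= 1 + r ^+ 3.
  by move=> r0; have := sqr_ge0 (r - 1); rewrite sqrrB => s; nra.
have h3 : (p ^+ 2) ^+ 2 <= 1 + 2 * p ^+ 6.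
  have -> : p ^+ 6 = (p ^+ 2) ^+ 3 by rewrite -exprM.
  by move: (p ^+ 2) (sqr_ge0 p) => r r0; have := sqr_ge0 (r - 1); nra.
have h4 : q ^+ 2 <= 1 + q ^+ 6.
  have -> : q ^+ 6 = (q ^+ 2) ^+ 3 by rewrite -exprM.
  by apply: c0; exact: sqr_ge0.
have h5 : 0 <= p ^+ 6 by rewrite exprn_ge0.
have h6 : 0 <= q ^+ 6 by rewrite exprn_ge0.
by rewrite mulrDl mul1r; lra.
Qed.

Lemma normr_sqlog_le_pow6 u : `|sqlog u| <= 64 * (1 + 2 * u ^+ 6).
Proof.
apply: le_trans (normr_sqlog_le u) _; rewrite -mulrA.
have := mul_growth_le u u; lra.
Qed.

Lemma pow5M_le u w : `|u ^+ 5 * w| <= u ^+ 6 + w ^+ 6.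
Proof.
rewrite normrM normrX (_ : u ^+ 6 = `|u| ^+ 6); last first.
  by rewrite -normrX ger0_norm// exprn_even_ge0.
rewrite (_ : w ^+ 6 = `|w| ^+ 6); last by rewrite -normrX ger0_norm// exprn_even_ge0.
move: (normr_ge0 u) (normr_ge0 w); move: `|u| `|w| => p q p0 q0.
have P6 : 0 <= p ^+ 6 by rewrite exprn_ge0.
have Q6 : 0 <= q ^+ 6 by rewrite exprn_ge0.
have [qp|pq] := leP q p.
  apply: (@le_trans _ _ (p ^+ 6)); last by rewrite lerDl.
  by rewrite [leRHS]exprSr ler_wpM2l// exprn_ge0.
apply: (@le_trans _ _ (q ^+ 6)); last by rewrite lerDr.
by rewrite [leRHS]exprSr ler_wpM2r// lerXn2r// ltW.
Qed.

(** The growing Lipschitz factor, once squared, is controlled by sixth powers and receives the small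
    weight e; what remains is w^2, which vanishes in the L^2 limit. *)
Lemma sqlog_young e u w : 0 < e ->
  `|sqlog (w + u) - sqlog u| <= e * (1600 * (1 + u ^+ 6 + w ^+ 6)) + e^-1 * w ^+ 2.
Proof.
move=> e0; apply: le_trans (sqlog_lipschitz _ _) _; rewrite addrK.
set F := 16 * _; have F0 : 0 <= F.
  by rewrite /F; have := sqr_ge0 u; have := sqr_ge0 (w + u); lra.
have Y : F * `|w| <= e / 4 * F ^+ 2 + e^-1 * w ^+ 2.
  rewrite -(real_normK (num_real w)).
  have := mulr_ge0 (ltW e0) (sqr_ge0 (F / 2 - e^-1 * `|w|)).
  have -> : e * (F / 2 - e^-1 * `|w|) ^+ 2 = e / 4 * F ^+ 2 + e^-1 * `|w| ^+ 2 - F * `|w|.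
    by field; rewrite gt_eqF.
  lra.
apply: (le_trans Y); rewrite lerD2r -mulrA ler_wpM2l ?(ltW e0)//.
have FF : F <= 16 * (1 + 3 * u ^+ 2 + 2 * w ^+ 2).
  rewrite /F ler_wpM2l//; have := sqr_ge0 (w - u); rewrite sqrrB sqrrD; lra.
have : F ^+ 2 <= (16 * (1 + 3 * u ^+ 2 + 2 * w ^+ 2)) ^+ 2.
  by rewrite lerXn2r ?nnegrE//; have := sqr_ge0 u; have := sqr_ge0 w; lra.
move: (F ^+ 2) => G hG.
have cub (r : R) : 0 <= r -> r ^+ 2 <= 1 / 3 + 2 / 3 * r ^+ 3.
  move=> r0; have -> : 1 / 3 + 2 / 3 * r ^+ 3 = r ^+ 2 + (r - 1) ^+ 2 * (2 * r + 1) / 3 by field.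
  by rewrite lerDl divr_ge0// mulr_ge0 ?sqr_ge0//; lra.
have := cub _ (sqr_ge0 u); have := cub _ (sqr_ge0 w).
have -> : (u ^+ 2) ^+ 3 = u ^+ 6 by rewrite -exprM.
have -> : (w ^+ 2) ^+ 3 = w ^+ 6 by rewrite -exprM.
have u6 : 0 <= u ^+ 6 by rewrite exprn_even_ge0.
have w6 : 0 <= w ^+ 6 by rewrite exprn_even_ge0.
move: (u ^+ 2) (w ^+ 2) (u ^+ 6) (w ^+ 6) u6 w6 hG (sqr_ge0 u) (sqr_ge0 w).
move=> a c a3 c3 a30 c30 hG a0 c0 h1 h2.
have : (1 + 3 * a + 2 * c) ^+ 2 <= 3 * (1 + 9 * a ^+ 2 + 4 * c ^+ 2).
  have := sqr_ge0 (1 - 3 * a); have := sqr_ge0 (1 - 2 * c); have := sqr_ge0 (3 * a - 2 * c).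
  by rewrite !sqrrB; lra.
rewrite exprMn in hG; move: ((1 + _ + _) ^+ 2) (a ^+ 2) (c ^+ 2) hG h1 h2 => x y z; lra.
Qed.

Lemma sqlog_second_order a h t : `|t| <= 1 -> sqlog (a + t * h) <=
  sqlog a + t * (2 * (a * h * ln (a ^+ 2)) + 2 * (a * h)) +
  t ^+ 2 * (60 * (1 + a ^+ 6 + h ^+ 6)).
Proof.
move=> t1; apply: le_trans (sqlog_upper a (t * h)) _.
have -> : 2 * a * (ln (a ^+ 2) + 1) * (t * h) =
  t * (2 * (a * h * ln (a ^+ 2)) + 2 * (a * h)) by ring.
rewrite lerD2l exprMn -mulrA ler_wpM2l ?sqr_ge0//.
have th : `|t * h| <= `|h| by rewrite normrM ler_piMl.
have h1 : 4 + 2 * `|a| + 2 * `|a + t * h| <= 4 + 4 * `|a| + 2 * `|h|.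
  by have := ler_normD a (t * h); lra.
apply: (@le_trans _ _ (h ^+ 2 * (4 + 4 * `|a| + 2 * `|h|))).
  by rewrite ler_wpM2l ?sqr_ge0.
have k1 := mul_growth_le h a; have k2 := mul_growth_le h h.
have k3 := normr_ge0 a; have k4 := normr_ge0 h.
have k5 : 0 <= a ^+ 6 by rewrite exprn_even_ge0.
have k6 : 0 <= h ^+ 6 by rewrite exprn_even_ge0.
have k7 := mul_growth_le h 1; rewrite normr1 expr1n in k7.
move: (h ^+ 2) (a ^+ 6) (h ^+ 6) (`|a|) (`|h|) k1 k2 k3 k4 k5 k6 k7 => *; nra.
Qed.

End growth.

(** * Limits of the integrals in the energy *)

Section critical_integrals.
Context d (T : measurableType d) (R : realType).
Variables (mu : {measure set T -> \bar R}) (D : set T).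
Hypotheses (mD : measurable D) (fD : (mu D < +oo)%E).
Notation L1 := (L1 mu D).
Notation L2 := (L2 mu D).
Notation sqn := (L2_sqn mu D).
Notation ip := (L2_ip mu D).
Implicit Types u v w : T -> R.

Definition L6 u := measurable_fun D u /\ L1 (fun x => u x ^+ 6).

Let V : R := \int[mu]_(x in D) 1.

Lemma L1_growth (C : R) u w (F : T -> R) : L6 u -> L6 w -> measurable_fun D F ->
  (forall x, D x -> `|F x| <= C * (1 + u x ^+ 6 + w x ^+ 6)) -> L1 F.
Proof.
move=> [mu_ lu] [mw lw] mF FC; apply: (L1_le mD mF _ FC).
by apply: (L1Z mD); apply: (L1D mD _ lw); apply: (L1D mD _ lu); exact: L1_cst.
Qed.

Lemma Rint_growth (C : R) u w : L6 u -> L6 w ->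
  \int[mu]_(x in D) (C * (1 + u x ^+ 6 + w x ^+ 6)) =
  C * (V + \int[mu]_(x in D) (u x ^+ 6) + \int[mu]_(x in D) (w x ^+ 6)).
Proof.
move=> [_ lu] [_ lw]; have l1 : L1 (fun=> 1) by exact: L1_cst.
by rewrite (RintZ mD _ (L1D mD (L1D mD l1 lu) lw)) (RintD mD (L1D mD l1 lu) lw) (RintD mD l1 lu).
Qed.

Lemma L6_L2 u : L6 u -> L2 u.
Proof.
move=> lu; have [mu_ _] := lu; split => //.
apply: (@L1_growth 4 u u) => //; first exact: measurable_funX.
move=> x _; rewrite ger0_norm ?sqr_ge0//.
have := mul_growth_le (u x) 1; rewrite normr1 expr1n.
have : 0 <= u x ^+ 6 by rewrite exprn_even_ge0.
have h (r : R) : 0 <= r -> r <= 1 + r ^+ 3.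
  by move=> r0; have := sqr_ge0 (r - 1); rewrite sqrrB => s; nra.
have := h _ (sqr_ge0 (u x)); rewrite -exprM; lra.
Qed.

Lemma L6B u w : L6 u -> L6 w -> L6 (fun x => u x - w x).
Proof.
move=> lu lw; have [mu_ _] := lu; have [mw _] := lw.
have mB : measurable_fun D (fun x => u x - w x) by exact: measurable_funB.
split => //; apply: (@L1_growth 32 u w) => //; first exact: measurable_funX.
move=> x _; rewrite ger0_norm ?exprn_even_ge0//.
have := pow6B_le (u x) (w x); lra.
Qed.

Lemma measurable_sqlog u : measurable_fun D u -> measurable_fun D (fun x => sqlog (u x)).
Proof.
move=> mu_; apply: measurable_funM; first exact: measurable_funX.
by apply: measurableT_comp => //; exact: measurable_funX.
Qed.

Lemma L1_sqlog u : L6 u -> L1 (fun x => sqlog (u x)).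
Proof.
move=> lu; have [mu_ _] := lu.
apply: (@L1_growth 64 u u) => //; first exact: measurable_sqlog.
by move=> x _; have := normr_sqlog_le_pow6 (u x); lra.
Qed.

Lemma L1_mul_pow5 u w : L6 u -> L6 w -> L1 (fun x => u x ^+ 5 * w x).
Proof.
move=> lu lw; have [mu_ _] := lu; have [mw _] := lw.
apply: (@L1_growth 1 u w) => //.
  by apply: measurable_funM => //; exact: measurable_funX.
by move=> x _; have := pow5M_le (u x) (w x); lra.
Qed.

Lemma L1_mul_ln u w : L6 u -> L6 w -> L1 (fun x => u x * w x * ln (u x ^+ 2)).
Proof.
move=> lu lw; have [mu_ _] := lu; have [mw _] := lw.
apply: (@L1_growth 8 u w) => //.
  apply: measurable_funM; first exact: measurable_funM.
  by apply: measurableT_comp => //; exact: measurable_funX.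
move=> x _; rewrite mulrAC normrM.
apply: (@le_trans _ _ (2 * (1 + u x ^+ 2) * `|w x|)).
  by rewrite ler_wpM2r// normr_mul_ln_sqr_le.
by have := mul_growth_le (u x) (w x); lra.
Qed.

Section limits.
Variables (v_ : nat -> T -> R) (u : T -> R) (K : R).
Hypotheses (lv : forall n, L6 (v_ n)) (lu : L6 u)
  (vK : forall n, \int[mu]_(x in D) (v_ n x ^+ 6) <= K)
  (cv : sqn (fun x => v_ n x - u x) @[n --> \oo] --> (0 : R)).

Let w n x := v_ n x - u x.
Let lw n : L6 (w n). Proof. exact: L6B. Qed.
Let U6 := \int[mu]_(x in D) (u x ^+ 6).
Let W : R := 32 * (K + U6).

Let wK n : \int[mu]_(x in D) (w n x ^+ 6) <= W.
Proof.
have [_ l1] := lv n; have [_ l2] := lu; have [_ l3] := lw n.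
apply: (@le_trans _ _ (\int[mu]_(x in D) (32 * (v_ n x ^+ 6 + u x ^+ 6)))).
  apply: (Rint_le mD l3); first exact: (L1Z mD _ (L1D mD l1 l2)).
  by move=> x _; exact: pow6B_le.
rewrite (RintZ mD _ (L1D mD l1 l2)) (RintD mD l1 l2) /W -/U6.
by rewrite ler_wpM2l// lerD2r.
Qed.

Lemma sqn_cvg : sqn (v_ n) - sqn u @[n --> \oo] --> (0 : R).
Proof.
apply: (@cvg0_of_le _ _ (2 * sqn u)) => e e0.
exists (fun n => (1 + 2 * e^-1) * sqn (w n)).
  by rewrite -[X in _ --> X](mulr0 (1 + 2 * e^-1)); exact: cvgMr.
move=> n; have l1 := L6_L2 (lw n); have l2 := L6_L2 lu.
have -> : sqn (v_ n) = sqn (w n) + 2 * ip (w n) u + sqn u.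
  rewrite -(sqnD mD l1 l2); congr L2_sqn.
  by apply/funext => x; rewrite /w subrK.
rewrite addrK; apply: le_trans (ler_normD _ _) _.
rewrite (ger0_norm (sqn_ge0 _ _ _)) normrM (ger0_norm (_ : 0 <= 2))//.
have := normr_ip_le mD l1 l2; have ei : 0 < e^-1 by rewrite invr_gt0.
have s1 := sqn_ge0 mu D (w n); have s2 := sqn_ge0 mu D u.
have : Num.sqrt (sqn (w n)) * Num.sqrt (sqn u) <= e^-1 * sqn (w n) + e * sqn u.
  rewrite -{2}(sqr_sqrtr s1) -{2}(sqr_sqrtr s2).
  move: (Num.sqrt _) (Num.sqrt _) (sqrtr_ge0 (sqn (w n))) (sqrtr_ge0 (sqn u)) => q p q0 p0.
  have := mulr_ge0 (ltW e0) (sqr_ge0 (q - e^-1 * p)).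
  have -> : e * (q - e^-1 * p) ^+ 2 = e * q ^+ 2 - 2 * (p * q) + e^-1 * p ^+ 2.
    by field; rewrite gt_eqF.
  by have := mulr_ge0 p0 q0; lra.
move=> h1 h2; have := le_trans h2 h1; clear h1 h2.
move: (`|ip _ _|) (sqn (w n)) (sqn u) => r s t; lra.
Qed.

Lemma Rint_sqlog_cvg : \int[mu]_(x in D) sqlog (v_ n x) - \int[mu]_(x in D) sqlog (u x)
  @[n --> \oo] --> (0 : R).
Proof.
apply: (@cvg0_of_le _ _ (1600 * (V + U6 + W))) => e e0.
exists (fun n => e^-1 * sqn (w n)).
  by rewrite -[X in _ --> X](mulr0 e^-1); exact: cvgMr.
move=> n; have [_ l1] := lu; have [_ l2] := lw n; have l3 := L6_L2 (lw n).
rewrite -RintegralB//; [|exact: L1_sqlog|exact: L1_sqlog].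
have lG : L1 (fun x => 1600 * (1 + u x ^+ 6 + w n x ^+ 6)).
  by apply: (L1Z mD); apply: (L1D mD _ l2); apply: (L1D mD _ l1); exact: L1_cst.
have lH := L1Z mD e^-1 (L2_sqr l3).
apply: (@le_trans _ _ (\int[mu]_(x in D) (e * (1600 * (1 + u x ^+ 6 + w n x ^+ 6)) +
    e^-1 * w n x ^+ 2))).
  apply: (Rint_norm_le mD).
  - by apply: L1B => //; exact: L1_sqlog.
  - exact: (L1D mD (L1Z mD e lG) lH).
  by move=> x _; have := sqlog_young (u x) (w n x) e0; rewrite subrK.
rewrite (RintD mD (L1Z mD e lG) lH) (RintZ mD _ lG) (RintZ mD _ (L2_sqr l3)).
rewrite lerD2r (Rint_growth _ lu (lw n)); apply: (ler_wpM2l (ltW e0)).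
have h0 : (0 : R) <= 1600 by exact: ler0n.
by apply: (ler_wpM2l h0); rewrite lerD2l; exact: wK.
Qed.

Lemma measurable_tail (M : R) : measurable_fun D u ->
  measurable_fun D (fun x => if `|u x| <= M then 0 else u x ^+ 6).
Proof.
move=> mu_; apply: measurable_fun_if => //.
- by apply: measurable_fun_ler => //; exact: measurableT_comp.
- by apply: measurable_funS (measurable_funX 6 mu_) => //; exact: subIsetl.
Qed.

Lemma tail_cvg : \int[mu]_(x in D) (if `|u x| <= n%:R then 0 else u x ^+ 6)
  @[n --> \oo] --> (0 : R).
Proof.
have [mu_ l6] := lu.
rewrite [X in _ --> X](_ : 0 = \int[mu]_(x in D) (fun=> 0) x); last first.
  by rewrite Rintegral_cst// mul0r.
apply: (@Rint_dominated_cvg _ _ _ _ _ mD _ _ (fun x => u x ^+ 6)) => //.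
- by move=> n; exact: measurable_tail.
- move=> x _; apply: cvg_near_cst.
  have [N HN] : exists N : nat, `|u x| <= N%:R.
    by exists (Num.truncn `|u x|).+1; rewrite ltW// truncnS_gt.
  by exists N => // n /= Nn; rewrite (le_trans HN)// ler_nat.
by move=> n x _; case: ifP => _; rewrite ?normr0 ?ger0_norm ?exprn_even_ge0.
Qed.

(** [pow6_splitting] is integrated for w_n = v_n - u: the part weighted by e is controlled by the
    L^6 bound on w_n, the tail of u by dominated convergence, and the quadratic part by convergence
    in L^2. *)
Lemma brezis_lieb : \int[mu]_(x in D) (v_ n x ^+ 6) - \int[mu]_(x in D) (w n x ^+ 6) - U6
  @[n --> \oo] --> (0 : R).
Proof.
have [mu_ l6] := lu.
apply: (@cvg0_of_le _ _ (V + W + 1)) => e e0.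
have [C1 C10 HC1] := pow6_splitting e0.
(* C1 is known before the cutoff N, so the tail can be required to cost at most e after
   multiplication by C1. *)
have d0 : 0 < e / (C1 + 1) by rewrite divr_gt0// ltr_wpDl.
have /cvgrPdist_le/(_ _ d0)[N _ /(_ N (leqnn N))] := tail_cvg.
rewrite sub0r normrN => tN.
have [C2 C20 HC2] := HC1 N%:R (ler0n _ _).
exists (fun n => C2 * sqn (w n)).
  by rewrite -[X in _ --> X](mulr0 C2); exact: cvgMr.
move=> n; have [mw l6w] := lw n; have [_ l6v] := lv n; have l2 := L2_sqr (L6_L2 (lw n)).
pose h x := if `|u x| <= N%:R then 0 else u x ^+ 6 : R.
have lh : L1 h.
  apply: (L1_le mD _ l6).
    exact: measurable_tail.
  by move=> x _; rewrite /h; case: ifP => _; rewrite ?normr0 ?ger0_norm ?exprn_even_ge0.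
have l1 : L1 (fun=> 1) by exact: L1_cst.
have lA := L1Z mD e (L1D mD l1 l6w).
rewrite -RintegralB// -RintegralB//; last exact: (L1B mD l6v l6w).
apply: (@le_trans _ _ (\int[mu]_(x in D) (e * (1 + w n x ^+ 6) + C1 * h x + C2 * w n x ^+ 2))).
  apply: (Rint_norm_le mD).
  - exact: (L1B mD (L1B mD l6v l6w) l6).
  - exact: (L1D mD (L1D mD lA (L1Z mD C1 lh)) (L1Z mD C2 l2)).
  by move=> x _; have := HC2 (w n x) (u x); rewrite subrK.
rewrite (RintD mD (L1D mD lA (L1Z mD C1 lh)) (L1Z mD C2 l2)) (RintD mD lA (L1Z mD C1 lh)).
rewrite (RintZ mD _ (L1D mD l1 l6w)) (RintZ mD _ lh) (RintZ mD _ l2) (RintD mD l1 l6w).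
have -> : e * (V + W + 1) = e * (V + W) + e by ring.
rewrite lerD2r; apply: lerD.
  by rewrite ler_wpM2l ?(ltW e0)// lerD2l; exact: wK.
apply: le_trans (ler_wpM2l C10 (le_trans (ler_norm _) tN)) _.
rewrite mulrA ler_pdivrMr ?ltr_wpDl// mulrC ler_wpM2l ?(ltW e0)//; lra.
Qed.

End limits.

End critical_integrals.

(** * The critical squared gradient norm *)

Section thresholds.
Context (R : realType).
Implicit Types b S s e : R.

Lemma le_of_small x c C e1 : 0 < e1 -> 0 <= C ->
  (forall e, 0 < e -> e <= e1 -> x <= c + e * C) -> x <= c :> R.
Proof.
move=> e10 C0 H; rewrite leNgt; apply/negP => cx.
have C1 : 0 < C + 1 by rewrite ltr_wpDl.
have d0 : 0 < (x - c) / (2 * (C + 1)) by rewrite divr_gt0 ?subr_gt0// mulr_gt0.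
pose e := Num.min e1 ((x - c) / (2 * (C + 1))).
have e0 : 0 < e by rewrite lt_min e10.
have := H e e0 ltac:(by rewrite ge_min lexx).
have eC : e * (C + 1) <= (x - c) / 2.
  have : e <= (x - c) / (2 * (C + 1)) by rewrite ge_min lexx orbT.
  by rewrite invfM mulrA ler_pdivlMr.
by have := mulr_ge0 (ltW e0) C0; lra.
Qed.

Lemma cvg0_norm_le (x : nat -> R) e : x n @[n --> \oo] --> (0 : R) -> 0 < e ->
  \forall n \near \oo, `|x n| <= e.
Proof.
move=> /cvgrPdist_le/(_ e)/[apply]; apply: filterS => n.
by rewrite sub0r normrN.
Qed.

(* The maximum point of s/2 + b s^2/4 - s^3/(6 S^3), the lower bound of the
   energy at squared gradient norm s, up to the volume term. *)
Definition threshold b S : R :=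
  (b * S ^+ 3 + Num.sqrt (b ^+ 2 * S ^+ 6 + 4 * S ^+ 3)) / 2.

(** This says that the derivative 1/2 + b s/2 - s^2/(2 S^3) vanishes at the threshold; the equation
    reduces higher powers of the threshold to lower ones. *)
Lemma threshold_sqr b S : 0 < S ->
  threshold b S ^+ 2 = S ^+ 3 * (b * threshold b S + 1).
Proof.
move=> S0; rewrite /threshold; have q0 : 0 <= b ^+ 2 * S ^+ 6 + 4 * S ^+ 3.
  apply: addr_ge0; first by apply: mulr_ge0; [exact: sqr_ge0|apply: exprn_ge0; exact: ltW].
  by apply: mulr_ge0 => //; apply: exprn_ge0; exact: ltW.
have := sqr_sqrtr q0; move: (Num.sqrt _) => r.
have -> : S ^+ 6 = (S ^+ 3) ^+ 2 by rewrite -exprM.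
move: (S ^+ 3) => T h.
have -> : ((b * T + r) / 2) ^+ 2 = (b ^+ 2 * T ^+ 2 + 2 * b * T * r + r ^+ 2) / 4 by field.
by rewrite h; field.
Qed.

Lemma threshold_gt0 b S : 0 < b -> 0 < S -> 0 < threshold b S.
Proof.
move=> b0 S0; rewrite divr_gt0// ltr_pwDl ?sqrtr_ge0//.
by rewrite mulr_gt0// exprn_gt0.
Qed.

(** The origin of the first two terms of the assumption: they are the height of the energy barrier
    before the volume term is added. *)
Lemma threshold_value b S : 0 < S -> let s := threshold b S in
  s / 2 + b / 4 * s ^+ 2 - s ^+ 3 / (6 * S ^+ 3) =
  b * S ^+ 3 / 12 + (4 + b ^+ 2 * S ^+ 3)
        * (b * S ^+ 3 + Num.sqrt (b ^+ 2 * S ^+ 6 + 4 * S ^+ 3)) / 24.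
Proof.
move=> S0 s; have -> : b * S ^+ 3 + Num.sqrt (b ^+ 2 * S ^+ 6 + 4 * S ^+ 3) = 2 * s.
  by rewrite /s /threshold [RHS]mulrC divfK.
have := threshold_sqr b S0; rewrite -/s; have : S ^+ 3 != 0 by rewrite expf_eq0 gt_eqF.
move: (S ^+ 3) => T T0 s2.
have -> : s ^+ 3 / (6 * T) = (b * s ^+ 2 + s) / 6.
  by rewrite exprS [in LHS]s2; field; rewrite T0.
by rewrite s2; field.
Qed.

(** The claim amounts to t^2 <= T (3 + 3 b t / 2), whereas s satisfies s^2 = T (1 + b s), so there
    is room beyond s. The margin 11/10 absorbs the cross term of the splitting, which is small but
    not zero at a finite index. *)
Lemma cubic_le b T s t : 0 <= b -> 0 < T -> 0 < s -> s ^+ 2 = T * (b * s + 1) ->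
  0 <= t -> t <= 11 / 10 * s -> t ^+ 3 / (6 * T) <= t / 2 + b / 4 * t ^+ 2.
Proof.
move=> b0 T0 s0 s2 t0 ts.
rewrite ler_pdivrMr ?mulr_gt0// exprS.
have -> : (t / 2 + b / 4 * t ^+ 2) * (6 * T) = t * (T * (3 + 3 / 2 * b * t)) by field.
rewrite ler_wpM2l// -(ler_pM2r s0).
have h1 : t ^+ 2 * s <= 11 / 10 * (t * s ^+ 2).
  have := mulr_ge0 (mulr_ge0 t0 (ltW s0)) (_ : 0 <= 11 / 10 * s - t); rewrite subr_ge0 => /(_ ts).
  lra.
apply: (le_trans h1); rewrite s2.
have h2 : 0 <= T * b * t * s by rewrite !mulr_ge0// ltW.
have h3 : T * t <= T * (11 / 10 * s) by rewrite ler_wpM2l// ltW.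
have h4 : 0 <= T * s by rewrite mulr_ge0// ltW.
lra.
Qed.

(** Here a and t are the squared gradient norms of the limit and of the difference, p is their inner
    product and w the integral of the sixth power of the difference. The product 2ta in the square
    is nonnegative and is discarded; e <= s0 / 20 keeps t below 11/10 s0, where [cubic_le] pays for
    w. *)
Lemma kirchhoff_splitting b T s0 (a t p w e : R) : 0 <= b -> 0 < T -> 0 < s0 ->
  s0 ^+ 2 = T * (b * s0 + 1) -> 0 <= a -> 0 <= t -> `|p| <= e -> e <= s0 / 20 ->
  t + 2 * p + a <= s0 -> T * w <= t ^+ 3 ->
  a / 2 + b / 4 * a ^+ 2 + w / 6 <= (t + 2 * p + a) / 2 + b / 4 * (t + 2 * p + a) ^+ 2 +
    e * (1 + 5 / 2 * b * s0).
Proof.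
move=> b0 T0 s00 s2 a0 t0; rewrite ler_norml => /andP[p1 p2] es ts tw.
have e0 : 0 <= e by lra.
have t1 : t <= 11 / 10 * s0 by lra.
have hw : w / 6 <= t / 2 + b / 4 * t ^+ 2.
  apply: le_trans (cubic_le b0 T0 s00 s2 t0 t1).
  by rewrite ler_pdivlMr ?mulr_gt0//; have -> : w / 6 * (6 * T) = T * w by field.
have q : t ^+ 2 + a ^+ 2 <= (t + 2 * p + a) ^+ 2 + 10 * e * s0.
  have h1 : 0 <= (p + e) * (t + a) by apply: mulr_ge0; lra.
  have h2 : 0 <= e * (11 / 10 * s0 - t - a) by apply: mulr_ge0; lra.
  have h3 := mulr_ge0 t0 a0; have h4 := sqr_ge0 p; have h5 := mulr_ge0 e0 (ltW s00).
  have -> : (t + 2 * p + a) ^+ 2 = t ^+ 2 + a ^+ 2 + 2 * (t * a) + 4 * p ^+ 2 +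
    4 * ((p + e) * (t + a)) + 4 * (e * (11 / 10 * s0 - t - a)) - 22 / 5 * (e * s0) by field.
  lra.
have := ler_wpM2l (divr_ge0 b0 (ler0n _ 4)) q.
rewrite !mulrDr; have -> : b / 4 * (10 * e * s0) = e * (5 / 2 * b * s0) by field.
lra.
Qed.

End thresholds.

(** * Lower bounds and lower semicontinuity of the energy *)

Section functional.
Context (R : realType) (Omega : set (R * R * R)) (b lambda mu : R).
Notation T3 := (measurableTypeR R * measurableTypeR R * measurableTypeR R)%type.
Hypotheses (oO : open Omega) (bO : bounded_set Omega)
  (S0 : 0 < sobolev_constant Omega) (b0 : 0 < b) (mu0 : mu < 0).
Let mO : measurable (Omega : set T3). Proof. exact: open_measurable3. Qed.
Let fO : (leb3 Omega < +oo)%E. Proof. exact: bounded_leb3_lty. Qed.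
Notation L1 := (L1 leb3 Omega).
Notation L2 := (L2 leb3 Omega).
Notation L6 := (L6 leb3 Omega).
Notation sqn := (L2_sqn leb3 Omega).
Notation ip := (L2_ip leb3 Omega).
Notation gsqn := (grad_sqn Omega).
Notation gip := (grad_ip Omega).
Notation H0 := (H0 Omega).
Implicit Types u v phi : R * R * R -> R.
Implicit Types g h : 'I_3 -> R * R * R -> R.

(** The energy with the gradient as a separate argument, hence independent of the representatives
    chosen by [wpartial]; [energyE] makes the link. *)
Definition functional u g : R :=
  gsqn g / 2 + b / 4 * gsqn g ^+ 2 - (lambda - mu) / 2 * sqn u
  - mu / 2 * \int[leb3]_(x in Omega) sqlog (u x)
  - 1 / 6 * \int[leb3]_(x in Omega) (u x ^+ 6).
Notation J := functional.
Let S := sobolev_constant Omega.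
Let s0 := threshold b S.
Let s00 : 0 < s0. Proof. exact: threshold_gt0. Qed.
Let S30 : 0 < S ^+ 3. Proof. exact: exprn_gt0. Qed.
Let s0_sqr : s0 ^+ 2 = S ^+ 3 * (b * s0 + 1). Proof. exact: threshold_sqr. Qed.

Lemma H0_L6 u g : H0 u g -> L6 u.
Proof.
move=> Hu; have [lu _] := sobolev_inequality oO fO S0 Hu; split => //.
exact: L2_measurable (H0_L2 Hu).
Qed.

Lemma energyE u g : H0 u g -> energy Omega b lambda mu u = J u g.
Proof.
move=> Hu; have [lu wu _] := Hu; have [_ l6] := H0_L6 Hu.
have n4 : norm_H01 Omega u ^+ 4 = (norm_H01 Omega u ^+ 2) ^+ 2 by rewrite -exprM.
rewrite /energy n4.
rewrite (norm_H01_sqr oO fO wu) (norm_Lp_even mO (n := 2) isT isT (L2_sqr lu)).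
rewrite (norm_Lp_even mO (n := 6) isT isT l6) /J.
rewrite -/(sqn u) /sqlog; move: (Rintegral _ _ _) (Rintegral _ _ _) (gsqn g) (sqn u).
by move=> x y z t; field.
Qed.

Lemma volumeE : volume Omega = \int[leb3]_(x in Omega) 1.
Proof. by rewrite Rintegral_cst// mul1r. Qed.

(** The coefficient -mu/2 is nonnegative, so [sqlog_lower] can be integrated. L solves (L + 1) mu =
    mu - lambda, which cancels the L^2 term of the energy and leaves only the volume. *)
Lemma functional_lower u g : H0 u g ->
  gsqn g / 2 + b / 4 * gsqn g ^+ 2 - gsqn g ^+ 3 / (6 * S ^+ 3)
    + mu / 2 * expR (- (lambda / mu)) * volume Omega <= J u g.
Proof.
move=> Hu; have [lu wu _] := Hu; have l6 := H0_L6 Hu.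
have [_ hS] := sobolev_inequality oO fO S0 Hu.
pose L := - (lambda / mu).
have hL : (L + 1) * sqn u - expR L * volume Omega <=
    \int[leb3]_(x in Omega) sqlog (u x).
  have l1 : L1 (fun=> 1) by exact: L1_cst.
  have lZ := L1Z mO (L + 1) (L2_sqr lu); have lC := L1Z mO (- expR L) l1.
  rewrite volumeE -(RintZ mO (L + 1) (L2_sqr lu)) -mulNr -(RintZ mO (- expR L) l1).
  rewrite -(RintD mO lZ lC); apply: (Rint_le mO).
  - exact: (L1D mO lZ lC).
  - exact: (L1_sqlog mO fO l6).
  by move=> x _; have := sqlog_lower (u x) L; rewrite mulr1; lra.
have m2 : 0 <= - (mu / 2) by rewrite oppr_ge0 pmulr_lle0// ltW.
have := ler_wpM2l m2 hL.
have h6 : \int[leb3]_(x in Omega) (u x ^+ 6) / 6 <= gsqn g ^+ 3 / (6 * S ^+ 3).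
  rewrite ler_pdivlMr ?mulr_gt0//; move: hS; rewrite -/S.
  by move: (Rintegral _ _ _) (S ^+ 3) => i T hS; have -> : i / 6 * (6 * T) = T * i by field.
rewrite /J; move: h6; move: (_ / (6 * S ^+ 3)) => y.
move: (Rintegral _ _ _) (Rintegral _ _ _) (sqn u) (expR _) (volume _) => i6 il q E V h6.
have -> : - (mu / 2) * ((L + 1) * q - E * V) = (lambda - mu) / 2 * q + mu / 2 * E * V.
  by rewrite /L; field; rewrite lt_eqF.
move: (gsqn g) => s; lra.
Qed.

Lemma functional_bounded_below u g : H0 u g -> gsqn g <= s0 ->
  - (s0 ^+ 3 / (6 * S ^+ 3)) + mu / 2 * expR (- (lambda / mu)) * volume Omega <= J u g.
Proof.
move=> Hu gs; apply: le_trans (functional_lower Hu); rewrite lerD2r.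
have g0 := gsqn_ge0 Omega g.
have : gsqn g ^+ 3 / (6 * S ^+ 3) <= s0 ^+ 3 / (6 * S ^+ 3).
  have T0 : 0 <= (6 * S ^+ 3)^-1 by rewrite invr_ge0; apply: mulr_ge0 => //; exact: ltW.
  by apply: (ler_wpM2r T0); rewrite lerXn2r// ?nnegrE// ltW.
have h2 : 0 <= b / 4 * gsqn g ^+ 2.
  exact: (mulr_ge0 (divr_ge0 (ltW b0) (ler0n _ 4)) (sqr_ge0 (gsqn g))).
move: (gsqn g) g0 h2 => s g0 h2 h3; move: (s ^+ 3 / _) (s0 ^+ 3 / _) (b / 4 * s ^+ 2) h2 h3.
by move=> p q r; lra.
Qed.

(** One index n is taken at which all five errors are at most e; the two claims then hold up to
    multiples of e by [kirchhoff_splitting] and linear arithmetic, and e is arbitrary. *)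
Lemma functional_lsc (v_ : nat -> R * R * R -> R) (g_ : nat -> 'I_3 -> R * R * R -> R)
    u g (y : nat -> R) (c : R) :
  (forall n, H0 (v_ n) (g_ n)) -> (forall n, gsqn (g_ n) <= s0) -> H0 u g ->
  sqn (fun x => v_ n x - u x) @[n --> \oo] --> (0 : R) ->
  (forall n, J (v_ n) (g_ n) <= c + y n) -> y n @[n --> \oo] --> (0 : R) ->
  gsqn g <= s0 /\ J u g <= c.
Proof.
move=> Hv gs Hu cv Jc y0.
have lv n := H0_L6 (Hv n); have lu := H0_L6 Hu.
have K6 n := sobolev_pow6_bound oO bO S0 (Hv n) (gs n).
have lg_ n i : L2 (g_ n i) by exact: H0_L2g (Hv n).
have lg i : L2 (g i) by exact: H0_L2g Hu.
have lw n i : L2 (fun x => g_ n i x - g i x) by exact: L2B.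
have c1 := weak_gradient_cvg oO Hv Hu gs cv Hu.
have c2 := sqn_cvg mO fO lv lu cv.
have c3 := Rint_sqlog_cvg mO fO lv lu K6 cv.
have c4 := brezis_lieb mO fO lv lu K6 cv.
(* The weights of the errors in order: the excess y over c, the gradient splitting, the L^2 norm,
   the logarithmic integral and the Brezis-Lieb defect. *)
pose C := 1 + (1 + 5 / 2 * b * s0) + `|lambda - mu| / 2 + `|mu| / 2 + 1 / 6.
have C0 : 0 <= C.
  rewrite /C; have h1 := mulr_ge0 (ltW b0) (ltW s00); have h2 := normr_ge0 (lambda - mu).
  have := normr_ge0 mu; lra.
suff key e : 0 < e -> e <= s0 / 20 -> gsqn g <= s0 + e * 2 /\ J u g <= c + e * C.
  have s20 := divr_gt0 s00 (ltr0Sn _ 19).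
  split; first by apply: (le_of_small s20 (ler0n _ 2)) => e e0 /(key e e0)[].
  by apply: (le_of_small s20 C0) => e e0 /(key e e0)[].
move=> e0 es.
have [n [[[[n1 n2] n3] n4] n5]] := filter_ex (filterI (filterI (filterI (filterI
  (cvg0_norm_le c1 e0) (cvg0_norm_le c2 e0)) (cvg0_norm_le c3 e0))
  (cvg0_norm_le c4 e0)) (cvg0_norm_le y0 e0)).
have sE : gsqn (g_ n) = gsqn (fun i x => g_ n i x - g i x) +
    2 * gip (fun i x => g_ n i x - g i x) g + gsqn g.
  rewrite -(gsqnD oO (lw n) lg); congr grad_sqn.
  by apply/funext => i; apply/funext => x; rewrite subrK.
have [_ hS] := sobolev_inequality oO fO S0 (H0B oO (Hv n) Hu).
have t0 := gsqn_ge0 Omega (fun i x => g_ n i x - g i x).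
have a0 := gsqn_ge0 Omega g; have := gs n; rewrite sE => tpa.
have := kirchhoff_splitting (ltW b0) S30 s00 s0_sqr a0 t0 n1 es tpa hS.
have := Jc n; rewrite /J sE.
have small (k d : R) : `|d| <= e -> k * d <= `|k| * e.
  move=> de; apply: le_trans (ler_norm _) _; rewrite normrM; exact: ler_wpM2l.
move: n1 (small (lambda - mu) _ n2) (small mu _ n3) n4 n5 tpa t0.
rewrite !ler_norml /C.
move: (gsqn (fun _ _ => _)) (gip _ _) (gsqn g) => t p a.
move: (\int[leb3]_(x in Omega) ((v_ n x - u x) ^+ 6)) (\int[leb3]_(x in Omega) (v_ n x ^+ 6)).
move: (\int[leb3]_(x in Omega) (u x ^+ 6)) (\int[leb3]_(x in Omega) sqlog (v_ n x)).
move: (\int[leb3]_(x in Omega) sqlog (u x)) (sqn (v_ n)) (sqn u) (`|lambda - mu|) (`|mu|) (y n).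
move=> lu' qv qu l m yn i6 lv' w6 v6 /andP[n1 n1'] h2 h3 /andP[n4 n4'] /andP[n5 n5'] tpa t0.
move=> hJ hK; split; first by lra.
lra.
Qed.

End functional.

(** * Existence of an interior minimizer of negative energy *)

Section minimization.
Context (R : realType) (Omega : set (R * R * R)) (b lambda mu : R).
Notation T3 := (measurableTypeR R * measurableTypeR R * measurableTypeR R)%type.
Hypotheses (oO : open Omega) (bO : bounded_set Omega)
  (S0 : 0 < sobolev_constant Omega) (b0 : 0 < b) (mu0 : mu < 0).
Let mO : measurable (Omega : set T3). Proof. exact: open_measurable3. Qed.
Let fO : (leb3 Omega < +oo)%E. Proof. exact: bounded_leb3_lty. Qed.
Notation L1 := (L1 leb3 Omega).
Notation L2 := (L2 leb3 Omega).
Notation L6 := (L6 leb3 Omega).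
Notation sqn := (L2_sqn leb3 Omega).
Notation ip := (L2_ip leb3 Omega).
Notation gsqn := (grad_sqn Omega).
Notation gip := (grad_ip Omega).
Notation H0 := (H0 Omega).
Notation J := (functional Omega b lambda mu).
Implicit Types u v phi : R * R * R -> R.
Implicit Types g h : 'I_3 -> R * R * R -> R.
Let S := sobolev_constant Omega.
Let s0 := threshold b S.
Let s00 : 0 < s0. Proof. exact: threshold_gt0. Qed.

Lemma sqn_gt0 u : L2 u -> ~ {ae leb3, forall x, Omega x -> u x = 0} -> 0 < sqn u.
Proof.
move=> [mu_ lu] nu; rewrite lt_def sqn_ge0 andbT; apply/eqP => q0; apply: nu.
have mS : measurable_fun (Omega : set T3) (fun x => (u x ^+ 2)%:E).
  by apply/measurable_EFinP; exact: measurable_funX.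
have /(ae_eq_integral_abs leb3 mO mS) : (\int[leb3]_(x in Omega) `|(u x ^+ 2)%:E| = 0)%E.
  under eq_integral => x _ do rewrite gee0_abs ?lee_fin ?sqr_ge0//.
  by rewrite -EFin_Rint// -/(sqn u) q0.
apply: ae_imp => x /[apply] /= -[] /eqP; by rewrite sqrf_eq0 => /eqP.
Qed.

Lemma functionalZ t u g : H0 u g -> t != 0 ->
  J (fun x => t * u x) (fun i x => t * g i x) =
  t ^+ 2 * gsqn g / 2 + b / 4 * (t ^+ 2 * gsqn g) ^+ 2
  - (lambda - mu) / 2 * (t ^+ 2 * sqn u)
  - mu / 2 * (t ^+ 2 * \int[leb3]_(x in Omega) sqlog (u x) + t ^+ 2 * ln (t ^+ 2) * sqn u)
  - 1 / 6 * (t ^+ 6 * \int[leb3]_(x in Omega) (u x ^+ 6)).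
Proof.
move=> Hu t0; have l6 := H0_L6 oO bO S0 Hu; have [_ l6'] := l6.
have lL := L1_sqlog mO fO l6; have l2 := L2_sqr (H0_L2 Hu).
rewrite /functional (gsqnZ oO) ?(sqnZ mO t (H0_L2 Hu))//; last first.
  by move=> i; exact: H0_L2g Hu.
have -> : \int[leb3]_(x in Omega) sqlog (t * u x) =
    t ^+ 2 * \int[leb3]_(x in Omega) sqlog (u x) + t ^+ 2 * ln (t ^+ 2) * sqn u.
  rewrite -(RintZ mO _ lL) -(RintZ mO _ l2) -(RintD mO (L1Z mO _ lL) (L1Z mO _ l2)).
  by apply: eq_Rintegral => x _; rewrite sqlogM.
congr (_ - _ * _); rewrite -(RintZ mO _ l6').
by apply: eq_Rintegral => x _; rewrite exprMn.
Qed.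

Lemma functional_negative : exists u g, [/\ H0 u g, gsqn g <= s0 & J u g < 0].
Proof.
have [w [h [Hw nw]]] := sobolev_constant_nontrivial oO fO S0.
have q0 := sqn_gt0 (H0_L2 Hw) nw; have G0 := gsqn_ge0 Omega h.
have W0 : 0 <= \int[leb3]_(x in Omega) (w x ^+ 6).
  by apply: Rintegral_ge0 => x _; rewrite exprn_even_ge0.
(* For t <= 1 the quartic term is at most t^2 times its value at t = 1, so C collects the terms of
   order t^2 without the logarithm of t. *)
pose C := gsqn h / 2 + b / 4 * gsqn h ^+ 2 - (lambda - mu) / 2 * sqn w -
  mu / 2 * \int[leb3]_(x in Omega) sqlog (w x).
have mq : 0 < - mu * sqn w by rewrite mulr_gt0// oppr_gt0.
(* With t = e^(-r) the logarithm contributes t^2 mu r sqn w. The first summand of r pushes C + mu r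
   sqn w down to -1; the second brings t w into the ball, because e^r >= 1 + r. *)
pose r := (`|C| + 1) / (- mu * sqn w) + gsqn h / s0.
have r1 : 0 <= gsqn h / s0 by rewrite divr_ge0// ltW.
have r2 : 0 <= (`|C| + 1) / (- mu * sqn w).
  by apply: divr_ge0; [have := normr_ge0 C; lra|exact: ltW].
have r0 : 0 <= r by rewrite addr_ge0.
pose t := expR (- r); have t0 : 0 < t := expR_gt0 _.
have lnt : ln (t ^+ 2) = - 2 * r.
  by rewrite lnXn// expRK mulr2n; ring.
have t1 : t <= 1 by rewrite /t -expR0 ler_expR oppr_le0.
have t2 : t ^+ 2 <= t by rewrite expr2 ler_piMl// ltW.
have tG : t ^+ 2 * gsqn h <= s0.
  apply: (@le_trans _ _ (t * gsqn h)); first by rewrite ler_wpM2r.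
  rewrite /t expRN mulrC ler_pdivrMr ?expR_gt0//.
  apply: (@le_trans _ _ (s0 * r)).
    by rewrite /r mulrDr [s0 * (gsqn h / s0)]mulrC divfK ?gt_eqF// lerDr mulr_ge0// ltW.
  rewrite ler_wpM2l ?(ltW s00)//; have := expR_ge1Dx r; lra.
exists (fun x => t * w x), (fun i x => t * h i x); split; first exact: H0Z.
  by rewrite (gsqnZ oO)// => i; exact: H0_L2g Hw.
rewrite functionalZ ?gt_eqF// lnt.
have rC : C + mu * r * sqn w <= - 1.
  have : (`|C| + 1) <= r * (- mu * sqn w).
    by rewrite /r mulrDl divfK ?gt_eqF// lerDl mulr_ge0// ltW.
  by have := ler_norm C; move: (r) => rr; lra.
have T2 : 0 < t ^+ 2 by rewrite exprn_gt0.
have t6 : 0 <= t ^+ 6 * \int[leb3]_(x in Omega) (w x ^+ 6).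
  by apply: mulr_ge0 => //; rewrite exprn_ge0// ltW.
have T1 : t ^+ 2 <= 1 by apply: le_trans t1.
have key := ler_wpM2l (ltW T2) rC; rewrite /C in key.
have G2 : b / 4 * (t ^+ 2 * gsqn h) ^+ 2 <= t ^+ 2 * (b / 4 * gsqn h ^+ 2).
  have -> : b / 4 * (t ^+ 2 * gsqn h) ^+ 2 = t ^+ 2 * t ^+ 2 * (b / 4 * gsqn h ^+ 2) by ring.
  rewrite ler_wpM2r//; last by rewrite ler_piMl// ltW.
  by apply: mulr_ge0; [apply: divr_ge0 => //; exact: ltW|exact: sqr_ge0].
move: key G2 T2 t6; move: (t ^+ 6 * _) (t ^+ 2) (gsqn h) (sqn w) => x6 T G q.
move: (Rintegral _ _ _) (b / 4 * (T * G) ^+ 2) => I p key G2 T2 x60.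
lra.
Qed.

Hypothesis hyp : 0 < b * S ^+ 3 / 12
      + (4 + b ^+ 2 * S ^+ 3)
        * (b * S ^+ 3 + Num.sqrt (b ^+ 2 * S ^+ 6 + 4 * S ^+ 3)) / 24
      + mu / 2 * expR (- (lambda / mu)) * volume Omega.

Lemma functional_sphere_gt0 u g : H0 u g -> gsqn g = s0 -> 0 < J u g.
Proof.
move=> Hu gs; apply: lt_le_trans (functional_lower b lambda oO bO S0 mu0 Hu).
by rewrite gs -/S (threshold_value b S0).
Qed.

Lemma minimizer_exists : exists u g, [/\ H0 u g, gsqn g < s0, J u g < 0 &
  forall v h, H0 v h -> gsqn h <= s0 -> J u g <= J v h].
Proof.
have [w [k [Hw ks Jw]]] := functional_negative.
pose A := [set c | exists v h, [/\ H0 v h, gsqn h <= s0 & c = J v h]].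
have Aw : A (J w k) by exists w, k.
have hA : has_inf A.
  split; first by exists (J w k).
  exists (- (s0 ^+ 3 / (6 * S ^+ 3)) + mu / 2 * expR (- (lambda / mu)) * volume Omega).
  by move=> _ [v [h [Hv hs ->]]]; exact: functional_bounded_below.
have e_ n : 0 < (n.+1%:R : R)^-1 by rewrite invr_gt0.
have /choice[vh Hvh] n : exists vh : (R * R * R -> R) * ('I_3 -> R * R * R -> R),
    [/\ H0 vh.1 vh.2, gsqn vh.2 <= s0 & J vh.1 vh.2 <= inf A + n.+1%:R^-1].
  have [_ [v [h [Hv hs ->]]] /ltW Jv] := inf_adherent (e_ n) hA.
  by exists (v, h).
have Hv n : H0 (vh n).1 (vh n).2 by case: (Hvh n).
have gv n : gsqn (vh n).2 <= s0 by case: (Hvh n).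
have [s [u [g [ks' Hu cu]]]] := H0_compact oO bO S0 Hv gv.
have [gs Ju] : gsqn g <= s0 /\ J u g <= inf A.
  apply: (@functional_lsc _ _ b lambda mu oO bO S0 b0 (fun n => (vh (s n)).1)
    (fun n => (vh (s n)).2) u g (fun n => (s n).+1%:R^-1)) => //.
    by move=> n; case: (Hvh (s n)).
  have -> : (fun n => ((s n).+1%:R : R)^-1) = (fun n => 1 * (s n).+1%:R^-1).
    by apply/funext => n; rewrite mul1r.
  exact: scaled_harmonic_cvg.
have J0 : J u g < 0 by apply: le_lt_trans Ju (le_lt_trans (ge_inf hA.2 Aw) Jw).
exists u, g; split => //.
  rewrite lt_neqAle gs andbT; apply/eqP => /(functional_sphere_gt0 Hu).
  by rewrite ltNge ltW.
by move=> v h Hvv hs; apply: (le_trans Ju); apply: (ge_inf hA.2); exists v, h.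
Qed.

End minimization.

(** * The Euler-Lagrange equation and local minimality *)

Lemma eq0_of_parabola (R : realType) (A B t0 : R) : 0 < t0 ->
  (forall t, `|t| <= t0 -> 0 <= t * A + t ^+ 2 * B) -> A = 0.
Proof.
move=> t00 H; apply/eqP; rewrite -normr_le0.
apply: (le_of_small t00 (normr_ge0 B)) => e e0 et; rewrite add0r.
have h1 := H e ltac:(by rewrite ger0_norm// ltW).
have h2 := H (- e) ltac:(by rewrite normrN ger0_norm// ltW).
have BB : e * B <= e * `|B| by rewrite ler_wpM2l ?ler_norm// ltW.
rewrite -(ler_pM2l e0) -{1}(ger0_norm (ltW e0)) -normrM ler_norml.
have := ler_wpM2l (ltW e0) BB; rewrite sqrrN in h2; rewrite mulNr in h2.
rewrite expr2 -mulrA in h1; rewrite expr2 -mulrA in h2.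
by move: (e * A) (e * (e * B)) (e * (e * `|B|)) h1 h2 => x y z h1 h2 h3; apply/andP; split; lra.
Qed.

(** The arithmetic of [functional_line]: s, c, n are the coefficients of the squared gradient norm
    along the line, q, p, qv those of the squared L^2 norm, and primes mark integrals at u + t v.
    For |t| <= 1 the terms of the Kirchhoff square beyond first order are put into the coefficient
    of t^2. *)
Lemma kirchhoff_line_le (R : realFieldType)
    (b lambda mu s c n q p qv I6 I6' I5 Il Il' M B t : R) : 0 <= b -> mu < 0 ->
  `|t| <= 1 -> I6 + 6 * t * I5 <= I6' ->
  Il' <= Il + t * (2 * M + 2 * p) + t ^+ 2 * B ->
  (s + 2 * t * c + t ^+ 2 * n) / 2 + b / 4 * (s + 2 * t * c + t ^+ 2 * n) ^+ 2
    - (lambda - mu) / 2 * (q + 2 * (t * p) + t ^+ 2 * qv) - mu / 2 * Il' - 1 / 6 * I6' <=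
  s / 2 + b / 4 * s ^+ 2 - (lambda - mu) / 2 * q - mu / 2 * Il - 1 / 6 * I6
    + t * ((1 + b * s) * c - lambda * p - mu * M - I5)
    + t ^+ 2 * (n / 2 + b / 2 * s * n + b / 4 * (8 * c ^+ 2 + 2 * n ^+ 2)
      - (lambda - mu) / 2 * qv - mu / 2 * B).
Proof.
move=> b0 mu0 t1 h6 hl.
have m2 : 0 <= - (mu / 2) by rewrite oppr_ge0 pmulr_lle0// ltW.
have hm := ler_wpM2l m2 hl.
have tn : t ^+ 2 * n ^+ 2 <= n ^+ 2.
  rewrite ler_piMl ?sqr_ge0// -(real_normK (num_real t)) expr2.
  by apply: mulr_ile1.
have sq : (2 * c + t * n) ^+ 2 <= 8 * c ^+ 2 + 2 * n ^+ 2.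
  have -> : (2 * c + t * n) ^+ 2 = 8 * c ^+ 2 + 2 * (t ^+ 2 * n ^+ 2) - (2 * c - t * n) ^+ 2.
    by ring.
  by have := sqr_ge0 (2 * c - t * n); lra.
have bt : 0 <= b / 4 * t ^+ 2 by rewrite mulr_ge0 ?sqr_ge0// divr_ge0.
have := ler_wpM2l bt sq.
have -> : b / 4 * (s + 2 * t * c + t ^+ 2 * n) ^+ 2 = b / 4 * s ^+ 2 + b * s * t * c +
  b / 2 * s * t ^+ 2 * n + b / 4 * t ^+ 2 * (2 * c + t * n) ^+ 2 by field.
move: (b / 4 * t ^+ 2 * (2 * c + t * n) ^+ 2) => X hX; lra.
Qed.

Section euler_lagrange.
Context (R : realType) (Omega : set (R * R * R)) (b lambda mu : R).
Notation T3 := (measurableTypeR R * measurableTypeR R * measurableTypeR R)%type.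
Hypotheses (oO : open Omega) (bO : bounded_set Omega)
  (S0 : 0 < sobolev_constant Omega) (b0 : 0 < b) (mu0 : mu < 0).
Let mO : measurable (Omega : set T3). Proof. exact: open_measurable3. Qed.
Let fO : (leb3 Omega < +oo)%E. Proof. exact: bounded_leb3_lty. Qed.
Notation L1 := (L1 leb3 Omega).
Notation L2 := (L2 leb3 Omega).
Notation L6 := (L6 leb3 Omega).
Notation sqn := (L2_sqn leb3 Omega).
Notation ip := (L2_ip leb3 Omega).
Notation gsqn := (grad_sqn Omega).
Notation gip := (grad_ip Omega).
Notation H0 := (H0 Omega).
Notation J := (functional Omega b lambda mu).
Implicit Types u v phi : R * R * R -> R.
Implicit Types g h : 'I_3 -> R * R * R -> R.

Definition first_variation u g v h : R :=
  (1 + b * gsqn g) * gip g h - lambda * ip u v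
  - mu * \int[leb3]_(x in Omega) (u x * v x * ln (u x ^+ 2))
  - \int[leb3]_(x in Omega) (u x ^+ 5 * v x).

Lemma gsqn_line t g h : (forall i, L2 (g i)) -> (forall i, L2 (h i)) ->
  gsqn (fun i x => g i x + t * h i x) = gsqn g + 2 * t * gip g h + t ^+ 2 * gsqn h.
Proof.
move=> lg lh; rewrite (gsqnD oO)//; last by move=> i; exact: L2Z.
rewrite (gsqnZ oO)//; congr (_ + _ + _); rewrite -mulrA; congr (_ * _).
rewrite (gipC Omega) (gipC Omega g) /grad_ip mulr_sumr.
by apply: eq_bigr => i _; rewrite (ipZl mO).
Qed.

Lemma Rint_pow6_line t u v : L6 u -> L6 v -> L6 (fun x => u x + t * v x) ->
  \int[leb3]_(x in Omega) (u x ^+ 6) + 6 * t * \int[leb3]_(x in Omega) (u x ^+ 5 * v x) <=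
  \int[leb3]_(x in Omega) ((u x + t * v x) ^+ 6).
Proof.
move=> lu lv [_ lw]; have l5 := L1_mul_pow5 mO fO lu lv; have [_ l6] := lu.
rewrite -(RintZ mO _ l5) -(RintD mO l6 (L1Z mO _ l5)); apply: (Rint_le mO _ lw).
  exact: (L1D mO l6 (L1Z mO _ l5)).
move=> x _; have := pow6_tangent (u x) (t * v x).
by have -> : 6 * u x ^+ 5 * (t * v x) = 6 * t * (u x ^+ 5 * v x) by ring.
Qed.

Lemma Rint_sqlog_line t u v : `|t| <= 1 -> L6 u -> L6 v -> L6 (fun x => u x + t * v x) ->
  \int[leb3]_(x in Omega) sqlog (u x + t * v x) <=
  \int[leb3]_(x in Omega) sqlog (u x) +
  t * (2 * \int[leb3]_(x in Omega) (u x * v x * ln (u x ^+ 2)) + 2 * ip u v) +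
  t ^+ 2 * \int[leb3]_(x in Omega) (60 * (1 + u x ^+ 6 + v x ^+ 6)).
Proof.
move=> t1 lu lv lw.
have k1 := L1_sqlog mO fO lu; have k2 := L1_mul_ln mO fO lu lv.
have k3 := L2M mO (L6_L2 mO fO lu) (L6_L2 mO fO lv).
have k4 : L1 (fun x => 60 * (1 + u x ^+ 6 + v x ^+ 6)).
  case: lu lv => _ l6 [_ l6']; apply: (L1Z mO); apply: (L1D mO _ l6').
  by apply: (L1D mO _ l6); exact: L1_cst.
have k23 := L1D mO (L1Z mO 2 k2) (L1Z mO 2 k3).
rewrite /L2_ip -(RintZ mO _ k2) -(RintZ mO _ k3) -(RintD mO (L1Z mO 2 k2) (L1Z mO 2 k3)).
rewrite -(RintZ mO _ k23) -(RintZ mO _ k4) -(RintD mO k1 (L1Z mO t k23)).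
rewrite -(RintD mO (L1D mO k1 (L1Z mO t k23)) (L1Z mO _ k4)); apply: (Rint_le mO).
- exact: (L1_sqlog mO fO lw).
- exact: (L1D mO (L1D mO k1 (L1Z mO t k23)) (L1Z mO _ k4)).
by move=> x _; exact: sqlog_second_order.
Qed.

(** An upper bound of second order is available because both nonlinear terms have a favorable sign:
    -mu/2 is positive and [sqlog_second_order] bounds the logarithmic part from above, while the
    tangent inequality handles minus the sixth power. At a minimizer [eq0_of_parabola] reads off the
    first variation. *)
Lemma functional_line u g v h : H0 u g -> H0 v h -> exists B, forall t, `|t| <= 1 ->
  J (fun x => u x + t * v x) (fun i x => g i x + t * h i x) <=
  J u g + t * first_variation u g v h + t ^+ 2 * B.
Proof.
move=> Hu Hv; have lu := H0_L6 oO bO S0 Hu; have lv := H0_L6 oO bO S0 Hv.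
have l2u := H0_L2 Hu; have l2v := H0_L2 Hv.
exists (gsqn h / 2 + b / 2 * gsqn g * gsqn h + b / 4 * (8 * gip g h ^+ 2 + 2 * gsqn h ^+ 2)
  - (lambda - mu) / 2 * sqn v
  - mu / 2 * \int[leb3]_(x in Omega) (60 * (1 + u x ^+ 6 + v x ^+ 6))) => t t1.
have lw := H0_L6 oO bO S0 (H0D oO Hu (H0Z oO t Hv)).
have h1 := Rint_pow6_line lu lv lw.
have h2 := Rint_sqlog_line t1 lu lv lw.
rewrite /functional gsqn_line; [|by move=> i; exact: H0_L2g Hu|by move=> i; exact: H0_L2g Hv].
rewrite (sqnD mO l2u (L2Z mO t l2v)) (sqnZ mO t l2v).
rewrite (ipC leb3 Omega u) (ipZl mO)// (ipC leb3 Omega v).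
rewrite /first_variation.
apply: kirchhoff_line_le; [exact: ltW|exact: mu0|exact: t1|exact: h1|exact: h2].
Qed.

Lemma weak_solution_of_min u g (s : R) : H0 u g -> gsqn g < s ->
  (forall v h, H0 v h -> gsqn h <= s -> J u g <= J v h) ->
  forall v h, H0 v h -> first_variation u g v h = 0.
Proof.
move=> Hu gs min v h Hv; have [B HB] := functional_line Hu Hv.
have lg i : L2 (g i) by exact: H0_L2g Hu.
have lh i : L2 (h i) by exact: H0_L2g Hv.
have k0 : 0 < 2 * `|gip g h| + gsqn h + 1.
  by rewrite ltr_wpDl// addr_ge0 ?gsqn_ge0// mulr_ge0.
(* For |t| <= 1 the squared gradient norm moves by at most |t| (2 |gip g h| + gsqn h), so this range
   of t stays in the ball. *)
have d0 : 0 < Num.min 1 ((s - gsqn g) / (2 * `|gip g h| + gsqn h + 1)).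
  by rewrite lt_min ltr01 divr_gt0// subr_gt0.
apply: (eq0_of_parabola (B := B) d0) => t; rewrite le_min => /andP[t1].
rewrite ler_pdivlMr// => tk.
have gt : gsqn (fun i x => g i x + t * h i x) <= s.
  rewrite gsqn_line//; have eta0 := gsqn_ge0 Omega h.
  have h1 : t * gip g h <= `|t| * `|gip g h| by rewrite -normrM ler_norm.
  have h2 : t ^+ 2 * gsqn h <= `|t| * gsqn h.
    rewrite ler_wpM2r// -(real_normK (num_real t)) expr2 ler_piMl//.
  by have := normr_ge0 t; lra.
have := HB t t1; have := min _ _ (H0D oO Hu (H0Z oO t Hv)) gt.
move: (J u g) (functional _ _ _ _ _ _) => x y; lra.
Qed.

Lemma weak_solutionE u g : H0 u g -> (forall v h, H0 v h -> first_variation u g v h = 0) ->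
  weak_solution Omega b lambda mu u.
Proof.
move=> Hu crit; split; first exact: (H0_mem_H01 oO fO Hu).
move=> phi /(mem_H01_H0 oO fO) Hp; rewrite -[RHS](crit _ _ Hp) /first_variation.
have [_ wu _] := Hu; have [_ wp _] := Hp.
rewrite (norm_H01_sqr oO fO wu) (dot_gradE oO fO wu wp) /L2_ip; congr (_ - _).
apply: eq_Rintegral => x _; rewrite -normrX ger0_norm ?exprn_even_ge0//.
by rewrite -exprSr.
Qed.

Lemma local_minimizerE u g (s : R) : H0 u g -> gsqn g < s ->
  (forall v h, H0 v h -> gsqn h <= s -> J u g <= J v h) ->
  local_minimizer Omega b lambda mu u.
Proof.
move=> Hu gs min; split; first exact: (H0_mem_H01 oO fO Hu).
have g0 := gsqn_ge0 Omega g; have d0 : 0 < s - gsqn g by rewrite subr_gt0.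
(* The gap s - gsqn g is shared equally: the weight t in Young's inequality keeps 2 t gsqn g within
   one half, and [r2] keeps (2/t + 1) times the squared gradient norm of the perturbation within the
   other. *)
pose t := (s - gsqn g) / (4 * (gsqn g + 1)).
have t0 : 0 < t by rewrite divr_gt0// mulr_gt0// ltr_wpDl.
pose r2 := (s - gsqn g) / 2 / (2 * t^-1 + 1).
have k0 : 0 < 2 * t^-1 + 1 by rewrite ltr_wpDl// mulr_ge0// invr_ge0 ltW.
have r20 : 0 < r2 by rewrite !divr_gt0.
exists (Num.sqrt r2); first by rewrite sqrtr_gt0.
move=> v /(mem_H01_H0 oO fO) Hv vu.
set h := (X in H0 _ X) in Hv; have Hk := H0B oO Hv Hu.
set k := (X in H0 _ X) in Hk; have [_ wk _] := Hk.
have k2 : gsqn k <= r2.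
  rewrite -(norm_H01_sqr oO fO wk) -[leRHS](sqr_sqrtr (ltW r20)).
  by rewrite lerXn2r ?nnegrE ?sqrtr_ge0// ltW.
rewrite (energyE b lambda mu oO bO S0 Hu) (energyE b lambda mu oO bO S0 Hv); apply: min => //.
have lg i : L2 (g i) by exact: H0_L2g Hu.
have lk i : L2 (k i) by exact: H0_L2g Hk.
have -> : h = (fun i x => g i x + k i x).
  by apply/funext => i; apply/funext => x; rewrite /k addrC subrK.
rewrite (gsqnD oO lg lk); have := gip_young oO t0 lg lk; have := ler_norm (gip g k).
have tg : t * gsqn g <= (s - gsqn g) / 4.
  rewrite /t invfM mulrA -mulrA ler_piMr ?divr_ge0 ?(ltW d0)//.
  by rewrite mulrC ler_pdivrMr ?ltr_wpDl// mul1r; lra.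
have rr : (2 * t^-1 + 1) * r2 = (s - gsqn g) / 2.
  by rewrite /r2 mulrC divfK// gt_eqF.
have rk : (2 * t^-1 + 1) * gsqn k <= (2 * t^-1 + 1) * r2 by rewrite ler_wpM2l// ltW.
rewrite rr in rk; move: (gip g k) (`|_|) (gsqn k) (gsqn g) (t^-1) tg rk => p q x y z tg rk.
lra.
Qed.

End euler_lagrange.

(** * Positivity of the Sobolev constant and conclusion *)

Lemma sobolev_constant_gt0 (R : realType) (Omega : set (R * R * R)) (b lambda mu : R) :
  mu < 0 ->
  let S := sobolev_constant Omega in
  0 < b * S ^+ 3 / 12
      + (4 + b ^+ 2 * S ^+ 3)
        * (b * S ^+ 3 + Num.sqrt (b ^+ 2 * S ^+ 6 + 4 * S ^+ 3)) / 24
      + mu / 2 * expR (- (lambda / mu)) * volume Omega -> 0 < S.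
Proof.
move=> mu0 S hyp; have S_ge0 : 0 <= S := sobolev_constant_ge0 Omega.
rewrite lt_def S_ge0 andbT; move: hyp; apply: contraTneq => ->.
have z n : (0 : R) ^+ n.+1 = 0 by rewrite expr0n.
rewrite !z !mulr0 !addr0 sqrtr0 addr0 mulr0 !mul0r !add0r -leNgt.
apply: mulr_le0_ge0; last exact: fine_ge0.
by apply: mulr_le0_ge0; [rewrite pmulr_lle0// ltW|exact: expR_ge0].
Qed.

Theorem theorem1p1 (R : realType) (Omega : set (R * R * R))
    (b lambda mu : R) :
  bounded_smooth_domain Omega -> 0 < b -> mu < 0 ->
  let S := sobolev_constant Omega in
  0 < b * S ^+ 3 / 12
      + (4 + b ^+ 2 * S ^+ 3)
        * (b * S ^+ 3 + Num.sqrt (b ^+ 2 * S ^+ 6 + 4 * S ^+ 3)) / 24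
      + mu / 2 * expR (- (lambda / mu)) * volume Omega ->
  exists u : R * R * R -> R,
    local_minimum_solution Omega b lambda mu u /\ energy Omega b lambda mu u < 0.
Proof.
move=> [_ oO _ bO _] b0 mu0 S hyp; have S0 : 0 < S := sobolev_constant_gt0 mu0 hyp.
have [u [g [Hu gs Ju min]]] := minimizer_exists oO bO S0 b0 mu0 hyp.
exists u; split; last by rewrite (energyE b lambda mu oO bO S0 Hu).
split; last exact: local_minimizerE gs min.
by apply: (weak_solutionE oO bO Hu); exact: weak_solution_of_min Hu gs min.
Qed.
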